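(* Let $q\in\{1,\dots,n-1\}$. Suppose that $\{\sigma_1,\dots,\sigma_k\}-\{\varepsilon_1,\dots,\varepsilon_{n-k}\}$ satisfies condition $(N_a)$, and that $c_q+d_q=n-q$, $c_q\ge1$ and $d_q\ge1$. If $\mu_z^q\ne z-1$ and $\rho_h^q\ne h-1$, then the following hold. (1) Let $n-k$ be even. If $n-q-c_q$ is even and $v_s^q[M]$ is nonpositive on $I\times I$, then $M\in[\lambda_*^q,\lambda_1)$; and if $n-q-c_q$ is odd and $v_s^q[M]$ is nonnegative on $I\times I$, then $M\in[\lambda_*^q,\lambda_1)$. Here $\lambda_1<0$ is the biggest negative eigenvalue of $T_n[0]$ in $X_{\{\sigma_1,\dots,\sigma_k\}}^{\{\varepsilon_1,\dots,\varepsilon_{n-k}\}}$, and $\lambda_*^q<0$ is the maximum between $\lambda_3^q<0$, the biggest negative eigenvalue of $T_n[0]$ in $X_3$, and $\lambda_5^q<0$, the biggest negative eigenvalue of $T_n[0]$ in $X_5$. (2) Let $n-k$ be odd. If $n-q-c_q$ is even and $v_s^q[M]$ is nonpositive on $I\times I$, then $M\in(\lambda_1,\lambda_*^q]$; and if $n-q-c_q$ is odd and $v_s^q[M]$ is nonnegative on $I\times I$, then $M\in(\lambda_1,\lambda_*^q]$. Here $\lambda_1>0$ is the least positive eigenvalue of $T_n[0]$ in $X_{\{\sigma_1,\dots,\sigma_k\}}^{\{\varepsilon_1,\dots,\varepsilon_{n-k}\}}$, and $\lambda_*^q>0$ is the minimum between $\lambda_3^q>0$, the least positive eigenvalue of $T_n[0]$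 in $X_3$, and $\lambda_5^q>0$, the least positive eigenvalue of $T_n[0]$ in $X_5$.
   Context: Let $n\ge 2$, $I=[a,b]$, $M\in\mathbb{R}$, $T_n[M]u=u^{(n)}+Mu$, $k\in\{1,\dots,n-1\}$, and let $0\le\sigma_1<\dots<\sigma_k\le n-1$ and $0\le\varepsilon_1<\dots<\varepsilon_{n-k}\le n-1$ be integers. For sets $A,B\subset\{0,\dots,n-1\}$ let $X_A^B=\{u\in C^n(I): u^{(i)}(a)=0\ \forall i\in A,\ u^{(j)}(b)=0\ \forall j\in B\}$. A number $\lambda\in\mathbb{R}$ is called an eigenvalue of $T_n[0]$ in $X_A^B$ if there is $u\in X_A^B$, $u\not\equiv0$, with $u^{(n)}(t)+\lambda u(t)=0$ on $I$. Condition $(N_a)$: $\#\{j:\sigma_j<h\}+\#\{j:\varepsilon_j<h\}\ge h$ for all $h\in\{1,\dots,n-1\}$. $g_M(t,s)$ denotes the Green's function of $T_n[M]$ in $X_{\{\sigma_1,\dots,\sigma_k\}}^{\{\varepsilon_1,\dots,\varepsilon_{n-k}\}}$ (any assertion about $g_M$ for a given $M$ includes that it exists, i.e. that $M$ is not an eigenvalue of $T_n[0]$ in this space), and $v_s^q[M](t)=\frac{\partial^q}{\partial t^q}g_M(t,s)$. For $q\in\{1,\dots,n-1\}$: $c_q=\#\{i:\sigma_i\ge q\}$ and $d_q=\#\{i:\varepsilon_i\ge q\}$. Let $\mu_1^q<\dots<\mu_k^q$ be the increasing enumeration of $\{\sigma_i-q:\sigma_i\ge q\}\cup\{\sigma_i-q+n:\sigma_i<q\}$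 and $\rho_1^q<\dots<\rho_{n-k}^q$ the increasing enumeration of $\{\varepsilon_i-q:\varepsilon_i\ge q\}\cup\{\varepsilon_i-q+n:\varepsilon_i<q\}$. Put $\alpha^q=\min(\{0,\dots,n-1\}\setminus\{\mu_1^q,\dots,\mu_k^q\})$ and $\beta^q=\min(\{0,\dots,n-1\}\setminus\{\rho_1^q,\dots,\rho_{n-k}^q\})$. When $c_q,d_q\ge1$ let $z=k-(j-1)$ with $j=\min\{i:\sigma_i\ge q\}$ and $h=n-k-(r-1)$ with $r=\min\{i:\varepsilon_i\ge q\}$ (so $\mu_z^q=\sigma_k-q$ and $\rho_h^q=\varepsilon_{n-k}-q$). Define $X_3=X_A^B$ with $A=(\{\mu_1^q,\dots,\mu_k^q\}\setminus\{\mu_z^q\})\cup\{\alpha^q\}$, $B=\{\rho_1^q,\dots,\rho_{n-k}^q\}$; $X_5=X_A^B$ with $A=\{\mu_1^q,\dots,\mu_k^q\}$, $B=(\{\rho_1^q,\dots,\rho_{n-k}^q\}\setminus\{\rho_h^q\})\cup\{\beta^q\}$. *)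

(* Defs.v *)
From HB Require Import structures.
From mathcomp Require Import all_boot all_order all_algebra.
From mathcomp Require Import all_classical all_reals all_analysis.

Set Implicit Arguments.
Unset Strict Implicit.
Unset Printing Implicit Defensive.

Import Order.TTheory GRing.Theory Num.Theory.
Import numFieldNormedType.Exports.

Local Open Scope classical_set_scope.
Local Open Scope ring_scope.

Section Analysis.
Context {R : realType}.
Variables a b : R.

(* Derivatives on I = [a, b] are relative to I: two-sided inside, one-sided at
   a and at b, so that only the values of f on I matter.  derivI is meaningful
   only where derivableI holds. *)
Definition derivableI (f : R -> R) (x : R) : Prop :=
  cvg ((f y - f x) / (y - x) @[y --> within `[a, b] x^']).

Definition derivI (f : R -> R) (x : R) : R :=
  lim ((f y - f x) / (y - x) @[y --> within `[a, b] x^']).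

Definition nderivI (i : nat) (f : R -> R) : R -> R := iter i derivI f.

Definition classC (n : nat) (f : R -> R) : Prop :=
  (forall i x, (i < n)%N -> x \in `[a, b] -> derivableI (nderivI i f) x) /\
  {within `[a, b], continuous (nderivI n f)}.

Definition T_op (n : nat) (M : R) (u : R -> R) (t : R) : R :=
  nderivI n u t + M * u t.

(* Sequences A and B stand for the finite sets of their elements. *)
Definition bc (A B : seq nat) (u : R -> R) : Prop :=
  (forall i, i \in A -> nderivI i u a = 0) /\
  (forall j, j \in B -> nderivI j u b = 0).

Definition X_space (n : nat) (A B : seq nat) : set (R -> R) :=
  [set u | classC n u /\ bc A B u].

(* The sign convention is u^(n) + lambda u = 0. *)
Definition eigenvalue (n : nat) (A B : seq nat) (lambda : R) : Prop :=
  exists u : R -> R,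
    [/\ X_space n A B u,
        (exists2 t, t \in `[a, b] & u t != 0) &
        forall t, t \in `[a, b] -> T_op n lambda u t = 0].

Definition biggest_negative_eigenvalue n A B (lambda : R) : Prop :=
  [/\ lambda < 0, eigenvalue n A B lambda &
      forall l, l < 0 -> eigenvalue n A B l -> l <= lambda].

Definition least_positive_eigenvalue n A B (lambda : R) : Prop :=
  [/\ 0 < lambda, eigenvalue n A B lambda &
      forall l, 0 < l -> eigenvalue n A B l -> lambda <= l].

(* i-th derivative of g in its first variable t.  For t != s it only depends on
   the values of g(., s) near t on the same side of the diagonal. *)
Definition partial_t (i : nat) (g : R -> R -> R) (t s : R) : R :=
  nderivI i (g ^~ s) t.

Definition square : set (R * R) := `[a, b] `*` `[a, b].
Definition triangle_lt : set (R * R) := square `&` [set p | p.1 < p.2].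
Definition triangle_gt : set (R * R) := square `&` [set p | p.2 < p.1].

(* The classical definition of the Green's function of T_n[M] in X_A^B, for
   n >= 2: g is C^(n-2) in t on the whole square, C^n in t off the diagonal,
   the (n-1)-th derivative in t jumps by 1 across the diagonal, and g(., s)
   solves the homogeneous problem for a < s < b.  The values at s = a and s = b
   are determined by continuity. *)
Definition is_green (n : nat) (M : R) (A B : seq nat) (g : R -> R -> R) : Prop :=
  [/\ (forall i t s, t \in `[a, b] -> s \in `[a, b] ->
         (i < n - 2)%N \/ (i < n)%N /\ t != s ->
         derivableI (partial_t i g ^~ s) t),
      (forall i, (i <= n - 2)%N ->
         {within square, continuous (fun p => partial_t i g p.1 p.2)}),
      (forall i, (i <= n)%N ->
         {within triangle_lt, continuous (fun p => partial_t i g p.1 p.2)} /\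
         {within triangle_gt, continuous (fun p => partial_t i g p.1 p.2)}),
      (forall x, x \in `]a, b[ ->
         exists lplus lminus : R,
           [/\ partial_t n.-1 g t x @[t --> x^'+] --> lplus,
               partial_t n.-1 g x s @[s --> x^'-] --> lplus,
               partial_t n.-1 g t x @[t --> x^'-] --> lminus,
               partial_t n.-1 g x s @[s --> x^'+] --> lminus &
               lplus - lminus = 1]) &
      (forall s, s \in `]a, b[ ->
         (forall t, t \in `[a, b] -> t != s -> T_op n M (g ^~ s) t = 0) /\
         bc A B (g ^~ s))].

Definition nonpositive_on_square (v : R -> R -> R) : Prop :=
  forall t s, t \in `[a, b] -> s \in `[a, b] -> v t s <= 0.

Definition nonnegative_on_square (v : R -> R -> R) : Prop :=
  forall t s, t \in `[a, b] -> s \in `[a, b] -> 0 <= v t s.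

End Analysis.

(* Index sets: tau is an increasing sequence in {0, ..., n-1}, playing the role
   of sigma or of epsilon. *)
Section Indices.
Local Open Scope nat_scope.

Definition index_seq (n m : nat) (tau : seq nat) : Prop :=
  [/\ sorted ltn tau, size tau = m & all (fun i => i < n) tau].

Definition condition_Na (n : nat) (sigma eps : seq nat) : Prop :=
  forall h, 1 <= h <= n.-1 ->
    h <= count (fun i => i < h) sigma + count (fun i => i < h) eps.

(* c_q for sigma, d_q for epsilon. *)
Definition card_ge (q : nat) (tau : seq nat) : nat := count (fun i => q <= i) tau.

(* mu^q for sigma, rho^q for epsilon. *)
Definition shifted (n q : nat) (tau : seq nat) : seq nat :=
  sort leq ([seq i - q | i <- tau & q <= i] ++ [seq i + n - q | i <- tau & i < q]).

(* alpha^q for mu^q, beta^q for rho^q: the filtered list is increasing, so its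
   head is its least element; it is nonempty as soon as size s < n. *)
Definition least_missing (n : nat) (s : seq nat) : nat :=
  head 0 [seq i <- iota 0 n | i \notin s].

(* z for sigma, h for epsilon: m - (j - 1) with m = size tau and j the 1-based
   index of the first entry >= q; find is 0-based. *)
Definition last_kept (q : nat) (tau : seq nat) : nat :=
  size tau - find (fun i => q <= i) tau.

(* s_i with the 1-based indexing of the enumerations mu and rho. *)
Definition entry (s : seq nat) (i : nat) : nat := nth 0 s i.-1.

(* (s \ {s_i}) U {least_missing n s}. *)
Definition exchange (n : nat) (s : seq nat) (i : nat) : seq nat :=
  least_missing n s :: [seq j <- s | j != entry s i].

End Indices.

(* Main.v *)
(**
With [tau = (-1)^(n-k)], an eigenvalue [lambda] for which [- tau lambda > 0]
belongs to a solution of [u^(n) = kappa u] with [tau kappa > 0].  The number of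
sign changes in the cyclic sequence [u, u', ..., u^(n)] does not increase with
[t]; it is at most the number [n - k] of free derivatives at [a], at least the
number [n - k] of conditions at [b], and its parity is that of [n - k].  Hence
it is constant, all zeros of [u] inside the interval are simple, and the signs
of the free derivatives at both end points are forced.

First eigenvalue: after rescaling, [u^(n) = tau u] on [[0, L]].  One condition
at [L] is dropped; the solution of the remaining problem is unique up to a
factor and depends continuously on [L].  It has no zero for small [L] (Rolle
and condition (N_a)), and it cannot remain positive for large [L], since mixed
monotonicity of the derivatives bounds [|u^(i+1)|] by [C |u^(i)| / L] around the
cycle.  By simplicity, the first zero enters through the end point [L], which
gives a positive eigenfunction for the eigenvalue closest to [0].

Bounds on [M]: let [p >= q] be the least order not prescribed at [a].  Near
[t = a] the [q]-th derivative of [g(., s)] has the sign of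
[G(s) = d^p g / dt^p (a, s)], and [G] solves the adjoint equation, with explicit
boundary data.  For an eigenfunction [U > 0] with eigenvalue [lambda], the
Lagrange concomitant [F] of [G] and [U] satisfies [F' = (M - lambda) G U], so the
sign of [G] together with the end point signs of [U] compares [M] with [lambda].
Up to a cyclic shift of the orders, which preserves nonzero eigenvalues, [X_3]
is the original space with the largest order at [a] replaced by [p]; the end
point [b] gives [X_5] in the same way.
*)

Require Import Defs.
From HB Require Import structures.
From mathcomp Require Import all_boot all_order all_algebra.
From mathcomp Require Import all_classical all_reals all_analysis.
From mathcomp Require Import ring lra zify.

Set Implicit Arguments.
Unset Strict Implicit.
Unset Printing Implicit Defensive.

Import Order.TTheory GRing.Theory Num.Theory.
Import numFieldNormedType.Exports.

Local Open Scope classical_set_scope.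
Local Open Scope ring_scope.

(** Two obstacles shape the development. The sign count treats all orders cyclically, whereas
    functions in the problem are differentiated only on the segment. A solution is therefore a
    sequence of functions on the whole line with [y (i + n) = kappa * y i], built from explicit
    power series, and the problem is transferred to it. Uniqueness comes from duality: the
    concomitant with an adjoint solution chosen to have unit data is constant. Secondly, the
    definition of [g] gives no differential equation in [s]. A boundary value of [g] is identified
    with the solution of a mixed adjoint problem, whose solvability follows from the jump formula
    for [g] itself.

    The two kinds of bounds differ in strictness. Against the first eigenfunction, a boundary term
    of strict sign contradicts weak monotonicity, so that end is open. Against an exchanged
    eigenfunction the boundary term has only a weak sign; the negated bound is then strict and
    forces [G = 0], so that end is closed. This boundary term is a single product: the exchange
    frees one order [j], and since [j] was the largest order at that end point, all lower
    derivatives of [G] vanish before the one paired with [j]. *)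

(** * Power series closed under differentiation *)

Section ExponentialSeries.
Context {R : realType}.
Implicit Types (c : nat -> R) (x : R).

(** Exponential generating function of [c]: division by [j!] turns differentiation into a shift of
    the coefficients. *)
Definition egf c x : R := limn (pseries (fun j => c j / j`!%:R) x).

(** Majorises the series by that of [C * exp (r * |x|)] and survives the shift, so every derivative
    converges everywhere. *)
Definition geometric_bound c :=
  exists2 C, 0 <= C & exists2 r, 0 <= r & forall j, `|c j| <= C * r ^+ j.

Lemma cvg_egf c x : geometric_bound c -> cvgn (pseries (fun j => c j / j`!%:R) x).
Proof.
move=> [C C0 [r r0 cle]]; apply: normed_cvg.
apply: (@series_le_cvg _ _ (fun j => C * exp_coeff (r * `|x|) j)).
- by move=> j; rewrite normr_ge0.
- by move=> j; rewrite mulr_ge0// /exp_coeff divr_ge0// exprn_ge0// mulr_ge0.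
- move=> j; rewrite /exp_coeff /= normrM normrM normfV normrX exprMn.
  rewrite (ger0_norm (_ : 0 <= j`!%:R))//.
  have -> : C * (r ^+ j * `|x| ^+ j / j`!%:R) = C * r ^+ j / j`!%:R * `|x| ^+ j.
    by ring.
  by rewrite ler_wpM2r ?exprn_ge0// ler_wpM2r ?invr_ge0.
rewrite (_ : (fun j => _) = C *: exp_coeff (r * `|x|)).
  exact/is_cvg_seriesZ/is_cvg_series_exp_coeff.
by apply/funext.
Qed.

Lemma geometric_bound_shift c : geometric_bound c -> geometric_bound (fun j => c j.+1).
Proof.
move=> [C C0 [r r0 cle]]; exists (C * r); first exact: mulr_ge0.
by exists r => // j; rewrite -mulrA -exprS.
Qed.

Lemma pseries_diffs_egf c :
  pseries_diffs (fun j => c j / j`!%:R) = (fun j => c j.+1 / j`!%:R).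
Proof.
apply/funext => j; by rewrite /pseries_diffs factS natrM invfM mulrCA mulVKf ?pnatr_eq0.
Qed.

Lemma is_derive_egf c x : geometric_bound c ->
  is_derive x (1 : R) (egf c) (egf (fun j => c j.+1) x).
Proof.
move=> cb; have cb1 := geometric_bound_shift cb.
have cb2 := geometric_bound_shift cb1.
rewrite /egf -pseries_diffs_egf.
(* Termwise differentiation asks for convergence of the series and of two formal derivatives at a
   point of modulus larger than [|x|]. *)
apply: (@pseries_snd_diffs _ _ (`|x| + 1)); rewrite ?pseries_diffs_egf.
- exact: cvg_egf.
- exact: cvg_egf.
- exact: cvg_egf.
by rewrite [ltRHS]ger0_norm// ltrDl.
Qed.

Lemma egf0 c : egf c 0 = c 0%N.
Proof.
apply: lim_near_cst => //; near=> m.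
have m0 : (0 < m)%N by near: m; exists 1%N.
rewrite /pseries /series /= -(prednK m0) big_nat_recl//= expr0 mulr1 fact0 divr1.
by rewrite big1 ?addr0// => i _; rewrite expr0n mulr0.
Unshelve. all: by end_near. Qed.

Lemma egfZ c a x : geometric_bound c -> egf (fun j => a * c j) x = a * egf c x.
Proof.
move=> cb; apply/cvg_lim => //.
rewrite (_ : pseries _ x = a *: pseries (fun j => c j / j`!%:R) x).
  by apply: cvgZr; apply: cvg_egf.
apply/funext => m; rewrite /pseries /series /= fctE scaler_sumr.
by apply: eq_bigr => i _; rewrite /= -!mulrA.
Qed.

End ExponentialSeries.

(** * Constancy and monotonicity from derivatives *)

Section RealCalculus.
Context {R : realType}.
Implicit Types (f g : R -> R) (x y c d : R).

Lemma is_derive_continuous f x df : is_derive x (1 : R) f df -> {for x, continuous f}.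
Proof.
by move=> dfx; apply/differentiable_continuous/derivable1_diffP; apply: ex_derive.
Qed.

Lemma is_derive_within f df (i : interval R) :
  (forall x, x \in i -> is_derive x (1 : R) f (df x)) -> {within [set` i], continuous f}.
Proof.
by move=> dfi; apply: derivable_within_continuous => x xi; case: (dfi x xi).
Qed.

Lemma derive_constant_oo f c d : (forall x, x \in `]c, d[ -> is_derive x (1 : R) f 0) ->
  {in `]c, d[ &, forall x y, f x = f y}.
Proof.
move=> df; suff lt x y : x \in `]c, d[ -> y \in `]c, d[ -> x < y -> f x = f y.
  move=> x y xI yI; case: (ltgtP x y) => [xy|yx|->//]; first exact: lt.
  by apply/esym; exact: lt.
move=> /itvP xI /itvP yI xy; apply/eqP; rewrite eq_sym -subr_eq0; apply/eqP.
have dfxy z : z \in `[x, y] -> is_derive z (1 : R) f ((fun=> 0) z).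
  move=> zI; apply: df; rewrite in_itv/= (lt_le_trans _ (_ : x <= z)) ?xI//=.
    by rewrite (le_lt_trans (_ : z <= y)) ?yI// (itvP zI).
  by rewrite (itvP zI).
have fc : {within `[x, y], continuous f} by exact: is_derive_within dfxy.
have dfo z : z \in `]x, y[ -> is_derive z (1 : R) f ((fun=> 0) z).
  by move=> zI; apply: dfxy; apply: subset_itv_oo_cc.
have [z _] := MVT xy dfo fc.
by rewrite mul0r.
Qed.

Lemma derive_constant_right f c d l :
  (forall x, x \in `]c, d[ -> is_derive x (1 : R) f 0) ->
  f x @[x --> c^'+] --> l -> forall x, x \in `]c, d[ -> f x = l.
Proof.
move=> df fl x xI; have xI' := itvP xI; apply: (cvg_unique _ _ fl) => //.
apply: cvg_near_cst; near=> z; apply: (derive_constant_oo df) => //.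
by rewrite in_itv/=; apply/andP; split=> //; near: z; apply: nbhs_right_lt; rewrite xI'.
Unshelve. all: by end_near. Qed.

Lemma derive_constant_left f c d l :
  (forall x, x \in `]c, d[ -> is_derive x (1 : R) f 0) ->
  f x @[x --> d^'-] --> l -> forall x, x \in `]c, d[ -> f x = l.
Proof.
move=> df fl x xI; have xI' := itvP xI; apply: (cvg_unique _ _ fl) => //.
apply: cvg_near_cst; near=> z; apply: (derive_constant_oo df) => //.
by rewrite in_itv/=; apply/andP; split=> //; near: z; apply: nbhs_left_gt; rewrite xI'.
Unshelve. all: by end_near. Qed.

Lemma derive_ge0_le f df x y :
  (forall z, z \in `[x, y] -> is_derive z (1 : R) f (df z)) ->
  (forall z, z \in `]x, y[ -> 0 <= df z) -> x <= y -> f x <= f y.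
Proof.
move=> dfE dfp; rewrite le_eqVlt => /predU1P[->//|xy].
have dfo z : z \in `]x, y[ -> is_derive z (1 : R) f (df z).
  by move=> zI; apply: dfE; apply: subset_itv_oo_cc.
have [z zI] := MVT xy dfo (is_derive_within dfE).
by rewrite -subr_ge0 => ->; rewrite mulr_ge0 ?dfp// subr_ge0 ltW.
Qed.

Lemma derive_gt0_lt f df x y :
  (forall z, z \in `[x, y] -> is_derive z (1 : R) f (df z)) ->
  (forall z, z \in `]x, y[ -> 0 < df z) -> x < y -> f x < f y.
Proof.
move=> dfE dfp xy.
have dfo z : z \in `]x, y[ -> is_derive z (1 : R) f (df z).
  by move=> zI; apply: dfE; apply: subset_itv_oo_cc.
have [z zI] := MVT xy dfo (is_derive_within dfE).
by rewrite -subr_gt0 => ->; rewrite mulr_gt0 ?dfp// subr_gt0.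
Qed.

End RealCalculus.

(** * Global solutions, the Lagrange concomitant and uniqueness *)

Section Solutions.
Context {R : realType}.
Implicit Types (y z G : nat -> R -> R) (kappa s t x c d : R) (n : nat).

(* [y i] plays the role of the [i]-th derivative of a solution of
   [u^(n) = kappa u]; in the notation of the equation [T_n[M] u = 0],
   [kappa = - M]. *)
Definition solution n kappa y :=
  (forall i x, is_derive x (1 : R) (y i) (y i.+1 x)) /\
  (forall i x, y (i + n)%N x = kappa * y i x).

Lemma solution_continuous n kappa y i : solution n kappa y -> continuous (y i).
Proof. by move=> [dy _] x; apply: is_derive_continuous (dy i x). Qed.

Lemma solution_basis n kappa : (0 < n)%N ->
  exists E : nat -> nat -> R -> R, forall r, (r < n)%N ->
    solution n kappa (E r) /\ forall i, (i < n)%N -> E r i 0 = (i == r)%:R.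
Proof.
move=> n0.
(* Taylor coefficients at 0 of the solution with unit data at order [r]: they obey
   [c (j + n) = kappa * c j]. *)
pose c (r j : nat) : R := kappa ^+ (j %/ n)%N * (j %% n == r)%N%:R.
have cb r i : geometric_bound (fun j => c r (j + i)%N).
  elim: i => [|i ih].
    (* The ratio is [1 + |kappa|] because enlarging the exponent [j %/ n] to [j] needs a base at
       least 1. *)
    exists 1 => //; exists (1 + `|kappa|) => [|j]; first by rewrite addr_ge0.
    rewrite addn0 mul1r /c normrM normrX.
    apply: (@le_trans _ _ (`|kappa| ^+ (j %/ n)%N)).
      by rewrite ler_piMr ?exprn_ge0//; case: eqP; rewrite ?normr1 ?normr0.
    apply: (@le_trans _ _ ((1 + `|kappa|) ^+ (j %/ n)%N)).
      by rewrite lerXn2r ?nnegrE ?addr_ge0// lerDr.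
    by rewrite ler_weXn2l ?lerDl// leq_div.
  have := geometric_bound_shift ih; congr geometric_bound.
  by apply/funext => j; rewrite addSnnS.
exists (fun r i x => egf (fun j => c r (j + i)%N) x) => r rn; split; first split.
- move=> i x; have := is_derive_egf x (cb r i); congr is_derive.
  by congr egf; apply/funext => j; rewrite addSnnS.
- move=> i x; rewrite -(egfZ _ _ (cb r i)); congr egf; apply/funext => j.
  by rewrite /c addnA divnDr// divnn n0 addn1 exprS modnDr mulrA.
- by move=> i ilt; rewrite egf0 add0n /c divn_small// modn_small// expr0 mul1r.
Qed.

Lemma solution_sum n kappa m (v : 'I_m -> R) (y : 'I_m -> nat -> R -> R) :
  (forall r, solution n kappa (y r)) ->
  solution n kappa (fun i t => \sum_(r < m) v r * y r i t).
Proof.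
move=> ys; split=> [i x|i x]; last first.
  by rewrite mulr_sumr; apply: eq_bigr => r _; rewrite (ys r).2 mulrCA.
rewrite (_ : (fun t => _) = \sum_(r < m) (v r \*: (y r i : R -> R))); last first.
  by apply/funext => t; rewrite fct_sumE.
by apply: is_derive_sum => r; apply: is_deriveZ; exact: (ys r).1.
Qed.

(** Trades interval length for the constant of the equation; [rho = 1] is translation and [rho = -1]
    reflection. *)
Lemma solution_affine n kappa y (rho c : R) : solution n kappa y ->
  solution n (kappa * rho ^+ n) (fun i t => rho ^+ i * y i (rho * t + c)).
Proof.
move=> [dy py]; split=> [i x|i x]; last by rewrite py exprD; ring.
have da : is_derive x (1 : R) (fun t : R => rho * t + c) rho.
  rewrite (_ : (fun t => _) = (rho \*: (id : R -> R)) + cst c)//.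
  by apply: is_derive_eq; rewrite addr0 /GRing.scale/= mulr1.
have dc := @is_derive1_comp _ (y i) _ x _ _ (dy i (rho * x + c)) da.
rewrite (_ : (fun t => _) = rho ^+ i \*: (y i \o (fun t => rho * t + c)))//.
by apply: is_derive_eq; rewrite /GRing.scale/= exprS; ring.
Qed.

Lemma solution_shift n kappa y c : solution n kappa y ->
  solution n kappa (fun i t => y i (t + c)).
Proof.
move=> /(solution_affine 1 c); rewrite expr1n mulr1; congr solution.
by apply/funext => i; apply/funext => t; rewrite expr1n !mul1r.
Qed.

Lemma solution_deriv n kappa y q : solution n kappa y ->
  solution n kappa (fun i => y (i + q)%N).
Proof.
by move=> [dy py]; split=> [i x|i x]; [exact: dy|rewrite addnAC py].
Qed.

Lemma solution_comb n kappa y z (a b : R) : solution n kappa y -> solution n kappa z ->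
  solution n kappa (fun i t => a * y i t + b * z i t).
Proof.
move=> [dy py] [dz pz]; split=> [i x|i x]; last by rewrite py pz; ring.
rewrite (_ : (fun t => _) = (a \*: (y i : R -> R)) + (b \*: (z i : R -> R)))//.
exact: is_deriveD.
Qed.

Lemma solution_exists n kappa t0 (v : nat -> R) : (0 < n)%N ->
  exists2 y, solution n kappa y & forall i, (i < n)%N -> y i t0 = v i.
Proof.
move=> n0; have [E EP] := solution_basis kappa n0.
exists (fun i t => \sum_(r < n) v r * E r i (t - t0)).
  apply: (@solution_sum n kappa n v (fun r i t => E r i (t - t0))) => r.
  exact/solution_shift/(EP _ _).1.
move=> i ilt; rewrite subrr (bigD1 (Ordinal ilt))//= (EP _ _).2// eqxx mulr1.
rewrite big1 ?addr0// => r /negPf rne.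
by rewrite (EP _ _).2// eq_sym (_ : (r == i :> nat) = false) ?mulr0// -rne.
Qed.

(** Lagrange's bilinear concomitant: the boundary term of [n]-fold integration by parts of
    [G * z^(n)]. *)
Definition concomitant n G z t : R := \sum_(m < n) (-1) ^+ m * G m t * z (n.-1 - m)%N t.

Lemma is_derive_concomitant n G z t :
  (forall i, (i < n)%N -> is_derive t (1 : R) (G i) (G i.+1 t)) ->
  (forall i, (i < n)%N -> is_derive t (1 : R) (z i) (z i.+1 t)) ->
  is_derive t (1 : R) (concomitant n G z)
    (G 0%N t * z n t - (-1) ^+ n * G n t * z 0%N t).
Proof.
move=> dG dz.
rewrite (_ : concomitant n G z =
  \sum_(m < n) (((-1) ^+ m : R) \*: ((G m : R -> R) * (z (n.-1 - m)%N : R -> R)))); last first.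
  apply/funext => x; rewrite /concomitant fct_sumE; apply: eq_bigr => m _.
  by rewrite -mulrA.
(* The derivative of the [m]-th summand is [f m.+1 - f m], so only the two extreme terms survive. *)
pose f m := - ((-1) ^+ m * G m t * z (n - m)%N t).
apply: (@is_derive_eq _ _ _ _ _ _ _ (\sum_(m < n) (f m.+1 - f m))); last first.
  rewrite -(big_mkord xpredT (fun m => f m.+1 - f m)) telescope_sumr// /f subnn subn0.
  by rewrite expr0 mul1r opprK addrC.
apply: is_derive_sum => m.
have dGm := dG m (ltn_ord m).
have dzm := dz (n.-1 - m)%N; have ltm : (n.-1 - m < n)%N by have := ltn_ord m; lia.
have {dzm ltm} dzm := dzm ltm; apply: is_derive_eq.
have -> : (n.-1 - m).+1 = (n - m)%N by have := ltn_ord m; lia.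
rewrite /f (_ : (n - m.+1)%N = (n.-1 - m)%N); last by lia.
by rewrite /GRing.scale/= exprS; ring.
Qed.

Lemma concomitant_cvg n G z (F : set_system R) {FF : Filter F} (g l : nat -> R) :
  (forall m, (m < n)%N -> G m t @[t --> F] --> g m) ->
  (forall m, (m < n)%N -> z m t @[t --> F] --> l m) ->
  concomitant n G z t @[t --> F] --> \sum_(m < n) (-1) ^+ m * g m * l (n.-1 - m)%N.
Proof.
move=> cG cz; rewrite /concomitant.
apply: cvg_big => [|m _]; first exact: add_continuous.
apply: cvgM; last by apply: cz; have := ltn_ord m; lia.
by apply: cvgM; [exact: cvg_cst|exact: cG].
Qed.

(** With unit data for [G] the pairing reads off a single derivative of [z]; both uniqueness results
    below rest on this choice of [G]. *)
Lemma concomitant_delta n G z t i : (i < n)%N ->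
  (forall m, (m < n)%N -> G m t = (m == n.-1 - i)%N%:R) ->
  concomitant n G z t = (-1) ^+ (n.-1 - i) * z i t.
Proof.
move=> ilt GE; have lt' : (n.-1 - i < n)%N by lia.
rewrite /concomitant (bigD1 (Ordinal lt'))//= GE// eqxx mulr1.
rewrite big1 ?addr0; first by congr (_ * z _ t); lia.
move=> m /negPf mne; rewrite GE// (_ : (nat_of_ord m == n.-1 - i)%N = false) ?mulr0 ?mul0r//.
Qed.

(** Uniqueness for functions differentiable only inside the interval: the pairing with an adjoint
    solution having unit data at [x] is constant and tends to 0 at [c]. *)
Lemma zero_right_limits n kappa z c d : c < d ->
  (forall i x, (i < n)%N -> x \in `]c, d[ -> is_derive x (1 : R) (z i) (z i.+1 x)) ->
  (forall x, x \in `]c, d[ -> z n x = kappa * z 0%N x) ->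
  (forall i, (i < n)%N -> z i t @[t --> c^'+] --> (0 : R)) ->
  forall i x, (i < n)%N -> x \in `]c, d[ -> z i x = 0.
Proof.
move=> cd dz nz lz i x ilt xI.
have [G Gs GE] := solution_exists ((-1) ^+ n * kappa) x
  (fun m => (m == n.-1 - i)%N%:R) (leq_ltn_trans (leq0n i) ilt).
have dW u : u \in `]c, d[ -> is_derive u (1 : R) (concomitant n G z) 0.
  move=> uI; apply: is_derive_eq.
    by apply: is_derive_concomitant => j jlt; [exact: Gs.1|exact: dz].
  rewrite nz//; have := Gs.2 0%N u; rewrite add0n => ->.
  by rewrite !mulrA -exprMn mulN1r opprK expr1n mul1r; ring.
have lW : concomitant n G z t @[t --> c^'+] --> (0 : R).
  have cG m : (m < n)%N -> G m t @[t --> c^'+] --> G m c.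
    by move=> _; apply: cvg_at_right_filter; exact: (solution_continuous Gs).
  have cW := concomitant_cvg (l := fun=> 0) cG lz.
  rewrite big1 in cW; first exact: cW.
  by move=> m _; rewrite mulr0.
have := derive_constant_right dW lW xI; rewrite (concomitant_delta _ ilt GE).
by move/eqP; rewrite mulf_eq0 signr_eq0 => /eqP.
Qed.

Lemma concomitant_const n kappa G y s t :
  solution n ((-1) ^+ n * kappa) G -> solution n kappa y ->
  concomitant n G y s = concomitant n G y t.
Proof.
move=> Gs ys; pose c := Num.min s t - 1; pose d := Num.max s t + 1.
apply: (@derive_constant_oo _ _ c d) => [u _||].
- apply: is_derive_eq.
    by apply: is_derive_concomitant => j jlt; [exact: Gs.1|exact: ys.1].
  have := Gs.2 0%N u; have := ys.2 0%N u; rewrite add0n => -> ->.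
  by rewrite !mulrA -exprMn mulN1r opprK expr1n mul1r; ring.
- rewrite in_itv/= /c /d; apply/andP; split.
    by rewrite ltrBlDr ltr_pwDr// ge_min lexx.
  by rewrite ltr_pwDr// le_max lexx.
- rewrite in_itv/= /c /d; apply/andP; split.
    by rewrite ltrBlDr ltr_pwDr// ge_min lexx orbT.
  by rewrite ltr_pwDr// le_max lexx orbT.
Qed.

Lemma solution_eq0 n kappa y s : (0 < n)%N -> solution n kappa y ->
  (forall i, (i < n)%N -> y i s = 0) -> forall i t, y i t = 0.
Proof.
move=> n0 ys ys0 i t; elim/ltn_ind: i => i ih.
case: (ltnP i n) => [ilt|nle]; last first.
  by rewrite -(subnK nle) ys.2 ih ?mulr0//; lia.
have [G Gs GE] := solution_exists ((-1) ^+ n * kappa) t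
  (fun m => (m == n.-1 - i)%N%:R) n0.
have := concomitant_const t s Gs ys; rewrite (concomitant_delta _ ilt GE).
rewrite /concomitant big1; last by move=> m _; rewrite ys0 ?mulr0//; have := ltn_ord m; lia.
by move/eqP; rewrite mulf_eq0 signr_eq0 => /eqP.
Qed.

Lemma solution_nonzero n kappa y s t i : (0 < n)%N -> solution n kappa y ->
  y i s != 0 -> exists2 j, (j < n)%N & y j t != 0.
Proof.
move=> n0 ys yn0; apply: contrapT => no; move/eqP: yn0; apply.
apply: (solution_eq0 (s := t)) ys _ _ _ => // j jlt; apply: contrapT => /eqP yj.
by apply: no; exists j.
Qed.

End Solutions.

(** * Signs in one-sided neighbourhoods *)

Section LocalSigns.
Context {R : realType}.
Implicit Types (f df g : R -> R) (c d t s : R).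

Lemma near_rightP (P : R -> Prop) t : (\forall u \near t^'+, P u) <->
  exists2 e, 0 < e & forall u, t < u < t + e -> P u.
Proof.
split=> [[e /= e0 Pe]|[e e0 Pe]].
  exists e => // u /andP[tu ut]; apply: Pe => //=.
  by rewrite ltr0_norm ?subr_lt0// opprB ltrBlDl.
exists e => //= u /= + tu; rewrite ltr0_norm ?subr_lt0// opprB ltrBlDl => ut.
by apply: Pe; rewrite tu ut.
Qed.

Lemma near_leftP (P : R -> Prop) t : (\forall u \near t^'-, P u) <->
  exists2 e, 0 < e & forall u, t - e < u < t -> P u.
Proof.
split=> [[e /= e0 Pe]|[e e0 Pe]].
  exists e => // u /andP[tu ut]; apply: Pe => //=.
  by rewrite gtr0_norm ?subr_gt0// ltrBlDr -ltrBlDl.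
exists e => //= u /= + tu; rewrite gtr0_norm ?subr_gt0// ltrBlDr -ltrBlDl => ut.
by apply: Pe; rewrite tu ut.
Qed.

(** Right of a zero a function has the sign of its derivative, left of it ([near_left_sign]) the
    opposite sign. All rules on sign changes come from this. *)
Lemma near_right_sign f df t s : (forall u, is_derive u (1 : R) f (df u)) ->
  f t = 0 -> (\forall u \near t^'+, 0 < s * df u) -> \forall u \near t^'+, 0 < s * f u.
Proof.
move=> dfE ft0 /near_rightP[e e0 dfp]; apply/near_rightP; exists e => // u /andP[tu ue].
have dsf z : z \in `[t, u] -> is_derive z (1 : R) (s \*: f) (s * df z).
  by move=> _; exact: is_deriveZ.
have sp z : z \in `]t, u[ -> 0 < s * df z.
  by rewrite in_itv/= => /andP[tz zu]; apply: dfp; rewrite tz (lt_trans zu).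
by have := derive_gt0_lt dsf sp tu; rewrite /= ft0 /GRing.scale/= mulr0.
Qed.

Lemma near_left_sign f df t s : (forall u, is_derive u (1 : R) f (df u)) ->
  f t = 0 -> (\forall u \near t^'-, 0 < s * df u) -> \forall u \near t^'-, 0 < - s * f u.
Proof.
move=> dfE ft0 /near_leftP[e e0 dfp]; apply/near_leftP; exists e => // u /andP[ue ut].
have dsf z : z \in `[u, t] -> is_derive z (1 : R) (s \*: f) (s * df z).
  by move=> _; exact: is_deriveZ.
have sp z : z \in `]u, t[ -> 0 < s * df z.
  by rewrite in_itv/= => /andP[uz zt]; apply: dfp; rewrite zt (lt_trans ue).
have := derive_gt0_lt dsf sp ut.
by rewrite /= ft0 /GRing.scale/= mulr0 mulNr oppr_gt0.
Qed.

Lemma asbool_near_lt0 (F : set_system R) {FF : ProperFilter F} f g s s' :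
  (\forall u \near F, 0 < s * f u) -> (\forall u \near F, 0 < s' * g u) ->
  `[< \forall u \near F, f u * g u < 0 >] = (s * s' < 0).
Proof.
move=> sf sg; have key u : 0 < s * f u -> 0 < s' * g u -> (f u * g u < 0) = (s * s' < 0).
  move=> sfu sgu; have : 0 < (s * s') * (f u * g u) by rewrite mulrACA mulr_gt0.
  by move=> h; apply/idP/idP => h'; [rewrite nmulr_lgt0 in h|rewrite nmulr_rgt0 in h].
apply/asboolP/idP => [fg|ss'].
  near F => u; rewrite -(key u); [near: u; exact: fg|near: u; exact: sf|near: u; exact: sg].
by near=> u; rewrite (key u)//; [near: u; exact: sf|near: u; exact: sg].
Unshelve. all: by end_near. Qed.

Lemma near_all_ltn (T : Type) (F : set_system T) {FF : Filter F} (P : nat -> T -> Prop) m :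
  (forall i, \forall u \near F, P i u) -> \forall u \near F, forall i, (i < m)%N -> P i u.
Proof.
move=> FP; elim: m => [|m ih]; first by near=> u.
near=> u => i; rewrite ltnS leq_eqVlt => /predU1P[->|]; first by near: u; exact: FP.
by move: i; near: u.
Unshelve. all: by end_near. Qed.

(** Supremum argument: the left condition carries the bound to [sup S], and the right condition
    carries it beyond unless [sup S = d]. *)
Lemma locally_nonincreasing_le (f : R -> nat) c d :
  (forall t, \forall u \near t^'+, (f u <= f t)%N) ->
  (forall t, \forall u \near t^'-, (f t <= f u)%N) ->
  c <= d -> (f d <= f c)%N.
Proof.
move=> fr fl cd; pose S := [set t | c <= t <= d /\ forall u, c <= u <= t -> (f u <= f c)%N].
have Sc : S c.
  by split; [rewrite lexx cd|move=> u /andP[cu uc]; rewrite (le_anti (introT andP (conj cu uc)))].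
have Sub : ubound S d by move=> t [/andP[]].
have Sup : has_sup S by split; [exists c|exists d].
have cs : c <= sup S by apply: ub_le_sup => //; exists d.
have sd : sup S <= d by apply: ge_sup => //; exists c.
have Slt u : c <= u < sup S -> (f u <= f c)%N.
  move=> /andP[cu us]; have [t St /ltW ut] := sup_gt (ex_intro _ c Sc) us.
  by apply: St.2; rewrite cu ut.
have Ss : (f (sup S) <= f c)%N.
  move: cs; rewrite le_eqVlt => /predU1P[<-//|cs].
  have /near_leftP[e e0 fe] := fl (sup S).
  pose u := Num.max c (sup S - e / 2).
  have us : u < sup S by rewrite gt_max cs/= ltrBlDr ltrDl divr_gt0.
  apply: leq_trans (fe u _) (Slt u _); last by rewrite le_max lexx us.
  by rewrite us lt_max ltrD2l ltrN2 ltr_pdivrMr// ltr_pMr ?ltr1n// orbT.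
move: sd; rewrite le_eqVlt => /predU1P[<-//|sd].
have /near_rightP[e e0 fe] := fr (sup S).
pose u := Num.min d (sup S + e / 2).
have su : sup S < u by rewrite lt_min sd/= ltrDl divr_gt0.
suff /(ub_le_sup (ex_intro _ d Sub)) : S u by rewrite leNgt su.
split; first by rewrite (le_trans cs (ltW su)) ge_min lexx.
move=> v /andP[cv vu]; have [vs|] := ltP v (sup S); first by rewrite Slt// cv vs.
rewrite le_eqVlt => /predU1P[<-//|sv]; apply: leq_trans Ss; apply: fe.
rewrite sv (le_lt_trans vu)// gt_min ltrD2l ltr_pdivrMr// ltr_pMr ?ltr1n// orbT//.
Qed.

End LocalSigns.

(** * Cyclic sign changes in the sequence of derivatives *)

Section SignChanges.
Context {R : realType}.
Variables (n : nat) (kappa : R) (y : nat -> R -> R).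
Hypotheses (n0 : (0 < n)%N) (kappa0 : kappa != 0) (ys : solution n kappa y).
Hypothesis yn0 : exists i s, y i s != 0.
Implicit Types (i : nat) (t s u : R).

Definition changeR i t : bool := `[< \forall u \near t^'+, y i u * y i.+1 u < 0 >].
Definition changeL i t : bool := `[< \forall u \near t^'-, y i u * y i.+1 u < 0 >].
(* Cyclic number of sign changes of [y 0, ..., y n] immediately to the right
   and immediately to the left of [t]. *)
Definition changesR t := (\sum_(i < n) changeR i t)%N.
Definition changesL t := (\sum_(i < n) changeL i t)%N.
Definition zeros t := (\sum_(i < n) (y i t == 0%R))%N.

Let rsign i t s := \forall u \near t^'+, 0 < s * y i u.
Let lsign i t s := \forall u \near t^'-, 0 < s * y i u.

Let sign_nz i t : y i t != 0 -> rsign i t (y i t) /\ lsign i t (y i t).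
Proof.
move=> yit; have c := solution_continuous (i := i) ys (x := t).
have h : \forall u \near t, 0 < y i t * y i u.
  have : y i t * y i u @[u --> t] --> y i t * y i t by apply: cvgM => //; exact: cvg_cst.
  by move/cvgr_gt; apply; rewrite -expr2 exprn_even_gt0.
by split; apply: cvg_within.
Qed.

Let rsign_step i t s : y i t = 0 -> rsign i.+1 t s -> rsign i t s.
Proof. by apply: near_right_sign => u; exact: ys.1. Qed.

Let lsign_step i t s : y i t = 0 -> lsign i.+1 t s -> lsign i t (- s).
Proof. by apply: near_left_sign => u; exact: ys.1. Qed.

Let nz_after i t : exists j, y (i + j)%N t != 0.
Proof.
have [i0 [s yi0]] := yn0; have [j jlt yj] := solution_nonzero t n0 ys yi0.
have nzm m : y (j + m * n)%N t != 0.
  elim: m => [|m ih]; first by rewrite mul0n addn0.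
  by rewrite mulSn addnCA addnC ys.2 mulf_neq0.
(* Periodicity moves the nonzero order [j] to [j + i * n], which is at least [i] since [n > 0]. *)
exists (j + i * n - i)%N; rewrite subnKC//.
by have : (i * 1 <= i * n)%N by [rewrite leq_mul2l n0 orbT]; lia.
Qed.

(** Every order has a definite one-sided sign: descend through the zeros from a nonzero derivative
    of order at least [i]. *)
Let rsign_ex i t : exists2 s, s != 0 & rsign i t s.
Proof.
have [j yj] := nz_after i t; elim: j i yj => [|j ih] i yj.
  by exists (y i t); [move: yj; rewrite addn0|apply: (sign_nz _).1; rewrite addn0 in yj].
have [yi0|yi] := eqVneq (y i t) 0; last by exists (y i t) => //; exact: (sign_nz _).1.
by have [|s s0 /(rsign_step yi0)] := ih i.+1; [rewrite addSnnS|exists s].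
Qed.

Let lsign_ex i t : exists2 s, s != 0 & lsign i t s.
Proof.
have [j yj] := nz_after i t; elim: j i yj => [|j ih] i yj.
  by exists (y i t); [move: yj; rewrite addn0|apply: (sign_nz _).2; rewrite addn0 in yj].
have [yi0|yi] := eqVneq (y i t) 0; last by exists (y i t) => //; exact: (sign_nz _).2.
by have [|s s0 /(lsign_step yi0)] := ih i.+1; [rewrite addSnnS|exists (- s); rewrite ?oppr_eq0].
Qed.

Lemma changeR_zero i t : y i t = 0 -> changeR i t = false.
Proof.
move=> yi0; have [s s0 rs] := rsign_ex i.+1 t.
rewrite /changeR (asbool_near_lt0 (F := t^'+) (rsign_step yi0 rs) rs).
by apply/negbTE; rewrite -leNgt -expr2 sqr_ge0.
Qed.

Lemma changeL_zero i t : y i t = 0 -> changeL i t = true.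
Proof.
move=> yi0; have [s s0 ls] := lsign_ex i.+1 t.
rewrite /changeL (asbool_near_lt0 (F := t^'-) (lsign_step yi0 ls) ls).
by rewrite mulNr oppr_lt0 -expr2 exprn_even_gt0.
Qed.

Lemma change_nonzero i t : y i t != 0 -> y i.+1 t != 0 ->
  changeR i t = (y i t * y i.+1 t < 0) /\ changeL i t = (y i t * y i.+1 t < 0).
Proof.
move=> /sign_nz[r l] /sign_nz[r' l'].
by rewrite /changeR /changeL (asbool_near_lt0 (F := t^'+) r r') (asbool_near_lt0 (F := t^'-) l l').
Qed.

Lemma near_right_regular t : \forall u \near t^'+, forall i, (i < n.+1)%N -> y i u != 0.
Proof.
apply: near_all_ltn => i; have [s s0 rs] := rsign_ex i t; near=> u.
apply: contraTneq isT => yi; have : 0 < s * y i u by near: u.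
by rewrite yi mulr0 ltxx.
Unshelve. all: by end_near. Qed.

Lemma near_left_regular t : \forall u \near t^'-, forall i, (i < n.+1)%N -> y i u != 0.
Proof.
apply: near_all_ltn => i; have [s s0 rs] := lsign_ex i t; near=> u.
apply: contraTneq isT => yi; have : 0 < s * y i u by near: u.
by rewrite yi mulr0 ltxx.
Unshelve. all: by end_near. Qed.

Lemma near_changeR t : \forall u \near t^'+, forall i, (i < n)%N ->
  (y i u * y i.+1 u < 0) = changeR i t.
Proof.
apply: near_all_ltn => i; have [s s0 rs] := rsign_ex i t.
have [s' s'0 rs'] := rsign_ex i.+1 t.
rewrite /changeR (asbool_near_lt0 (F := t^'+) rs rs'); near=> u.
have su : 0 < s * y i u by near: u.
have su' : 0 < s' * y i.+1 u by near: u.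
have : 0 < (s * s') * (y i u * y i.+1 u) by rewrite mulrACA mulr_gt0.
by move=> h; apply/idP/idP => h'; [rewrite nmulr_lgt0 in h|rewrite nmulr_rgt0 in h].
Unshelve. all: by end_near. Qed.

Lemma near_changeL t : \forall u \near t^'-, forall i, (i < n)%N ->
  (y i u * y i.+1 u < 0) = changeL i t.
Proof.
apply: near_all_ltn => i; have [s s0 rs] := lsign_ex i t.
have [s' s'0 rs'] := lsign_ex i.+1 t.
rewrite /changeL (asbool_near_lt0 (F := t^'-) rs rs'); near=> u.
have su : 0 < s * y i u by near: u.
have su' : 0 < s' * y i.+1 u by near: u.
have : 0 < (s * s') * (y i u * y i.+1 u) by rewrite mulrACA mulr_gt0.
by move=> h; apply/idP/idP => h'; [rewrite nmulr_lgt0 in h|rewrite nmulr_rgt0 in h].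
Unshelve. all: by end_near. Qed.

Lemma changes_regular t : (forall i, (i < n.+1)%N -> y i t != 0) ->
  changesR t = (\sum_(i < n) (y i t * y i.+1 t < 0)%R)%N /\
  changesL t = (\sum_(i < n) (y i t * y i.+1 t < 0)%R)%N.
Proof.
move=> yt; split; apply: eq_bigr => i _; have ilt := ltn_ord i.
  by rewrite (change_nonzero (yt _ (leqW ilt)) (yt _ _)).1.
by rewrite (change_nonzero (yt _ (leqW ilt)) (yt _ _)).2.
Qed.

Lemma near_changesR t : \forall u \near t^'+,
  changesR u = changesR t /\ changesL u = changesR t.
Proof.
near=> u.
have /changes_regular[-> ->] : forall i, (i < n.+1)%N -> y i u != 0.
  by near: u; exact: near_right_regular.
have h : forall i, (i < n)%N -> (y i u * y i.+1 u < 0) = changeR i t.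
  by near: u; exact: near_changeR.
by split; apply: eq_bigr => i _; rewrite h.
Unshelve. all: by end_near. Qed.

Lemma near_changesL t : \forall u \near t^'-,
  changesR u = changesL t /\ changesL u = changesL t.
Proof.
near=> u.
have /changes_regular[-> ->] : forall i, (i < n.+1)%N -> y i u != 0.
  by near: u; exact: near_left_regular.
have h : forall i, (i < n)%N -> (y i u * y i.+1 u < 0) = changeL i t.
  by near: u; exact: near_changeL.
by split; apply: eq_bigr => i _; rewrite h.
Unshelve. all: by end_near. Qed.

(* A zero [y i t] carries no sign change to its right and one to its left; the
   change at a nonzero entry can only be affected when the next entry is zero.
   Since [y n] and [y 0] vanish together, the zeros cancel around the cycle. *)
Lemma changesR_double_zeros t :
  (changesR t + \sum_(i < n) ((y i t == 0%R) && (y i.+1 t == 0%R)) <= changesL t)%N.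
Proof.
have key : (changesR t + \sum_(i < n) ((y i t == 0%R) && (y i.+1 t == 0%R)) + zeros t <=
    changesL t + \sum_(i < n) (y i.+1 t == 0%R))%N.
  rewrite -!big_split; apply: leq_sum => i _ /=.
  case: (eqVneq (y i t) 0) => [yi|yi].
    by rewrite changeR_zero// changeL_zero//=; case: eqP.
  have [yi1|yi1] /= := eqVneq (y i.+1 t) 0.
    by rewrite !addn0 (leq_trans (leq_b1 _))// addn1.
  by rewrite !addn0 (change_nonzero yi yi1).1 (change_nonzero yi yi1).2.
suff : zeros t = (\sum_(i < n) (y i.+1 t == 0%R))%N by move: key => /[swap] <-; rewrite leq_add2r.
have yn : (y n t == 0) = (y 0%N t == 0).
  by have := ys.2 0%N t; rewrite add0n => ->; rewrite mulf_eq0 (negPf kappa0).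
rewrite /zeros -(big_mkord xpredT (fun i => nat_of_bool (y i t == 0%R))).
rewrite -(big_mkord xpredT (fun i => nat_of_bool (y i.+1 t == 0%R))).
move: yn; case: (n) n0 => // m _ yn.
by rewrite big_nat_recl// big_nat_recr//= yn addnC.
Qed.

Lemma changesR_le_changesL t : (changesR t <= changesL t)%N.
Proof. by apply: leq_trans (changesR_double_zeros t); rewrite leq_addr. Qed.

(** A zero carries no right change, so each of the [n] positions counts at most once. *)
Lemma changesR_zeros t : (changesR t + zeros t <= n)%N.
Proof.
rewrite -[leqRHS]mul1n -[in leqRHS](card_ord n) mulnC -sum_nat_const.
rewrite /changesR /zeros -big_split; apply: leq_sum => i _ /=.
by case: eqP => [/changeR_zero->//|_]; rewrite addn0 leq_b1.
Qed.

Lemma zeros_changesL t : (zeros t <= changesL t)%N.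
Proof. by apply: leq_sum => i _; case: eqP => [/changeL_zero->|]. Qed.

(** Just after [t] the count stays [changesR t]; just before, it is [changesL t], which dominates
    [changesR t]. *)
Lemma changesR_le s t : s <= t -> (changesR t <= changesR s)%N.
Proof.
apply: (@locally_nonincreasing_le _ changesR) => {s}t.
  near=> u.
  have [-> _] : changesR u = changesR t /\ changesL u = changesR t; last by [].
  by near: u; exact: near_changesR.
near=> u.
have [-> _] : changesR u = changesL t /\ changesL u = changesL t by near: u; exact: near_changesL.
exact: changesR_le_changesL.
Unshelve. all: by end_near. Qed.

Lemma changesL_le_changesR s t : s < t -> (changesL t <= changesR s)%N.
Proof.
move=> st; near t^'- => u.
have [<- _] : changesR u = changesL t /\ changesL u = changesL t by near: u; exact: near_changesL.
by apply: changesR_le; apply: ltW; near: u; exact: nbhs_left_gt.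
Unshelve. all: by end_near. Qed.

Lemma odd_changes (p : nat -> R) j m : (j <= m)%N ->
  (forall i, (j <= i <= m)%N -> p i != 0) ->
  odd (\sum_(j <= i < m) (p i * p i.+1 < 0)%R) = (p j * p m < 0).
Proof.
move=> /subnKC <-; elim: (m - j)%N => [|d ih] p0.
  by rewrite addn0 big_geq//=; apply/esym/negbTE; rewrite -leNgt -expr2 sqr_ge0.
rewrite addnS big_nat_recr ?leq_addr//= oddD ih; last by move=> i /andP[? ?]; apply: p0; lia.
have p1 : p j != 0 by apply: p0; lia.
have p2 : p (j + d)%N != 0 by apply: p0; lia.
have p3 : p (j + d).+1 != 0 by apply: p0; lia.
case: (ltgtP (p j) 0) p1 => // p1 _; case: (ltgtP (p (j + d)%N) 0) p2 => // p2 _;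
case: (ltgtP (p (j + d).+1) 0) p3 => // p3 _;
rewrite ?(nmulr_llt0 _ p1) ?(nmulr_rlt0 _ p1) ?(pmulr_rlt0 _ p1)
  ?(nmulr_rlt0 _ p2) ?(pmulr_rlt0 _ p2) ?p2 ?p3;
by rewrite ?(lt_gtF p1) ?(lt_gtF p2) ?(lt_gtF p3).
Qed.

(** A full cycle runs from [y 0] to [y n = kappa * y 0], so the sign of [kappa] fixes the parity. *)
Lemma odd_changesR t : odd (changesR t) = (kappa < 0).
Proof.
near t^'+ => u; have yu : forall i, (i < n.+1)%N -> y i u != 0.
  by near: u; exact: near_right_regular.
have [<- _] : changesR u = changesR t /\ changesL u = changesR t by near: u; exact: near_changesR.
rewrite (changes_regular yu).1.
rewrite -(big_mkord xpredT (fun i => nat_of_bool (y i u * y i.+1 u < 0)%R)).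
rewrite (@odd_changes (y ^~ u) 0 n (leq0n n) (fun i h => yu i (proj2 (andP h)))).
have := ys.2 0%N u; rewrite add0n => ->.
by rewrite mulrCA -expr2 pmulr_llt0// exprn_even_gt0//= yu.
Unshelve. all: by end_near. Qed.

Lemma odd_changesL t : odd (changesL t) = (kappa < 0).
Proof.
near t^'- => u.
have [<- _] : changesR u = changesL t /\ changesL u = changesL t by near: u; exact: near_changesL.
exact: odd_changesR.
Unshelve. all: by end_near. Qed.

(** Signs are compared with the entry of order [n], whose sign is known as soon as that of [y 0]
    is. *)
Lemma near_right_sign_last t j : (j <= n)%N -> \forall u \near t^'+,
  (y j u * y n u < 0) = odd (\sum_(j <= i < n) changeR i t).
Proof.
move=> jn; near=> u; have yu : forall i, (i < n.+1)%N -> y i u != 0.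
  by near: u; exact: near_right_regular.
have h : forall i, (i < n)%N -> (y i u * y i.+1 u < 0) = changeR i t.
  by near: u; exact: near_changeR.
rewrite -(@odd_changes (y ^~ u) j n jn (fun i h => yu i (proj2 (andP h)))).
by congr odd; apply: eq_big_nat => i /andP[_ ilt]; rewrite h.
Unshelve. all: by end_near. Qed.

Lemma near_left_sign_last t j : (j <= n)%N -> \forall u \near t^'-,
  (y j u * y n u < 0) = odd (\sum_(j <= i < n) changeL i t).
Proof.
move=> jn; near=> u; have yu : forall i, (i < n.+1)%N -> y i u != 0.
  by near: u; exact: near_left_regular.
have h : forall i, (i < n)%N -> (y i u * y i.+1 u < 0) = changeL i t.
  by near: u; exact: near_changeL.
rewrite -(@odd_changes (y ^~ u) j n jn (fun i h => yu i (proj2 (andP h)))).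
by congr odd; apply: eq_big_nat => i /andP[_ ilt]; rewrite h.
Unshelve. all: by end_near. Qed.

Lemma zerosE t : zeros t = size [seq i <- iota 0 n | y i t == 0].
Proof.
rewrite size_filter -sum1_count big_mkcond /zeros.
rewrite -(big_mkord xpredT (fun i => nat_of_bool (y i t == 0%R))).
by rewrite /index_iota subn0; apply: eq_bigr => i _; case: eqP.
Qed.

Lemma size_le_zeros t (A : seq nat) : uniq A -> all (fun i => (i < n)%N) A ->
  {in A, forall i, y i t = 0} -> (size A <= zeros t)%N.
Proof.
move=> uA /allP An yA; rewrite zerosE; apply: uniq_leq_size => // i iA.
by rewrite mem_filter yA// eqxx mem_iota add0n An.
Qed.

Lemma size_eq_zeros t (A : seq nat) : uniq A -> all (fun i => (i < n)%N) A ->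
  {in A, forall i, y i t = 0} -> (zeros t <= size A)%N ->
  forall i, (i < n)%N -> (y i t == 0) = (i \in A).
Proof.
move=> uA /allP An yA; rewrite zerosE => sz i ilt.
have sub : {subset A <= [seq i <- iota 0 n | y i t == 0]}.
  by move=> j jA; rewrite mem_filter yA// eqxx mem_iota add0n An.
have [_ /(_ i) ->] := uniq_min_size uA sub sz.
by rewrite mem_filter mem_iota leq0n add0n ilt !andbT.
Qed.

(** Equality in [changesR_zeros] is equality in every position; [changeL_eq] does the same for
    [zeros_changesL]. *)
Lemma changeR_eq t : (changesR t + zeros t)%N = n ->
  forall i, (i < n)%N -> changeR i t = (y i t != 0).
Proof.
move=> e i ilt.
have le1 (k : 'I_n) : true -> (changeR k t + (y k t == 0%R) <= 1 ?=
    iff (changeR k t + (y k t == 0%R) == 1)%N)%N.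
  by move=> _; split=> //; case: (y k t =P 0) => [/changeR_zero->//|_]; rewrite addn0 leq_b1.
have [_] := leqif_sum le1; rewrite big_split /= [X in (X == _)%N]e.
rewrite sum_nat_const card_ord muln1 eqxx.
move=> /esym/forallP/(_ (Ordinal ilt)) /=; case: (y i t =P 0) => [/changeR_zero->//|_].
by rewrite addn0 eqb1.
Qed.

Lemma changeL_eq t : changesL t = zeros t ->
  forall i, (i < n)%N -> changeL i t = (y i t == 0).
Proof.
move=> e i ilt.
have le1 (k : 'I_n) : true -> ((y k t == 0%R) <= changeL k t ?=
    iff ((y k t == 0%R) == changeL k t :> nat))%N.
  by move=> _; split=> //; case: (y k t =P 0) => [/changeL_zero->|].
have [_] := leqif_sum le1; rewrite [X in (_ == X)%N]e eqxx.
move=> /esym/forallP/(_ (Ordinal ilt)) /=.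
by case: (y i t == 0); case: (changeL i t).
Qed.

(** The zeros at [c] leave at most [N] changes, those at [d] force at least [N - 1], and parity
    excludes [N - 1]. The slack of one zero at [d] is what lets the shooting argument drop a
    condition. *)
Lemma changes_rigid c d N : c < d -> (N <= n)%N -> odd N = (kappa < 0) ->
  (n - N <= zeros c)%N -> (N <= (zeros d).+1)%N ->
  [/\ changesR c = N, changesL d = N, (zeros c <= n - N)%N &
      forall t, c < t < d -> changesR t = N /\ changesL t = N].
Proof.
move=> cd Nn oN zc zd; have R1 := changesR_zeros c; have L1 := zeros_changesL d.
have LR := changesL_le_changesR cd.
have cN : changesR c = N.
  have := odd_changesR c; have := odd_changesL d; rewrite -oN => o1 o2.
  have [e|] := eqVneq (changesR c) N; first by [].
  by lia.
have dN : changesL d = N.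
  by have := odd_changesL d; rewrite -oN => o1; lia.
split=> //; first by lia.
move=> t /andP[ct td]; have := changesL_le_changesR td; have := changesL_le_changesR ct.
by have := changesR_le_changesL t; lia.
Qed.

Lemma no_double_zero t : (1 < n)%N -> changesR t = changesL t ->
  y 0%N t = 0 -> y 1%N t != 0.
Proof.
move=> n1 RL y0; apply/negP => /eqP y1; have := changesR_double_zeros t.
rewrite -RL -leq_subRL// subnn leqn0 sum_nat_eq0 => /forallP/(_ (Ordinal n0)).
by rewrite /= y0 y1 eqxx.
Qed.

End SignChanges.

(** Cyclic search: a run of indices violating [P] has length at most [n]. *)
Lemma next_index n (P : pred nat) i0 i : (i < n)%N -> (i0 < n)%N -> P i0 -> P (i0 + n)%N ->
  exists2 j, (j <= n)%N & P (i + j)%N /\ forall l, (l < j)%N -> ~~ P (i + l)%N.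
Proof.
move=> ilt i0lt P0 P1; have ex : exists j, P (i + j)%N.
  by exists (i0 + n - i)%N; rewrite subnKC//; lia.
have [j Pj jmin] := ex_minnP ex; exists j; last first.
  by split=> // l lj; apply/negP => /jmin; rewrite leqNgt lj.
case: (leqP i i0) => ii0.
  by apply: leq_trans (jmin (i0 - i)%N _) _; rewrite ?subnKC//; lia.
by apply: leq_trans (jmin (i0 + n - i)%N _) _; rewrite ?subnKC//; lia.
Qed.

(** * A positive solution cannot live on a long interval *)

Section PositiveSolutionsOnLongIntervals.
Context {R : realType}.
Variables (n : nat) (kappa : R) (y : nat -> R -> R).
Hypotheses (n0 : (0 < n)%N) (ys : solution n kappa y).

(** If one derivative has constant sign, the derivative one order below is strictly monotone and
    keeps its sign on one half, chosen by its value at the midpoint. Each order costs a factor 2 in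
    length. *)
Lemma one_signed_subinterval (c d : R) m j : c < d -> (j <= m)%N ->
  (exists s, forall t, c < t < d -> 0 < s * y m t) ->
  exists c' d', [/\ c <= c', d' <= d, d' - c' = (d - c) / 2 ^+ j &
    forall i, (m - j <= i <= m)%N -> exists s, forall t, c' < t < d' -> 0 < s * y i t].
Proof.
move=> cd; elim: j => [|j ih] jm sm.
  exists c, d; split=> //; first by rewrite expr0 divr1.
  by move=> i; rewrite subn0 -eqn_leq => /eqP<-.
have [c' [d' [cc' dd' len H]]] := ih (ltnW jm) sm.
have cd' : c' < d' by rewrite -subr_gt0 len divr_gt0 ?subr_gt0// exprn_gt0.
have [|s sy] := H (m - j)%N; first by rewrite leqnn leq_subr.
pose p := (c' + d') / 2; have pE := midf_lt cd'; have [cp pd] := pE.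
have iE : (m - j)%N = (m - j.+1).+1 by lia.
have mono u v : c' < u -> u < v -> v < d' -> s * y (m - j.+1) u < s * y (m - j.+1) v.
  move=> cu uv vd; apply: (@derive_gt0_lt _ (s \*: (y (m - j.+1)%N : R -> R))
    (fun z => s * y (m - j)%N z)) => // [z _|z /itvP zI].
    by rewrite iE; apply: is_deriveZ; exact: ys.1.
  by apply: sy; rewrite (lt_trans cu) ?zI//= (lt_trans _ vd) ?zI.
have hlen : (d' - c') / 2 = (d - c) / 2 ^+ j.+1 by rewrite len exprS; field.
have [py|py] := leP 0 (s * y (m - j.+1)%N p).
  exists p, d'; split=> //; first by rewrite (le_trans cc') ?ltW.
    by rewrite -hlen /p; field.
  move=> i /andP[ji im]; have [->|ne] := eqVneq i (m - j.+1)%N.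
    by exists s => t /andP[pt td]; apply: le_lt_trans py _; apply: mono.
  have [|s' s'y] := H i; first by apply/andP; split=> //; lia.
  by exists s' => t /andP[pt td]; apply: s'y; rewrite (lt_trans cp).
exists c', p; split=> //; first by rewrite (le_trans _ dd') ?ltW.
  by rewrite -hlen /p; field.
move=> i /andP[ji im]; have [->|ne] := eqVneq i (m - j.+1)%N.
  exists (- s) => t /andP[ct tp]; rewrite mulNr oppr_gt0; apply: lt_trans py.
  exact: mono.
have [|s' s'y] := H i; first by apply/andP; split=> //; lia.
by exists s' => t /andP[pt td]; apply: s'y; rewrite (lt_trans td) ?pt.
Qed.

Section Quotients.
Variables (c d : R).
Hypotheses (cd : c < d) (y_sign : forall i t, c <= t <= d -> 0 < y i c * y i t).

Let sg i := Num.sg (y i c).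

Let yc_neq0 i : y i c != 0.
Proof.
have := @y_sign i c; rewrite lexx ltW//= => /(_ isT).
by apply: contraTneq => ->; rewrite mul0r ltxx.
Qed.

Let sgy i t : c <= t <= d -> 0 < sg i * y i t.
Proof.
move=> ctd; have h := y_sign i ctd; have := yc_neq0 i; rewrite /sg.
case: (ltgtP (y i c) 0) => // yc _; first by rewrite ltr0_sg// mulN1r oppr_gt0 -(nmulr_rgt0 _ yc).
by rewrite gtr0_sg// mul1r -(pmulr_rgt0 _ yc).
Qed.

Let sg_plus i : 0 < y i c * y i.+1 c -> sg i.+1 = sg i.
Proof.
rewrite /sg; case: (ltgtP (y i c) 0) (yc_neq0 i) => // yi _ h.
  by rewrite (ltr0_sg yi) ltr0_sg// -(nmulr_rgt0 _ yi).
by rewrite (gtr0_sg yi) gtr0_sg// -(pmulr_rgt0 _ yi).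
Qed.

Let sg_minus i : y i c * y i.+1 c < 0 -> sg i.+1 = - sg i.
Proof.
rewrite /sg; case: (ltgtP (y i c) 0) (yc_neq0 i) => // yi _ h.
  by rewrite (ltr0_sg yi) opprK gtr0_sg// -(nmulr_rlt0 _ yi).
by rewrite (gtr0_sg yi) ltr0_sg// -(pmulr_rlt0 _ yi).
Qed.

(* Along a run of [j] increasing moduli followed by a decreasing one, the
   logarithmic derivative of [|y i|] is at most [j / (t - c)]. *)
Lemma increasing_run i j : (forall l, (l < j)%N -> 0 < y (i + l)%N c * y (i + l).+1 c) ->
  y (i + j)%N c * y (i + j).+1 c < 0 ->
  forall t, c <= t <= d -> (t - c) * (sg i * y i.+1 t) <= j%:R * (sg i * y i t).
Proof.
elim: j i => [|j ih] i plus minus t ctd; have /andP[ct td] := ctd.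
  rewrite mul0r; rewrite addn0 in minus.
  rewrite nmulr_lle0 ?subr_ge0// -[sg i]opprK -sg_minus// mulNr oppr_lt0.
  exact: sgy.
have e0 : sg i.+1 = sg i by apply: sg_plus; have := plus 0%N isT; rewrite addn0.
have IH u : c <= u <= d -> (u - c) * (sg i * y i.+2 u) <= j%:R * (sg i * y i.+1 u).
  rewrite -e0; apply: ih; last by rewrite addSnnS.
  by move=> l lj; have := plus l.+1 lj; rewrite addnS addSn.
(* The sign of [h'] is the induction hypothesis at the next order; the extra unit in [j.+1] absorbs
   the derivative of the factor [u - c]. *)
pose h u := j.+1%:R * (sg i * y i u) - (u - c) * (sg i * y i.+1 u).
suff : 0 <= h t by rewrite subr_ge0.
have hc : 0 <= h c.
  by rewrite /h subrr mul0r subr0 mulr_ge0// ltW// sgy// lexx ltW.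
apply: (le_trans hc).
pose dh u := j%:R * (sg i * y i.+1 u) - (u - c) * (sg i * y i.+2 u).
have dhE u : u \in `[c, t] -> is_derive u (1 : R) h (dh u).
  move=> _; have d0 := ys.1 i u; have d1 := ys.1 i.+1 u.
  rewrite (_ : h = (j.+1%:R * sg i) \*: (y i : R -> R) -
     ((id : R -> R) - cst c) * (sg i \*: (y i.+1 : R -> R))); last first.
    by apply/funext => v; rewrite /h /GRing.scale/= mulrA.
  apply: is_derive_eq; rewrite /GRing.scale/= !fctE /GRing.scale/= subr0 -natr1 /dh; ring.
apply: (derive_ge0_le dhE _ ct) => u /itvP uI.
rewrite /dh subr_ge0; apply: IH; rewrite uI/=.
by rewrite (le_trans _ td) ?uI.
Qed.

(** Mirror image of [increasing_run], weighted by the distance to [d]. *)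
Lemma decreasing_run i j : (forall l, (l < j)%N -> y (i + l)%N c * y (i + l).+1 c < 0) ->
  0 < y (i + j)%N c * y (i + j).+1 c ->
  forall t, c <= t <= d -> (d - t) * (- (sg i * y i.+1 t)) <= j%:R * (sg i * y i t).
Proof.
elim: j i => [|j ih] i minus plus t ctd; have /andP[ct td] := ctd.
  rewrite mul0r; rewrite addn0 in plus.
  by rewrite mulrN oppr_le0 mulr_ge0 ?subr_ge0// -sg_plus// ltW// sgy.
have e0 : sg i.+1 = - sg i by apply: sg_minus; have := minus 0%N isT; rewrite addn0.
have IH u : c <= u <= d -> (d - u) * (sg i * y i.+2 u) <= - (j%:R * (sg i * y i.+1 u)).
  move=> cu; have := ih i.+1 _ _ u cu; rewrite e0 !mulNr opprK mulrN; apply.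
    by move=> l lj; have := minus l.+1 lj; rewrite addnS addSn.
  by rewrite addSnnS.
pose h u := (u - d) * (sg i * y i.+1 u) - j.+1%:R * (sg i * y i u).
suff : h t <= 0 by rewrite /h mulrN; lra.
have hd : h d <= 0.
  by rewrite /h subrr mul0r sub0r oppr_le0 mulr_ge0// ltW// sgy// lexx ltW.
apply: le_trans hd.
pose dh u := - (j%:R * (sg i * y i.+1 u) + (d - u) * (sg i * y i.+2 u)).
have dhE u : u \in `[t, d] -> is_derive u (1 : R) h (dh u).
  move=> _; have d0 := ys.1 i u; have d1 := ys.1 i.+1 u.
  rewrite (_ : h = ((id : R -> R) - cst d) * (sg i \*: (y i.+1 : R -> R)) -
     (j.+1%:R * sg i) \*: (y i : R -> R)); last first.
    by apply/funext => v; rewrite /h /GRing.scale/= mulrA.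
  apply: is_derive_eq; rewrite /GRing.scale/= !fctE /GRing.scale/= subr0 -natr1 /dh; ring.
apply: (derive_ge0_le dhE _ td) => u /itvP uI.
rewrite /dh oppr_ge0 -lerBrDl sub0r; apply: IH; rewrite uI/= andbT.
by rewrite (le_trans ct) ?uI.
Qed.

(** At the midpoint [|y i.+1|] is at most [n / ((d - c) / 2)] times [|y i|]; since [|y n| = |y 0|],
    the product of these [n] factors is at least 1. Both sign relations occur, so every run ends
    within one cycle. *)
Lemma mixed_signs_length_le : `|kappa| = 1 ->
  (exists2 i, (i < n)%N & 0 < y i c * y i.+1 c) ->
  (exists2 i, (i < n)%N & y i c * y i.+1 c < 0) -> (d - c) / 2 <= n%:R.
Proof.
move=> k1 [ip ipn plus] [im imn minus].
have kn0 : kappa != 0 by rewrite -normr_eq0 k1 oner_eq0.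
have per i : y (i + n)%N c * y (i + n).+1 c = kappa ^+ 2 * (y i c * y i.+1 c).
  by rewrite -addSn !ys.2; ring.
have k2 : 0 < kappa ^+ 2 by rewrite exprn_even_gt0.
have nz i : y i c * y i.+1 c != 0 by rewrite mulf_neq0.
pose p := (c + d) / 2.
have pI : c <= p <= d by have [] := midf_lt cd; rewrite /p => /ltW-> /ltW->.
have pc : p - c = (d - c) / 2 by rewrite /p; field.
have dp : d - p = (d - c) / 2 by rewrite /p; field.
have step i : (i < n)%N -> (d - c) / 2 * `|y i.+1 p| <= n%:R * `|y i p|.
  move=> ilt.
  have ay m : `|y m p| = sg m * y m p.
    have := sgy m pI; rewrite /sg; case: sgrP (yc_neq0 m) => // _ _.
      by rewrite mul1r => /gtr0_norm.
    by rewrite mulN1r oppr_gt0 => /ltr0_norm.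
  case: (ltgtP 0 (y i c * y i.+1 c)) (nz i) => // hi _.
    have [|j jn [Pj jmin]] :=
        next_index (P := fun m => y m c * y m.+1 c < 0) ilt imn minus.
      by rewrite /= per pmulr_rlt0.
    have := increasing_run _ Pj pI; rewrite pc => h.
    rewrite (ay i.+1) (sg_plus hi) (ay i); apply: le_trans (h _) _ => [l lj|].
      by rewrite lt_neqAle eq_sym nz leNgt jmin.
    by rewrite ler_wpM2r ?ler_nat// ltW// sgy.
  have [|j jn [Pj jmin]] :=
      next_index (P := fun m => 0 < y m c * y m.+1 c) ilt ipn plus.
    by rewrite /= per pmulr_rgt0.
  have := decreasing_run _ Pj pI; rewrite dp => h.
  rewrite (ay i.+1) (sg_minus hi) mulNr (ay i); apply: le_trans (h _) _ => [l lj|].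
    by rewrite lt_neqAle nz leNgt jmin.
  by rewrite ler_wpM2r ?ler_nat// ltW// sgy.
rewrite leNgt; apply/negP => big.
have y0p : 0 < `|y 0%N p|.
  by rewrite normr_gt0; have := sgy 0%N pI; apply: contraTneq => ->; rewrite mulr0 ltxx.
have chain m : (m <= n)%N -> ((d - c) / 2) ^+ m * `|y m p| <= n%:R ^+ m * `|y 0%N p|.
  elim: m => [|m ih] mn; first by rewrite !expr0 !mul1r.
  rewrite exprSr -mulrA; apply: (@le_trans _ _ (((d - c) / 2) ^+ m * (n%:R * `|y m p|))).
    by rewrite ler_wpM2l ?step// exprn_ge0// divr_ge0// subr_ge0 ltW.
  by rewrite mulrCA exprS -mulrA ler_wpM2l// ih// ltnW.
have := chain n (leqnn n); have := ys.2 0%N p; rewrite add0n => ->.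
rewrite normrM k1 mul1r leNgt => /negP; apply.
by rewrite ltr_pM2r// ltrXn2r// -lt0n.
Qed.

End Quotients.

(** The constant: [n] halvings give [2 ^ n], trimming both ends and passing to the midpoint give 4,
    the cycle estimate gives [n]. The bounds on [N] provide both sign relations. *)
Lemma positive_solution_length_le (c d : R) N : `|kappa| = 1 -> (0 < N < n)%N ->
  c < d -> (forall t, c < t < d -> 0 < y 0%N t) ->
  (forall t, c < t < d -> changesR n y t = N) -> d - c <= (2 ^ n * 4 * n)%:R.
Proof.
move=> k1 /andP[N0 Nn] cd y0 yN.
have kn0 : kappa != 0 by rewrite -normr_eq0 k1 oner_eq0.
have [|c' [d' [cc' dd' len H]]] := @one_signed_subinterval c d n n cd (leqnn n).
  exists kappa => t /y0 yt; have := ys.2 0%N t; rewrite add0n => ->.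
  by rewrite mulrA -expr2 mulr_gt0// exprn_even_gt0.
have cd' : c' < d' by rewrite -subr_gt0 len divr_gt0 ?subr_gt0// exprn_gt0.
(* Trimming makes the signs hold on a closed interval, whose left end serves as base point. *)
pose l := (d' - c') / 4; have l0 : 0 < l by rewrite divr_gt0 ?subr_gt0.
have sgn i t : (i < n)%N -> c' + l <= t <= d' - l -> 0 < y i (c' + l) * y i t.
  move=> ilt /andP[t1 t2]; have [|s sy] := H i; first by rewrite subnn (ltnW ilt).
  have : 0 < (s * y i (c' + l)) * (s * y i t).
    rewrite mulr_gt0// sy//; last by apply/andP; split; lra.
    by apply/andP; split; rewrite ?ltrDl//; rewrite /l; lra.
  rewrite mulrACA -expr2 pmulr_rgt0//; rewrite exprn_even_gt0//=.
  have : 0 < s * y i ((c' + d') / 2) by apply: sy; have [-> ->] := midf_lt cd'.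
  by apply: contraTneq => ->; rewrite mul0r ltxx.
have sgn' i t : c' + l <= t <= d' - l -> 0 < y i (c' + l) * y i t.
  elim/ltn_ind: i => i ih ct; case: (ltnP i n) => [ilt|ni]; first exact: sgn.
  rewrite -(subnK ni) !ys.2 mulrACA -expr2 pmulr_rgt0 ?exprn_even_gt0// ih//; lia.
have cl : c' + l <= c' + l <= d' - l by rewrite lexx/= /l; lra.
have nz i : y i (c' + l) != 0.
  by have := sgn' i _ cl; apply: contraTneq => ->; rewrite mul0r ltxx.
have NE : (\sum_(i < n) (y i (c' + l) * y i.+1 (c' + l) < 0)%R)%N = N.
  rewrite -(yN (c' + l)); last by apply/andP; split; rewrite /l; lra.
  have := @changes_regular _ n kappa y ys (c' + l) (fun i _ => nz i); by case=> ->.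
have pos : (exists2 i, (i < n)%N & 0 < y i (c' + l) * y i.+1 (c' + l)).
  apply: contrapT => no; move: Nn; rewrite -NE ltnNge => /negP; apply.
  rewrite -[leqLHS]mul1n -[in leqLHS](card_ord n) mulnC -sum_nat_const; apply: leq_sum => i _.
  rewrite lt0b ltNge le_eqVlt negb_or eq_sym mulf_neq0//=; apply/negP => h.
  by apply: no; exists i.
have neg : (exists2 i, (i < n)%N & y i (c' + l) * y i.+1 (c' + l) < 0).
  apply: contrapT => no; move: N0; rewrite -NE lt0n sum_nat_eq0 => /negP; apply.
  by apply/forallP => i; apply/implyP => _; rewrite eqb0; apply/negP => h; apply: no; exists i.
have cdl : c' + l < d' - l by rewrite /l; lra.
have := @mixed_signs_length_le _ _ cdl sgn' k1 pos neg.
have -> : d' - l - (c' + l) = (d' - c') / 2 by rewrite /l; field.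
rewrite len => h; rewrite !natrM natrX.
have p2 : 0 < 2 ^+ n :> R by rewrite exprn_gt0.
have e : d - c = 2 ^+ n * 4 * ((d - c) / 2 ^+ n / 2 / 2) by field; rewrite gt_eqF.
by rewrite e ler_wpM2l// mulr_ge0// ltW.
Qed.

End PositiveSolutionsOnLongIntervals.

(** * Solutions vanish on short intervals *)

Section ShortIntervals.
Context {R : realType}.
Implicit Types (c d t : R) (zs ws : seq R).

Lemma Rolle_zeros (f df : R -> R) z zs : (forall x, is_derive x (1 : R) f (df x)) ->
  sorted <%R (z :: zs) -> {in z :: zs, forall x, f x = 0} ->
  exists ws, [/\ sorted <%R ws, size ws = size zs, {in ws, forall x, df x = 0} &
    {in ws, forall x, z < x < last z zs}].
Proof.
move=> dfE; elim: zs z => [|z' zs ih] z; first by move=> _ _; exists [::].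
move=> /= /andP[zz' zss] fz.
have [||ws [ws_s ws_n ws0 ws_b]] := ih z' => //.
  by move=> x xz; apply: fz; rewrite inE xz orbT.
have [|||w wI dw] := @Rolle R f z z' zz'.
- by move=> x _; apply: ex_derive.
- by apply: (is_derive_within (df := df)) => x _; exact: dfE.
- by rewrite !fz// !inE eqxx ?orbT.
have w0 : df w = 0 by rewrite -(@derive_val _ _ _ _ _ _ _ (dfE w)) derive_val.
have z'l : z' <= last z' zs.
  have := mem_last z' zs; rewrite inE => /predU1P[->//|].
  by move/(allP (order_path_min lt_trans zss)) => /ltW.
exists (w :: ws); split.
- rewrite /= path_min_sorted//; apply/allP => x /ws_b/andP[z'x _].
  by rewrite (lt_trans _ z'x)// (itvP wI).
- by rewrite /= ws_n.
- by move=> x; rewrite inE => /predU1P[->|/ws0].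
- move=> x; rewrite inE => /predU1P[->|/ws_b/andP[z'x ->]].
    by rewrite (itvP wI) (lt_le_trans _ z'l)// (itvP wI).
  by rewrite (lt_trans zz').
Qed.

Lemma derive_bound (f df : R -> R) c d t u (K : R) :
  (forall x, is_derive x (1 : R) f (df x)) ->
  (forall x, c <= x <= d -> `|df x| <= K) -> c <= t <= d -> c <= u <= d ->
  `|f t - f u| <= K * (d - c).
Proof.
move=> dfE dfK.
suff H v w : c <= v -> v <= w -> w <= d -> `|f w - f v| <= K * (d - c).
  move=> /andP[ct td] /andP[cu ud]; have [tu|ut] := leP t u; last by apply: H => //; exact: ltW.
  by rewrite distrC; exact: H.
move=> cv vw wd.
have [x xI ->] := @MVT_segment _ f df v w vw (fun x _ => dfE x)
  (is_derive_within (fun x _ => dfE x)).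
have /andP[vx xw] : v <= x <= w by move: xI; rewrite in_itv.
have xcd : c <= x <= d by rewrite (le_trans cv vx) (le_trans xw wd).
rewrite normrM; apply: ler_pM => //; first exact: dfK.
by rewrite ger0_norm ?subr_ge0//; lra.
Qed.

Variables (n : nat) (kappa : R) (y : nat -> R -> R).
Hypotheses (n0 : (0 < n)%N) (ys : solution n kappa y).

(* The numbers of conditions of order below [h] exceed [h - 1], so Rolle's
   theorem leaves a zero to each of the first [n] derivatives. *)
Lemma derivatives_have_zeros c d t0 (A B : seq nat) : c < t0 -> t0 <= d ->
  (forall h, (1 <= h <= n)%N -> (h <= count (fun i => i < h)%N A + count (fun i => i < h)%N B)%N) ->
  uniq A -> uniq B -> {in A, forall i, y i c = 0} ->
  {in B, forall i, i != 0%N -> y i d = 0} -> y 0%N t0 = 0 ->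
  forall h, (h < n)%N -> exists2 t, c <= t <= d & y h t = 0.
Proof.
move=> ct td NA uA uB yA yB yt.
have cnt h (C : seq nat) : uniq C ->
    count (fun i => i < h.+1)%N C = (count (fun i => i < h)%N C + (h \in C))%N.
  move=> uC; rewrite -(count_uniq_mem h uC) -count_predUI.
  rewrite (@eq_count _ (predI _ _) pred0) ?count_pred0 ?addn0.
    by apply: eq_count => i /=; rewrite ltnS leq_eqVlt orbC.
  by move=> i /=; apply/negbTE; case: eqP => [->|]; rewrite ?ltnn ?andbF.
(* Invariant: [y h] has at least as many zeros as there are conditions of order at most [h], minus
   [h]. The count [NA] then leaves at least one. *)
suff H h : (h < n)%N -> exists zs, [/\ sorted <%R zs, {in zs, forall x, c <= x <= d /\ y h x = 0} &
    (count (fun i => i < h.+1)%N A + count (fun i => i < h.+1)%N B <= h + size zs)%N].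
  move=> h hn; have [zs [_ zsP]] := H h hn.
  case: zs zsP => [|z zs] zsP sz.
    have := NA h.+1; rewrite hn => /(_ isT) h1; have := leq_trans h1 sz.
    by rewrite addn0 ltnn.
  by have [zI z0] := zsP z (mem_head z zs); exists z.
elim: h => [|h ih] hn.
  have cI : c <= c <= d by rewrite lexx ltW// (lt_le_trans ct).
  have tI : c <= t0 <= d by rewrite (ltW ct).
  (* At order 0 the zero [t0] stands for the condition of order 0 in [B]; it differs from [c]
     because [c < t0]. *)
  rewrite !cnt// !(@eq_count _ (fun i => i < 0)%N pred0)// !count_pred0 !add0n.
  have [A0|A0] := boolP (0%N \in A).
    exists [:: c; t0]; split; first by rewrite /= ct.
      by move=> x; rewrite !inE => /orP[] /eqP->; split=> //; exact: yA.
    by rewrite /= add1n ltnS leq_b1.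
  exists [:: t0]; split=> //; first by move=> x; rewrite inE => /eqP->.
  by rewrite add0n leq_b1.
have [zs [zs_s zsP zs_n]] := ih (ltnW hn).
case: zs zs_s zsP zs_n => [|z zs] zs_s zsP zs_n.
  have := NA h.+1; rewrite (ltnW hn) => /(_ isT) h1; have := leq_trans h1 zs_n.
  by rewrite addn0 ltnn.
have [ws [ws_s ws_n ws0 ws_b]] := Rolle_zeros (ys.1 h) zs_s (fun x xz => (zsP x xz).2).
(* The zeros from Rolle's theorem are interior, so prescribed zeros at [c] and [d] are new ones. *)
have ws_cd : {in ws, forall x, c < x < d}.
  move=> x /ws_b/andP[zx xl]; apply/andP; split.
    by apply: le_lt_trans zx; have [/andP[]] := zsP z (mem_head z zs).
  by apply: (lt_le_trans xl); have [/andP[]] := zsP _ (mem_last z zs).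
have cd : c < d by exact: lt_le_trans td.
exists ((if h.+1 \in A then [:: c] else [::]) ++ ws ++ (if h.+1 \in B then [:: d] else [::])).
split.
- have s1 : sorted <%R (ws ++ (if h.+1 \in B then [:: d] else [::])).
    case: ifP => _; last by rewrite cats0.
    rewrite cats1; case: ws ws_s ws_cd {ws_n ws0 ws_b} => //= w ws ws_s ws_cd.
    by rewrite rcons_path ws_s/=; have /andP[] := ws_cd _ (mem_last w ws).
  case: ifP => _ //; rewrite cat1s /= path_min_sorted//; apply/allP => x.
  rewrite mem_cat => /orP[/ws_cd/andP[]//|].
  by case: ifP => _ //; rewrite inE => /eqP->.
- move=> x; rewrite !mem_cat => /or3P[].
  + case: ifP => // hA; rewrite inE => /eqP->; split; first by rewrite lexx ltW.
    exact: yA.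
  + by move=> xw; have /andP[/ltW-> /ltW->] := ws_cd x xw; rewrite ws0.
  + case: ifP => // hB; rewrite inE => /eqP->; split; first by rewrite lexx ltW.
    exact: yB.
- rewrite !(cnt h.+1)// !size_cat ws_n; move: zs_n => /=.
  by case: (h.+1 \in A); case: (h.+1 \in B) => /=; lia.
Qed.

(** As each derivative has a zero, [n] mean value estimates starting from [|y n| = |y 0| <= C] give
    [|y 0| <= C * (d - c) ^ n], so the maximum [C] is 0. *)
Lemma short_interval_zero c d : `|kappa| = 1 -> c < d -> d - c < 1 ->
  (forall h, (h < n)%N -> exists2 t, c <= t <= d & y h t = 0) -> forall i t, y i t = 0.
Proof.
move=> k1 cd dc1 yz.
have [t0 t0I t0max] : exists2 t0, t0 \in `[c, d] &
    forall t, t \in `[c, d] -> `|y 0%N t| <= `|y 0%N t0|.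
  apply: (@EVT_max _ (fun t => `|y 0%N t|)); first exact: ltW.
  apply: continuous_subspaceT => t; apply: continuous_comp; last exact: norm_continuous.
  exact: (solution_continuous ys).
set C := `|y 0%N t0| in t0max.
have bound j : (j <= n)%N -> forall t, c <= t <= d -> `|y (n - j)%N t| <= C * (d - c) ^+ j.
  elim: j => [|j ih] jn t tI.
    rewrite subn0 expr0 mulr1; have := ys.2 0%N t; rewrite add0n => ->.
    by rewrite normrM k1 mul1r t0max.
  have [|u uI yu] := yz (n - j.+1)%N; first by lia.
  have -> : y (n - j.+1)%N t = y (n - j.+1)%N t - y (n - j.+1)%N u by rewrite yu subr0.
  rewrite exprSr mulrA; apply: derive_bound tI uI => [x|x xI].
    exact: (ys.1 (n - j.+1)%N x).
  by rewrite (_ : (n - j.+1).+1 = (n - j)%N) ?ih ?(ltnW jn)//; lia.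
have C0 : C = 0.
  have := bound n (leqnn n) t0; rewrite subnn -/C => /(_ t0I) h.
  apply/eqP; rewrite eq_le normr_ge0 andbT -subr_le0.
  have q1 : (d - c) ^+ n < 1 by rewrite exprn_ilt1 ?subr_ge0 ?(ltW cd)// -lt0n.
  have : C * (1 - (d - c) ^+ n) <= 0 by lra.
  by rewrite subr0 pmulr_lle0// subr_gt0.
apply: (solution_eq0 (s := c) n0 ys) => i ilt; apply/eqP; rewrite -normr_le0.
have := bound (n - i)%N (leq_subr i n) c; rewrite subKn ?(ltnW ilt)// C0 mul0r.
by apply; rewrite lexx ltW.
Qed.

End ShortIntervals.

(** * Continuity of determinants and cofactors *)

Section DeterminantContinuity.
Context {R : realType} {T : topologicalType}.

Lemma continuous_det m (M : T -> 'M[R]_m) :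
  (forall i j, continuous (fun x => M x i j)) -> continuous (fun x => \det (M x)).
Proof.
move=> cM; rewrite /determinant; apply: continuous_big; first exact: add_continuous.
move=> s _ x; apply: cvgM; first exact: cvg_cst.
by apply: cvg_big => [|i _]; [exact: mul_continuous|exact: cM].
Qed.

Lemma continuous_cofactor m (M : T -> 'M[R]_m) i0 j0 :
  (forall i j, continuous (fun x => M x i j)) -> continuous (fun x => cofactor (M x) i0 j0).
Proof.
move=> cM x; rewrite /cofactor; apply: cvgM; first exact: cvg_cst.
apply: (@continuous_det _ (fun x => row' i0 (col' j0 (M x)))) => i j.
rewrite (_ : (fun x => _) = (fun x => M x (lift i0 i) (lift j0 j))); first exact: cM.
by apply/funext => z; rewrite !mxE.
Qed.

End DeterminantContinuity.

(** * Sign changes under boundary conditions *)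

Section BoundaryConditions.
Context {R : realType}.
Variables (n : nat) (kappa : R).
Hypotheses (n1 : (1 < n)%N) (kappa0 : kappa != 0).
Implicit Types (y z : nat -> R -> R) (A B : seq nat) (c d t : R).

Let n0 : (0 < n)%N := ltnW n1.

Definition vanishes_at A t y := {in A, forall i, y i t = 0}.

(* One condition fewer than the order of the equation still determines all
   sign changes, by parity. *)
Lemma boundary_changes y A B c d N : solution n kappa y -> (exists i s, y i s != 0) ->
  c < d -> uniq A -> uniq B -> all (fun i => (i < n)%N) A -> all (fun i => (i < n)%N) B ->
  vanishes_at A c y -> vanishes_at B d y ->
  odd N = (kappa < 0) -> (N <= n)%N -> (n - N <= size A)%N -> (N <= (size B).+1)%N ->
  [/\ changesR n y c = N, changesL n y d = N, (zeros n y c <= n - N)%N,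
      (size A <= n - N)%N &
      forall t, c < t < d -> changesR n y t = N /\ changesL n y t = N].
Proof.
move=> ys yn0 cd uA uB An Bn yA yB oN Nn sA sB.
have zA := size_le_zeros (y := y) uA An yA; have zB := size_le_zeros (y := y) uB Bn yB.
have [||cN dN zc tN] := changes_rigid n0 kappa0 ys yn0 cd Nn oN.
- exact: leq_trans zA.
- by apply: leq_trans sB _; rewrite ltnS.
by split=> //; exact: leq_trans zc.
Qed.

(** A surplus condition at [c] exceeds the number of zeros possible there, provided at most one
    condition is missing at [d]. *)
Lemma boundary_trivial y A B c d N : solution n kappa y ->
  c < d -> uniq A -> uniq B -> all (fun i => (i < n)%N) A -> all (fun i => (i < n)%N) B ->
  vanishes_at A c y -> vanishes_at B d y ->
  odd N = (kappa < 0) -> (N <= n)%N -> (n - N < size A)%N -> (N <= (size B).+1)%N ->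
  forall i t, y i t = 0.
Proof.
move=> ys cd uA uB An Bn yA yB oN Nn sA sB i t; apply/eqP; apply: contraT => yi.
have yn0 : exists i s, y i s != 0 by exists i, t.
have [_ _ _ + _] := boundary_changes ys yn0 cd uA uB An Bn yA yB oN Nn (ltnW sA) sB.
by rewrite leqNgt sA.
Qed.

Lemma leading_sign_pos y r c t : solution n kappa y ->
  (forall i, (i < r)%N -> y i c = 0) -> (forall x, c < x <= t -> 0 < y r x) ->
  forall x, c < x <= t -> 0 < y 0%N x.
Proof.
move=> ys; elim: r => [//|r ih] yr0 yr; apply: ih => [i ir|x /andP[cx xt]].
  by apply: yr0; rewrite ltnS ltnW.
rewrite -(yr0 r (ltnSn r)); apply: (derive_gt0_lt (df := y r.+1)) cx => [z _|z].
  exact: ys.1.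
by rewrite in_itv/= => /andP[cz zx]; apply: yr; rewrite cz (le_trans (ltW zx)).
Qed.

End BoundaryConditions.

(** * Shooting in the interval length for [u^(n) = tau u] *)

Section Shooting.
Context {R : realType}.
Variables (n : nat) (A B : seq nat).
Hypotheses (n1 : (1 < n)%N) (uA : uniq A) (uB : uniq (0%N :: B)).
Hypotheses (An : all (fun i => (i < n)%N) A) (Bn : all (fun i => (i < n)%N) B).
Hypotheses (A0 : (0 < size A)%N) (AB : (size A + (size B).+1)%N = n).
Hypothesis Na : forall h, (1 <= h <= n)%N ->
  (h <= count (fun i => i < h)%N A + count (fun i => i < h)%N (0%N :: B))%N.

Let n0 : (0 < n)%N := ltnW n1.
Let m := size B.
Let tau : R := (-1) ^+ m.+1.

Let tau_odd : odd m.+1 = (tau < 0).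
Proof.
rewrite /tau -signr_odd; case: odd; rewrite ?expr1 ?expr0 ?oppr_lt0 ?ltr01//.
by rewrite ltr10.
Qed.
Let tau0 : tau != 0. Proof. by rewrite signr_eq0. Qed.
Let tau1 : `|tau| = 1. Proof. by rewrite normr_sign. Qed.
Let mn : (m.+1 <= n)%N. Proof. by rewrite -AB leq_addl. Qed.
Let nm : (n - m.+1)%N = size A. Proof. by rewrite -AB addnK. Qed.
Let uB' : uniq B. Proof. by case/andP: uB. Qed.

(** Orders free at 0; the basis solutions [E r] with [r] in this list span the solutions satisfying
    the conditions [A]. *)
Let Ac := [seq i <- iota 0 n | i \notin A].

Let size_Ac : size Ac = m.+1.
Proof.
have : (size Ac + size A)%N = n.
  have := count_predC (mem A) (iota 0 n); rewrite size_iota => <-.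
  rewrite size_filter addnC; congr (_ + _)%N.
  rewrite -size_filter; apply/perm_size/uniq_perm => //; first by rewrite filter_uniq// iota_uniq.
  move=> i; rewrite mem_filter mem_iota add0n /=; case: (boolP (i \in A)) => //=.
  by move/(allP An) => ->.
by move=> h; apply/eqP; rewrite -(eqn_add2r (size A)) h addnC AB.
Qed.

Let Ac_in (j : 'I_m.+1) : (nth 0%N Ac j < n)%N && (nth 0%N Ac j \notin A).
Proof.
have : nth 0%N Ac j \in Ac by rewrite mem_nth// size_Ac.
by rewrite mem_filter mem_iota add0n /= andbC.
Qed.

Let Ac_inj (i j : 'I_m.+1) : (nth 0%N Ac i == nth 0%N Ac j) = (i == j).
Proof. by rewrite nth_uniq ?size_Ac// filter_uniq// iota_uniq. Qed.

Let r0 := nth 0%N Ac 0.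

Let r0_min i : (i < r0)%N -> i \in A.
Proof.
move=> ir; apply: contraT => iA; have iAc : i \in Ac.
  have /andP[rn _] := Ac_in ord0.
  by rewrite mem_filter iA mem_iota add0n /= (ltn_trans ir rn).
have srt : sorted leq Ac by rewrite sorted_filter ?iota_sorted//; exact: leq_trans.
move: ir; rewrite ltnNge -(nth_index 0%N iAc) => /negP[].
by apply: (sorted_leq_nth leq_trans leqnn) => //; rewrite ?inE ?index_mem ?size_Ac.
Qed.

Let Eex := @solution_basis R n tau n0.
Let E := sval (cid Eex).
Let Es r : (r < n)%N -> solution n tau (E r). Proof. by move/(svalP (cid Eex)) => []. Qed.
Let E0 r i : (r < n)%N -> (i < n)%N -> E r i 0 = (i == r)%:R.
Proof. by move/(svalP (cid Eex)) => [_]; apply. Qed.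

(** Row 0 is the dropped condition, so the cofactors along it are orthogonal to the rows coming from
    [B]. *)
Let P (L : R) : 'M[R]_m.+1 :=
  \matrix_(i, j) E (nth 0%N Ac j) (nth 0%N (0%N :: B) i) L.

Let v (L : R) (j : 'I_m.+1) := cofactor (P L) ord0 j.

(* Solution of the boundary value problem with the condition of order [0] at
   [L] removed; its initial data are cofactors, hence continuous in [L]. *)
Let u (L : R) : nat -> R -> R :=
  fun i t => \sum_(j < m.+1) (v L ord0 * v L j) * E (nth 0%N Ac j) i t.

Let us L : solution n tau (u L).
Proof. by apply: solution_sum => j; apply: Es; have /andP[] := Ac_in j. Qed.

Let u_init L (j : 'I_m.+1) : u L (nth 0%N Ac j) 0 = v L ord0 * v L j.
Proof.
have /andP[jn _] := Ac_in j; rewrite /u (bigD1 j)//= E0// eqxx mulr1 big1 ?addr0//.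
move=> i ij; have /andP[iin _] := Ac_in i.
by rewrite E0// Ac_inj eq_sym (negPf ij) mulr0.
Qed.

Let comb_A (w : 'I_m.+1 -> R) :
  vanishes_at A 0 (fun i t => \sum_(j < m.+1) w j * E (nth 0%N Ac j) i t).
Proof.
move=> i iA; rewrite big1// => j _; have /andP[jn jA] := Ac_in j.
rewrite E0// ?(allP An)//; case: eqP => [e|_]; last by rewrite mulr0.
by rewrite -e iA in jA.
Qed.

Let u_A L : vanishes_at A 0 (u L). Proof. exact: comb_A. Qed.

Let u_B L : vanishes_at B L (u L).
Proof.
move=> b bB; have ib : ((index b B).+1 < m.+1)%N by rewrite ltnS index_mem.
have := congr1 (fun M : 'M[R]_m.+1 => M (Ordinal ib) ord0) (mul_mx_adj (P L)).
rewrite !mxE /= mulr0n => e.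
rewrite -[RHS](mulr0 (v L ord0)) -e mulr_sumr; apply: eq_bigr => j _.
by rewrite !mxE /= nth_index// /v; ring.
Qed.

(** If the minor were singular, a nontrivial solution would satisfy one condition more than [A] at 0
    and still [B] at [L], which [boundary_trivial] excludes. *)
Let v_neq0 L j : 0 < L -> v L j != 0.
Proof.
move=> L0; rewrite /v /cofactor mulf_neq0 ?signr_eq0 //.
rewrite -det_tr; apply/det0P => -[w w0 wM].
pose w' (j' : 'I_m.+1) : R := if unlift j j' is Some j'' then w 0 j'' else 0.
pose y i t := \sum_(j' < m.+1) w' j' * E (nth 0%N Ac j') i t.
have ysol : solution n tau y by apply: solution_sum => i; apply: Es; have /andP[] := Ac_in i.
have y_init (i : 'I_m.+1) : y (nth 0%N Ac i) 0 = w' i.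
  have /andP[jn _] := Ac_in i; rewrite /y (bigD1 i)//= E0// eqxx mulr1 big1 ?addr0//.
  move=> i' ij; have /andP[iin _] := Ac_in i'.
  by rewrite E0// Ac_inj eq_sym (negPf ij) mulr0.
have y0 i t : y i t = 0.
  have /andP[jn jA] := Ac_in j.
  apply: (@boundary_trivial _ n tau n1 tau0 y (nth 0%N Ac j :: A) B 0 L m.+1) => //.
  - by rewrite /= jA.
  - by rewrite /= jn.
  - move=> i'; rewrite inE => /predU1P[->|]; last exact: comb_A.
    by rewrite y_init /w' unlift_none.
  - move=> b bB; have ib : (index b B < m)%N by rewrite index_mem.
    have := congr1 (fun M : 'rV[R]_m => M 0 (Ordinal ib)) wM; rewrite !mxE => e.
    rewrite /y (bigD1 j)//= /w' unlift_none mul0r add0r -[RHS]e.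
    rewrite (reindex_omap (lift j) (unlift j)); last first.
      by move=> i'; case: unliftP => [i'' -> _ /=|->]; rewrite ?eqxx.
    rewrite (eq_bigl xpredT); last by move=> i'; rewrite liftK eqxx eq_sym neq_lift.
    by apply: eq_bigr => i' _; rewrite liftK !mxE lift0/= nth_index.
  - by rewrite nm /=.
move/eqP: w0; apply; apply/rowP => i; rewrite mxE.
by have := y0 (nth 0%N Ac (lift j i)) 0; rewrite y_init /w' liftK.
Qed.

(** The factor [v L ord0] in [u] makes the lowest free derivative a square, which fixes the sign of
    [u L] while keeping continuity in [L]. *)
Let u_r0 L : 0 < L -> 0 < u L r0 0.
Proof.
move=> L0; rewrite (u_init L ord0) -expr2 exprn_even_gt0//=.
exact: v_neq0.
Qed.

Let u_nz L : 0 < L -> exists i s, u L i s != 0.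
Proof. by move=> L0; exists r0, 0; rewrite gt_eqF// u_r0. Qed.

Let E_cont j i : continuous (E (nth 0%N Ac (j : 'I_m.+1)) i).
Proof. by apply: solution_continuous (Es _); have /andP[] := Ac_in j. Qed.

Let v_cont j : continuous (v ^~ j).
Proof.
apply: continuous_cofactor => i' j'.
rewrite (_ : (fun x => _) = E (nth 0%N Ac j') (nth 0%N (0%N :: B) i')); first exact: E_cont.
by apply/funext => x; rewrite mxE.
Qed.

Let u_cont i : continuous (fun p : R * R => u p.1 i p.2).
Proof.
move=> p; rewrite /u; apply: cvg_big => [|j _]; first exact: add_continuous.
have c1 j' : v x.1 j' @[x --> p] --> v p.1 j'.
  exact: (cvg_comp _ (v ^~ j') cvg_fst (@v_cont j' p.1)).
apply: cvgM; first exact: cvgM.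
exact: (cvg_comp _ (E (nth 0%N Ac j) i) cvg_snd (@E_cont j i p.2)).
Qed.

Let good L := forall t, 0 < t <= L -> 0 < u L 0%N t.

Let u_changes L : 0 < L -> [/\ changesR n (u L) 0 = m.+1, (zeros n (u L) 0 <= size A)%N &
  forall t, 0 < t < L -> changesR n (u L) t = m.+1 /\ changesL n (u L) t = m.+1].
Proof.
move=> L0; have h : (n - m.+1 <= size A)%N by rewrite nm.
have [c0 _ + _ ct] := boundary_changes n1 tau0 (us L) (u_nz L0) L0 uA uB' An Bn
  (@u_A L) (@u_B L) tau_odd mn h (leqnn _).
by rewrite nm.
Qed.

Let u_no_double L t : 0 < t < L -> u L 0%N t = 0 -> u L 1%N t != 0.
Proof.
move=> tL; have /andP[t0 tl] := tL; have L0 := lt_trans t0 tl.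
have [_ _ /(_ t tL)[e1 e2]] := u_changes L0.
by apply: (no_double_zero n0 tau0 (us L) (u_nz L0) n1); rewrite e1.
Qed.

Let good_le L : 0 < L -> good L -> L <= (2 ^ n * 4 * n)%:R.
Proof.
move=> L0 gL; have [_ _ ch] := u_changes L0; rewrite -[leLHS]subr0.
apply: (@positive_solution_length_le _ n tau (u L) n0 (us L) 0 L m.+1) => //.
- by rewrite /= -AB -[ltnLHS]add0n ltn_add2r.
- by move=> t /andP[t0 tL]; apply: gL; rewrite t0 ltW.
- by move=> t tL; have [] := ch t tL.
Qed.

(** Positivity near [t = 0], uniform in the length. Since [u] may vanish at 0, continuity is applied
    to the derivative of order [r0], which is then integrated. *)
Let u_near L : 0 < L -> exists2 e, 0 < e & forall M t, `|M - L| < e -> 0 < t < e -> 0 < u M 0%N t.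
Proof.
move=> L0; have := @u_cont r0 (L, 0).
move/cvgr_gt => /(_ 0 (u_r0 L0)) [[U V]] /= [[e1 /= e10 U1] [e2 /= e20 V2]] UV.
exists (Num.min e1 e2); first by rewrite lt_min e10.
move=> M t ML /andP[t0 te].
apply: (@leading_sign_pos _ n tau (u M) r0 0 t (us M)) => [i /r0_min|x /andP[x0 xt]|].
- exact: u_A.
- apply: (UV (M, x)); split=> /=.
    by apply: U1; rewrite /ball/= distrC (lt_le_trans ML)// ge_min lexx.
  apply: V2; rewrite /ball/= sub0r normrN gtr0_norm// (le_lt_trans xt)//.
  by rewrite (lt_le_trans te)// ge_min lexx orbT.
- by rewrite t0 lexx.
Qed.

(** A zero of [u L] in [(0, L]] would replace the dropped condition, and all conditions together
    admit no nontrivial solution on an interval shorter than 1. *)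
Let good_small L : 0 < L -> L < 1 -> good L.
Proof.
move=> L0 L1 t /andP[t0 tL]; rewrite ltNge; apply/negP => ut.
have [e e0 ue] := u_near L0.
pose x := Num.min (t / 2) (e / 2).
have x0 : 0 < x by rewrite lt_min !divr_gt0.
have xt : x <= t by rewrite ge_min ler_pdivrMr// ler_peMr ?ler1n// ltW.
have xe : x < e by rewrite gt_min [X in _ || X]ltr_pdivrMr// ltr_pMr ?ltr1n// orbT.
have ux : 0 < u L 0%N x by apply: ue; rewrite ?subrr ?normr0// x0 xe.
have [s sI us0] : exists2 s, s \in `[x, t] & u L 0%N s = 0.
  apply: IVT => //; last by rewrite ge_min ut orbT le_max (ltW ux).
  by apply: continuous_subspaceT => z; exact: (solution_continuous (us L)).
have /andP[xs st] : x <= s <= t by move: sI; rewrite in_itv.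
have [i [z /eqP]] := u_nz L0; apply.
apply: (short_interval_zero n0 (us L) tau1 L0) => //; first by rewrite subr0.
apply: (@derivatives_have_zeros _ n tau (u L) n0 (us L) 0 L s A (0%N :: B)) => //.
- exact: lt_le_trans xs.
- exact: le_trans tL.
- exact: u_A.
- by move=> j; rewrite inE => /predU1P[->//|jB _]; exact: u_B.
Qed.

Let good_open L : 0 < L -> good L -> \forall M \near L, good M.
Proof.
move=> L0 gL; have [e e0 ue] := u_near L0.
have M0 : \forall M \near L, 0 < M by exact: lt_nbhsr.
have Me : \forall M \near L, `|M - L| < e.
  by exists e => //= M; rewrite /ball/= distrC.
(* Writing [t = M * th] puts all lengths on one compact segment of [th]. *)
pose Q (M th : R) := 0 < th -> 0 < u M 0%N (M * th).
have /compact_near_coveringP/(_ _ (nbhs L) Q) : compact `[0 : R, 1] by exact: segment_compact.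
move=> H; have {}H : \forall M \near L, `[0, 1]%classic `<=` Q M.
  apply: H => th /=; rewrite in_itv/= => /andP[th0 th1].
  move: th0; rewrite le_eqVlt => /predU1P[<-|th0].
    have h1 : \forall x \near (0 : R), x < e / (L + 1).
      by apply: lt_nbhsl; rewrite divr_gt0// addr_gt0.
    have h2 : \forall M \near L, M < L + 1 by apply: lt_nbhsl; rewrite ltrDl.
    near=> p; move=> p0; apply: ue; first by near: p; exact: (cvg_snd Me).
    have Mp : 0 < p.2 by near: p; exact: (cvg_snd M0).
    rewrite mulr_gt0//=.
    have a1 : p.1 < e / (L + 1) by near: p; exact: (cvg_fst h1).
    have a2 : p.2 < L + 1 by near: p; exact: (cvg_snd h2).
    have L10 : 0 < L + 1 by rewrite addr_gt0.
    apply: (@lt_trans _ _ ((L + 1) * p.1)); first by rewrite ltr_pM2r.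
    by rewrite mulrC -ltr_pdivlMr.
  have c1 : (fun p : R * R => u p.2 0%N (p.2 * p.1)) @ (th, L) --> u L 0%N (L * th).
    have c2 : p.2 @[p --> (th, L)] --> L by exact: cvg_snd.
    have c3 : p.2 * p.1 @[p --> (th, L)] --> L * th.
      by apply: cvgM => //; exact: cvg_fst.
    exact: (cvg_comp _ (fun p : R * R => u p.1 0%N p.2) (cvg_pair c2 c3) (@u_cont 0%N (L, L * th))).
  have ut : 0 < u L 0%N (L * th).
    by apply: gL; rewrite mulr_gt0//= ler_piMr// ltW.
  near=> p; move=> _; near: p; exact: (cvgr_gt _ c1 _ ut).
near=> M => t /andP[t0 tM].
have Mp : 0 < M by near: M.
have HM : `[0, 1]%classic `<=` Q M by near: M; exact: H.
have : Q M (t / M).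
  by apply: HM => /=; rewrite in_itv/= divr_ge0 ?(ltW t0) ?(ltW Mp)// ler_pdivrMr// mul1r.
by rewrite /Q mulrCA divff ?gt_eqF// mulr1; apply; rewrite divr_gt0.
Unshelve. all: by end_near. Qed.

Lemma first_interval_zero_order : exists2 L1 : R, 0 < L1 &
  (exists y, [/\ solution n ((-1) ^+ (size B).+1) y, vanishes_at A 0 y,
       vanishes_at (0%N :: B) L1 y &
     forall t, 0 < t < L1 -> 0 < y 0%N t]) /\
  (forall L z, 0 < L < L1 -> solution n ((-1) ^+ (size B).+1) z -> vanishes_at A 0 z ->
     vanishes_at (0%N :: B) L z -> forall i t, z i t = 0).
Proof.
pose bad := [set L : R | 0 < L /\ ~ good L].
have bad_lb : lbound bad 1.
  by move=> L [L0 nL]; rewrite leNgt; apply/negP => L1; apply: nL; exact: good_small.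
have bad_ex : bad !=set0.
  exists ((2 ^ n * 4 * n)%:R + 1); split; first by rewrite ltr_wpDl.
  by move/good_le; rewrite leNgt ltrDl ltr01 => /(_ _)/negP; apply; rewrite // ltr_wpDl.
have hinf : has_inf bad by split=> //; exists 1.
(* First length at which positivity fails: it exists by [good_le] and is positive by
   [good_small]. *)
pose L1 := inf bad.
have L1_ge1 : 1 <= L1 by exact: lb_le_inf.
have L10 : 0 < L1 by exact: lt_le_trans L1_ge1.
have good_lt L : 0 < L < L1 -> good L.
  move=> /andP[L0 LL]; apply: contrapT => nL.
  by have := ge_inf hinf.2 (conj L0 nL : bad L); rewrite leNgt LL.
have bad1 : ~ good L1.
  move=> g1; have [e /= e0 ge] := good_open L10 g1.
  have [M [M0 nM] ML] := inf_lt bad_ex (ltac:(by rewrite ltrDl) : L1 < L1 + e).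
  have LM : L1 <= M by apply: ge_inf => //; exact: hinf.2.
  apply: nM; apply: ge; rewrite /ball/= distrC ger0_norm ?subr_ge0//.
  by rewrite ltrBlDl.
have u_ge0 t : 0 < t <= L1 -> 0 <= u L1 0%N t.
  move=> /andP[t0 tL]; pose th := t / L1.
  have th0 : 0 < th by rewrite divr_gt0.
  have th1 : th <= 1 by rewrite ler_pdivrMr// mul1r.
  have tE : t = L1 * th by rewrite /th mulrCA divff ?gt_eqF// mulr1.
  have c1 : L @[L --> L1^'-] --> L1 by apply: cvg_at_left_filter; exact: cvg_id.
  have c2 : L * th @[L --> L1^'-] --> L1 * th.
    by apply: cvgM; [exact: c1|exact: cvg_cst].
  have c : u L 0%N (L * th) @[L --> L1^'-] --> u L1 0%N t.
    rewrite tE.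
    exact: (cvg_comp _ (fun p : R * R => u p.1 0%N p.2) (cvg_pair c1 c2)
      (@u_cont 0%N (L1, L1 * th))).
  rewrite -(cvg_lim _ c)//; apply: limr_ge; first by apply/cvg_ex; eexists; exact: c.
  near=> L; apply: ltW.
  have L0 : 0 < L by near: L; exact: nbhs_left_gt.
  apply: (good_lt L); first by rewrite L0/=; near: L; exact: nbhs_left_lt.
  by rewrite mulr_gt0//= ler_piMr// ltW.
(* An interior zero would be a minimum, hence a double zero, which the constant number of sign
   changes forbids. *)
have u_gt0 t : 0 < t < L1 -> 0 < u L1 0%N t.
  move=> tL; have /andP[t0 tl] := tL.
  have := u_ge0 t; rewrite t0 (ltW tl) => /(_ isT); rewrite le_eqVlt => /predU1P[ut|//].
  have /negP := u_no_double tL (esym ut); case; apply/eqP.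
  have dut := (us L1).1 0%N t.
  have tI : t \in `]0, L1[ by rewrite in_itv/= t0 tl.
  have [_ d0] : is_derive t (1 : R) (u L1 0%N) 0.
    apply: derive1_at_min (ltW L10) _ tI _ => [x _|x]; first by case: ((us L1).1 0%N x).
    by rewrite in_itv/= => /andP[x0 xL]; rewrite -ut u_ge0// x0 ltW.
  by rewrite -d0 derive_val.
(* Positivity fails somewhere in [(0, L1]], because good lengths form an open set, and only [t = L1]
   is left. *)
have uL1 : u L1 0%N L1 = 0.
  have [t /not_implyP[/andP[t0 tL] /negP]] : exists t, ~ (0 < t <= L1 -> 0 < u L1 0%N t).
    exact/existsNP.
  rewrite -leNgt => ut; move: tL; rewrite le_eqVlt => /predU1P[e|tL].
    by apply/eqP; rewrite eq_le u_ge0 ?lexx ?L10// -{2}e ut.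
  by have := u_gt0 t; rewrite t0 tL => /(_ isT); rewrite ltNge ut.
exists L1 => //; split.
  exists (u L1); split; [exact: us|exact: u_A| |exact: u_gt0].
  by move=> b; rewrite inE => /predU1P[->//|]; exact: u_B.
move=> L z /andP[L0 LL] zs zA zB.
have /andP[r0n r0A] := Ac_in ord0.
have triv y : solution n tau y -> vanishes_at A 0 y -> y r0 0 = 0 -> vanishes_at B L y ->
    forall i t, y i t = 0.
  move=> ysol yA yr yB; apply: (@boundary_trivial _ n tau n1 tau0 y (r0 :: A) B 0 L m.+1) => //.
  - by rewrite /= r0A.
  - by rewrite /= r0n.
  - by move=> i; rewrite inE => /predU1P[->|/yA].
  - by rewrite nm /=.
apply: (triv z) => //; last by move=> b bB; apply: zB; rewrite inE bB orbT.
(* This combination kills the derivative of order [r0] at 0, so it is trivial; hence [z] is a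
   multiple of [u L], which is positive at [L]. *)
pose w i t := z r0 0 * u L i t + - u L r0 0 * z i t.
have w0 i t : w i t = 0.
  apply: triv; first exact: solution_comb.
  - by move=> j jA; rewrite /w (@u_A L j jA) (zA j jA); ring.
  - by rewrite /w; ring.
  - by move=> b bB; rewrite /w (@u_B L b bB) (zB b) ?inE ?bB ?orbT//; ring.
have := w0 0%N L; rewrite /w zB ?mem_head// mulr0 addr0 => /eqP.
rewrite mulf_eq0 => /orP[/eqP//|/eqP uL0].
have := @good_lt L; rewrite L0 LL => /(_ isT L); rewrite L0 lexx uL0 ltxx.
by move/(_ isT).
Unshelve. all: by end_near. Qed.

End Shooting.

(** * The first modulus on [[a, b]] and signs at the end points *)

Section FirstEigenvalue.
Context {R : realType}.
Variables (n : nat).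
Hypotheses (n1 : (1 < n)%N).
Implicit Types (A B : seq nat).

(* Polya's condition, i.e. condition (N_a) together with the count at [h = n]. *)
Definition polya A B := forall h, (1 <= h <= n)%N ->
  (h <= count (fun i => i < h)%N A + count (fun i => i < h)%N B)%N.

Definition boundary_orders A B :=
  [/\ uniq A, uniq B, all (fun i => (i < n)%N) A, all (fun i => (i < n)%N) B &
      [/\ (0 < size A)%N, (0 < size B)%N & (size A + size B)%N = n]].

Lemma polyaC A B : polya A B -> polya B A.
Proof. by move=> H h hn; rewrite addnC; exact: H. Qed.

Lemma boundary_ordersC A B : boundary_orders A B -> boundary_orders B A.
Proof. by case=> uA uB An Bn [A0 B0 AB]; split=> //; split=> //; rewrite addnC. Qed.

Definition first_interval A B (L1 : R) :=
  (exists y, [/\ solution n ((-1) ^+ size B) y, vanishes_at A 0 y, vanishes_at B L1 y &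
     forall t, 0 < t < L1 -> 0 < y 0%N t]) /\
  (forall L z, 0 < L < L1 -> solution n ((-1) ^+ size B) z -> vanishes_at A 0 z ->
     vanishes_at B L z -> forall i t, z i t = 0).

Lemma first_interval_mem0 A B : boundary_orders A B -> polya A B -> 0%N \in B ->
  exists2 L1, 0 < L1 & first_interval A B L1.
Proof.
move=> [uA uB An Bn [A0 B0 AB]] pAB B0in; have pB := perm_to_rem B0in.
have sB : size B = (size (rem 0%N B)).+1 by rewrite (perm_size pB).
have mB : B =i 0%N :: rem 0%N B by exact: perm_mem.
have [||||L1 L10 [[y [ys yA yB yp]] nz]] :=
    @first_interval_zero_order R n A (rem 0%N B) n1 uA _ An _ A0.
- by rewrite -(perm_uniq pB).
- by apply/allP => i iB; apply: (allP Bn); exact: mem_rem iB.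
- by rewrite -sB.
- by move=> h hn; have := pAB h hn; rewrite (permP pB).
exists L1 => //; rewrite /first_interval sB; split.
  by exists y; split=> // i; rewrite mB; exact: yB.
move=> L z L01 zs zA zB; apply: (nz L) => // i iB; apply: zB.
by rewrite mB.
Qed.

Lemma solution_reflect kappa y (c : R) : solution n kappa y ->
  solution n ((-1) ^+ n * kappa) (fun i t => (-1) ^+ i * y i (c - t)).
Proof.
move=> /(solution_affine (-1) c); rewrite mulrC; congr solution.
by apply/funext => i; apply/funext => t; rewrite mulN1r addrC.
Qed.

(** The count at [h = 1] puts order 0 in [A] or in [B]. Shooting needs it at the right end point,
    and reflection handles the other case. *)
Lemma first_interval_exists A B : boundary_orders A B -> polya A B ->
  exists2 L1, 0 < L1 & first_interval A B L1.
Proof.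
move=> AB pAB; have [uA uB An Bn [A0 B0 ABn]] := AB.
have [B0in|B0in] := boolP (0%N \in B); first exact: first_interval_mem0.
have A0in : 0%N \in A.
  have := pAB 1%N; rewrite (ltnW n1) => /(_ isT).
  apply: contraTT => A0in; rewrite -ltnNge ltnS leqn0 addn_eq0.
  have cnt C : 0%N \notin C -> count (fun i => i < 1)%N C = 0%N.
    move=> C0; apply/eqP; rewrite -leqn0 leqNgt -has_count; apply/hasPn => i iC.
    by rewrite -leqNgt lt0n; apply: contraNneq C0 => <-.
  by rewrite !cnt.
have [L1 L10 [[y [ys yB yA yp]] nz]] :=
  first_interval_mem0 (boundary_ordersC AB) (polyaC pAB) A0in.
have sgE : (-1) ^+ n * (-1) ^+ size A = (-1) ^+ size B :> R.
  by rewrite -ABn exprD mulrAC -exprD addnn -mul2n exprM sqrrN !expr1n mul1r.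
have sgE' : (-1) ^+ n * (-1) ^+ size B = (-1) ^+ size A :> R.
  by rewrite -ABn exprD -mulrA -exprD addnn -mul2n exprM sqrrN !expr1n mulr1.
exists L1 => //; split.
  exists (fun i t => (-1) ^+ i * y i (L1 - t)); split.
  - by rewrite -sgE; exact: solution_reflect.
  - by move=> i iA; rewrite subr0 yA// mulr0.
  - by move=> i iB; rewrite subrr yB// mulr0.
  - by move=> t /andP[t0 tL]; rewrite expr0 mul1r yp// subr_gt0 tL ltrBlDr ltrDl.
move=> L z LL zs zA zB i t.
suff /(_ i (L - t))/eqP : forall i t, (fun i t => (-1) ^+ i * z i (L - t)) i t = 0.
  by rewrite mulf_eq0 signr_eq0 subKr => /eqP.
apply: (nz L) => //.
- by rewrite -sgE'; exact: solution_reflect.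
- by move=> j jB; rewrite subr0 zB// mulr0.
- by move=> j jA; rewrite subrr zA// mulr0.
Qed.

Lemma nth_root_exists (m : R) : 0 < m -> exists2 s, 0 < s & s ^+ n = m.
Proof.
move=> m0; exists (m `^ n%:R^-1); first exact: powR_gt0.
rewrite -powR_mulrn ?powR_ge0// -powRrM mulVf ?powRr1 ?ltW//.
by rewrite pnatr_eq0 -lt0n ltnW.
Qed.

(* [m1] is the modulus of the first eigenvalue [- (-1) ^ size B * m1]. *)
Definition first_modulus (a b : R) A B (m1 : R) (y : nat -> R -> R) :=
  [/\ 0 < m1, [/\ solution n ((-1) ^+ size B * m1) y, vanishes_at A a y & vanishes_at B b y],
      (forall t, a < t < b -> 0 < y 0%N t) &
      forall m z, 0 < m < m1 -> solution n ((-1) ^+ size B * m) z -> vanishes_at A a z ->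
        vanishes_at B b z -> forall i t, z i t = 0].

Lemma first_modulus_exists (a b : R) A B : a < b -> boundary_orders A B -> polya A B ->
  exists m1 y, first_modulus a b A B m1 y.
Proof.
move=> ab AB pAB; have [L1 L10 [[y [ys yA yB yp]] nz]] := first_interval_exists AB pAB.
have ba0 : 0 < b - a by rewrite subr_gt0.
pose rho := L1 / (b - a); have rho0 : 0 < rho by rewrite divr_gt0.
have rb : rho * b + - (rho * a) = L1 by rewrite -mulrBr /rho divfK// gt_eqF.
exists (rho ^+ n), (fun i t => rho ^+ i * y i (rho * t + - (rho * a))); split.
- exact: exprn_gt0.
- split; first exact: solution_affine.
    by move=> i iA; rewrite subrr yA// mulr0.
  by move=> i iB; rewrite rb yB// mulr0.
- move=> t /andP[at_ tb]; rewrite expr0 mul1r yp// -rb -!mulrBr.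
  by rewrite mulr_gt0 ?subr_gt0//= ltr_pM2l// ltrD2r.
move=> m z /andP[m0 mm] zs zA zB i t.
(* With [m = s ^ n], rescaling by [s] yields unit modulus on an interval of length
   [s * (b - a) < L1]. *)
have [s s0 sm] := nth_root_exists m0.
have sL : 0 < s * (b - a) < L1.
  rewrite mulr_gt0//= -ltr_pdivlMr// -/rho; rewrite -sm in mm.
  by rewrite ltNge; apply/negP => h; move: mm; rewrite ltNge lerXn2r// nnegrE ltW.
suff /(_ i (s * (t - a)))/eqP :
    forall i t, (fun i t => (s^-1) ^+ i * z i (s^-1 * t + a)) i t = 0.
  rewrite /= mulrA mulVf ?(gt_eqF s0)// mul1r subrK mulf_eq0 expf_eq0 invr_eq0 (gt_eqF s0) andbF /=.
  by move/eqP.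
apply: (nz _) sL _ _ _.
- have := solution_affine s^-1 a zs; rewrite -sm -mulrA -exprMn divff ?gt_eqF//.
  by rewrite expr1n mulr1.
- by move=> j jA; rewrite mulr0 add0r zA// mulr0.
- by move=> j jB; rewrite mulrA mulVf ?gt_eqF// mul1r subrK zB// mulr0.
Qed.

Section EndpointSigns.
Variables (kappa : R) (y : nat -> R -> R) (a b : R) (A B : seq nat).
Hypotheses (ab : a < b) (AB : boundary_orders A B) (kappa0 : kappa != 0).
Hypotheses (kB : odd (size B) = (kappa < 0)) (ys : solution n kappa y).
Hypotheses (yA : vanishes_at A a y) (yB : vanishes_at B b y).
Hypothesis (yp : forall t, a < t < b -> 0 < y 0%N t).

Let n0 : (0 < n)%N := ltnW n1.

Let yn0 : exists i s, y i s != 0.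
Proof.
by exists 0%N, ((a + b) / 2); rewrite gt_eqF// yp//; have [-> ->] := midf_lt ab.
Qed.

Let nB : (n - size B)%N = size A.
Proof. by have [_ _ _ _ [_ _ <-]] := AB; rewrite addnK. Qed.

Let changes : [/\ changesR n y a = size B, changesL n y b = size B &
  (zeros n y a <= size A)%N].
Proof.
have [uA uB An Bn [A0 B0 ABn]] := AB.
have Bn' : (size B <= n)%N by rewrite -ABn leq_addl.
have nBA : (n - size B <= size A)%N by rewrite nB.
have [-> -> + _ _] := boundary_changes n1 kappa0 ys yn0 ab uA uB An Bn yA yB kB Bn' nBA (leqnSn _).
by rewrite nB.
Qed.

Let near_sign_value j c (F : set_system R) : F `=>` nbhs c -> y j c != 0 ->
  \forall u \near F, 0 < y j c * y j u.
Proof.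
move=> Fc yj; apply: Fc.
have : y j c * y j u @[u --> c] --> y j c * y j c.
  by apply: cvgM; [exact: cvg_cst|exact: (solution_continuous ys)].
by move/cvgr_gt; apply; rewrite -expr2 exprn_even_gt0.
Qed.

Let sign_transfer j c u p : 0 < y 0%N u -> 0 < y j c * y j u ->
  (y j u * y n u < 0) = odd p -> 0 < (-1) ^+ p * kappa * y j c.
Proof.
have := ys.2 0%N u; rewrite add0n => -> y0 yjj; rewrite mulrA pmulr_llt0// => e.
have : 0 < ((-1) ^+ p * (kappa * y j u)) * (y j c * y j u).
  rewrite pmulr_lgt0// -signr_odd -e [y j u * _]mulrC; case: (ltP (kappa * y j u) 0) => h.
    by rewrite /= expr1 mulN1r oppr_gt0.
  rewrite /= expr0 mul1r lt_neqAle h andbT eq_sym mulf_neq0//.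
  by apply: contraTneq yjj => ->; rewrite mulr0 ltxx.
have -> : (-1) ^+ p * (kappa * y j u) * (y j c * y j u) =
  ((-1) ^+ p * kappa * y j c) * (y j u ^+ 2) by ring.
rewrite pmulr_lgt0// exprn_even_gt0//=.
by apply: contraTneq yjj => ->; rewrite mulr0 ltxx.
Qed.

(** At [a] the bound [changesR + zeros <= n] is attained, so right changes occur exactly at the free
    orders; the parity of those from [j] on compares [y j] with [y n = kappa * y 0]. *)
Lemma left_endpoint_sign j : (j < n)%N -> j \notin A ->
  0 < (-1) ^+ (\sum_(j <= i < n) (i \notin A)) * kappa * y j a.
Proof.
move=> jn jA; have [uA uB An Bn [A0 B0 ABn]] := AB; have [cR _ za] := changes.
have yE := size_eq_zeros uA An yA za.
have zE : zeros n y a = size A.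
  by apply/eqP; rewrite eqn_leq za (size_le_zeros uA An yA).
have cE : forall i, (i < n)%N -> changeR y i a = (i \notin A).
  by move=> i ilt; rewrite (changeR_eq n0 kappa0 ys yn0 _ ilt) ?yE// cR zE addnC.
near a^'+ => u.
apply: (@sign_transfer j a u).
- apply: yp; apply/andP; split=> //; near: u; exact: nbhs_right_lt.
- near: u; apply: near_sign_value; first exact: cvg_within.
  by rewrite yE.
- have -> : (\sum_(j <= i < n) (i \notin A) = \sum_(j <= i < n) changeR y i a)%N.
    by apply: eq_big_nat => i /andP[_ ilt]; rewrite cE.
  by near: u; apply: (near_right_sign_last n0 kappa0 ys yn0); exact: ltnW.
Unshelve. all: by end_near. Qed.

(** At [b] it is the prescribed orders that carry the left changes. *)
Lemma right_endpoint_sign j : (j < n)%N -> j \notin B ->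
  0 < (-1) ^+ (\sum_(j <= i < n) (i \in B)) * kappa * y j b.
Proof.
move=> jn jB; have [uA uB An Bn [A0 B0 ABn]] := AB; have [_ cL _] := changes.
have zb : (zeros n y b <= size B)%N by rewrite -cL; exact: (zeros_changesL n0 kappa0 ys yn0).
have yE := size_eq_zeros uB Bn yB zb.
have zE : zeros n y b = size B.
  by apply/eqP; rewrite eqn_leq zb (size_le_zeros uB Bn yB).
have cE : forall i, (i < n)%N -> changeL y i b = (i \in B).
  by move=> i ilt; rewrite (changeL_eq n0 kappa0 ys yn0 _ ilt) ?yE// cL zE.
near b^'- => u.
apply: (@sign_transfer j b u).
- apply: yp; apply/andP; split=> //; near: u; exact: nbhs_left_gt.
- near: u; apply: near_sign_value; first exact: cvg_within.
  by rewrite yE.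
- have -> : (\sum_(j <= i < n) (i \in B) = \sum_(j <= i < n) changeL y i b)%N.
    by apply: eq_big_nat => i /andP[_ ilt]; rewrite cE.
  by near: u; apply: (near_left_sign_last n0 kappa0 ys yn0); exact: ltnW.
Unshelve. all: by end_near. Qed.

End EndpointSigns.

End FirstEigenvalue.

(** * Derivatives relative to the segment *)

Section RelativeDerivatives.
Context {R : realType}.
Variables (a b : R).
Hypothesis ab : a < b.
Implicit Types (f g : R -> R) (x t : R).

Lemma within_segment_proper x : x \in `[a, b] -> ProperFilter (within `[a, b] x^').
Proof.
rewrite in_itv/= => /andP[ax xb]; apply: Build_ProperFilter_ex => P [e /= e0 Pe].
have [xb'|bx] := ltP x b.
  pose y := Num.min ((x + b) / 2) (x + e / 2); have xy : x < y.
    by rewrite lt_min ltrDl divr_gt0// andbT; have [] := midf_lt xb'.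
  exists y; apply: Pe => /=; last 2 first.
  - by rewrite gt_eqF.
  - rewrite in_itv/= (le_trans ax (ltW xy))/= /y ge_min.
    by have [_ /ltW->] := midf_lt xb'.
  rewrite /ball/= distrC gtr0_norm ?subr_gt0// ltrBlDl /y gt_min.
  by apply/orP; right; lra.
have ax' : a < x by rewrite (lt_le_trans ab).
pose y := Num.max ((a + x) / 2) (x - e / 2); have yx : y < x.
  by rewrite gt_max ltrBlDr ltrDl divr_gt0// andbT; have [] := midf_lt ax'.
exists y; apply: Pe => /=; last 2 first.
- by rewrite lt_eqF.
- rewrite in_itv/= (le_trans (ltW yx) xb) andbT /y le_max.
  by have [/ltW->] := midf_lt ax'.
rewrite /ball/= gtr0_norm ?subr_gt0// ltrBlDr -ltrBlDl /y lt_max.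
by apply/orP; right; lra.
Qed.

Lemma derive_quotient_cvg f df x : is_derive x (1 : R) f df ->
  (f y - f x) / (y - x) @[y --> x^'] --> df.
Proof.
move=> fx; have : derivable f x 1 by case: fx.
move=> /cvg_ex[l fl]; have -> : df = l.
  by rewrite -[df]derive_val; apply/cvg_lim.
have sh : y - x @[y --> x^'] --> (0 : R)^'.
  move=> P [e /= e0 Pe]; exists e => //= y xy yx; apply: Pe => /=.
    by rewrite sub0r normrN distrC.
  by rewrite subr_eq0.
have := cvg_comp _ _ sh fl; apply: cvg_trans; apply: near_eq_cvg; near=> y => /=.
by rewrite /GRing.scale/= mulr1 subrK mulrC.
Unshelve. all: by end_near. Qed.

Lemma quotient_cvg_derive f l x : (f y - f x) / (y - x) @[y --> x^'] --> l ->
  is_derive x (1 : R) f l.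
Proof.
move=> fl; have sh : h + x @[h --> (0 : R)^'] --> x^'.
  move=> P [e /= e0 Pe]; exists e => //= y; rewrite /ball/= sub0r normrN => xy yx; apply: Pe => /=.
    by rewrite opprD addrCA subrr addr0 normrN.
  by rewrite -subr_eq0 addrK.
have fl' : h^-1 *: ((f \o shift x) (h *: 1) - f x) @[h --> (0 : R)^'] --> l.
  have := cvg_comp _ _ sh fl; apply: cvg_trans; apply: near_eq_cvg; near=> y => /=.
  by rewrite /GRing.scale/= mulr1 addrK mulrC.
apply: DeriveDef; first by apply/cvg_ex; exists l.
exact/cvg_lim.
Unshelve. all: by end_near. Qed.

Lemma derivableI_interior f x : x \in `]a, b[ -> derivableI a b f x ->
  is_derive x (1 : R) f (derivI a b f x).
Proof.
move=> xI fd; apply: quotient_cvg_derive; apply: cvg_trans fd.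
move=> P [e /= e0 Pe]; have /andP[ax xb] : a < x < b by move: xI; rewrite in_itv.
exists (Num.min e (Num.min (x - a) (b - x))).
  by rewrite /= !lt_min e0 !subr_gt0 ax xb.
move=> y /=; rewrite !lt_min => /and3P[ye ya yb] yx; apply: Pe => //=.
move: ya yb; rewrite !ltr_distlC in_itv/= => /andP[h1 h2] /andP[h3 h4].
by apply/andP; split; lra.
Qed.

Lemma derivI_eq f g dg x : {in `[a, b], f =1 g} -> x \in `[a, b] ->
  is_derive x (1 : R) g dg -> derivableI a b f x /\ derivI a b f x = dg.
Proof.
move=> fg xI gx; have PF := within_segment_proper xI.
have fl : (f y - f x) / (y - x) @[y --> within `[a, b] x^'] --> dg.
  have : (g y - g x) / (y - x) @[y --> within `[a, b] x^'] --> dg.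
    by apply: cvg_within_filter; exact: derive_quotient_cvg.
  apply: cvg_trans; apply: near_eq_cvg; near=> y.
  rewrite !fg//; near: y.
  by apply: withinT.
by split; [apply/cvg_ex; exists dg|exact/cvg_lim].
Unshelve. all: by end_near. Qed.

Lemma derivableI_right f : derivableI a b f a -> f t @[t --> a^'+] --> f a.
Proof.
move=> /cvg_ex[l fl].
have fl' : (f y - f a) / (y - a) @[y --> a^'+] --> l.
  apply: cvg_trans fl => P [e /= e0 Pe].
  exists (Num.min e (b - a)); first by rewrite /= lt_min e0 subr_gt0.
  move=> y /=; rewrite lt_min => /andP[ye yb] ay; apply: Pe => //=.
    by rewrite gt_eqF.
  by rewrite in_itv/= ltW//=; move: yb; rewrite ltr0_norm ?subr_lt0// opprB ltrD2r => /ltW.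
have : f a + (f y - f a) / (y - a) * (y - a) @[y --> a^'+] --> f a + l * (a - a).
  apply: cvgD; first exact: cvg_cst.
  apply: cvgM => //; apply: cvgB; last exact: cvg_cst.
  by apply: cvg_at_right_filter; exact: cvg_id.
rewrite subrr mulr0 addr0; apply: cvg_trans; apply: near_eq_cvg; near=> y.
by rewrite divfK ?subr_eq0 ?gt_eqF// addrC subrK.
Unshelve. all: by end_near. Qed.

Lemma derivableI_left f : derivableI a b f b -> f t @[t --> b^'-] --> f b.
Proof.
move=> /cvg_ex[l fl].
have fl' : (f y - f b) / (y - b) @[y --> b^'-] --> l.
  apply: cvg_trans fl => P [e /= e0 Pe].
  exists (Num.min e (b - a)); first by rewrite /= lt_min e0 subr_gt0.
  move=> y /=; rewrite lt_min => /andP[ye yb] ay; apply: Pe => //=.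
    by rewrite lt_eqF.
  rewrite in_itv/= [y <= b]ltW// andbT; move: yb.
  by rewrite gtr0_norm ?subr_gt0// ltrD2l ltrN2 => /ltW.
have : f b + (f y - f b) / (y - b) * (y - b) @[y --> b^'-] --> f b + l * (b - b).
  apply: cvgD; first exact: cvg_cst.
  apply: cvgM => //; apply: cvgB; last exact: cvg_cst.
  by apply: cvg_at_left_filter; exact: cvg_id.
rewrite subrr mulr0 addr0; apply: cvg_trans; apply: near_eq_cvg; near=> y.
by rewrite divfK ?subr_eq0 ?lt_eqF// addrC subrK.
Unshelve. all: by end_near. Qed.

End RelativeDerivatives.

(** * Eigenvalues in terms of global solutions *)

Section Eigenvalues.
Context {R : realType}.
Variables (a b : R) (n : nat).
Hypotheses (ab : a < b) (n0 : (0 < n)%N).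
Implicit Types (y : nat -> R -> R) (kappa lambda t x : R) (A B : seq nat).

Lemma nderivI_solution kappa y i : solution n kappa y ->
  {in `[a, b], nderivI a b i (y 0%N) =1 y i}.
Proof.
move=> ys; elim: i => [//|i ih] t tI.
by have [_] := derivI_eq ab ih tI (ys.1 i t).
Qed.

Lemma solution_classC kappa y : solution n kappa y -> classC a b n (y 0%N).
Proof.
move=> ys; split=> [i t _ tI|].
  by have [] := derivI_eq ab (nderivI_solution i ys) tI (ys.1 i t).
apply: (@subspace_eq_continuous _ `[a, b]%classic _ (y n)).
  by move=> t; rewrite inE => tI; apply/esym; exact: (nderivI_solution n ys).
exact/continuous_subspaceT/(solution_continuous ys).
Qed.

Lemma eq_solution_oo kappa y (z : nat -> R -> R) (c d : R) : c < d -> solution n kappa y ->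
  (forall i x, (i < n)%N -> x \in `]c, d[ -> is_derive x (1 : R) (z i) (z i.+1 x)) ->
  (forall x, x \in `]c, d[ -> z n x = kappa * z 0%N x) ->
  (forall i, (i < n)%N -> z i t @[t --> c^'+] --> y i c) ->
  forall i x, (i < n)%N -> x \in `]c, d[ -> z i x = y i x.
Proof.
move=> cd ys dz nz lz i x ilt xI; apply/eqP; rewrite -subr_eq0; apply/eqP.
apply: (@zero_right_limits _ n kappa (fun j => (z j : R -> R) - y j) c d) => //.
- by move=> j u jlt uI; exact: (is_deriveB (dz j u jlt uI) (ys.1 j u)).
- move=> u uI; rewrite !fctE nz//; have := ys.2 0%N u; rewrite add0n => ->.
  by rewrite mulrBr.
- move=> j jlt; rewrite -(subrr (y j c)); apply: cvgB; first exact: lz.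
  by apply: cvg_at_right_filter; exact: (solution_continuous ys).
Qed.

(** The global solution with the data of [u] at [a] agrees with [u] inside by uniqueness from right
    limits, and at [b] by left continuity. *)
Lemma classC_solution lambda (u : R -> R) : classC a b n u ->
  {in `[a, b], forall t, T_op a b n lambda u t = 0} ->
  exists2 y, solution n (- lambda) y &
    forall i, (i < n)%N -> {in `[a, b], nderivI a b i u =1 y i}.
Proof.
move=> [du _] Tu.
have [y ys y0] := solution_exists (- lambda) a (fun i => nderivI a b i u a) n0.
exists y => // i ilt.
have aI : a \in `[a, b] by rewrite in_itv/= lexx ltW.
have bI : b \in `[a, b] by rewrite in_itv/= lexx ltW.
have oo j : (j < n)%N -> {in `]a, b[, nderivI a b j u =1 y j}.
  move=> jlt t tI; apply: (eq_solution_oo (z := fun j => nderivI a b j u) ab ys) => //.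
  - move=> k x kn xI; apply: derivableI_interior => //; apply: du => //.
    exact: subset_itv_oo_cc.
  - move=> x xI; have := Tu x (subset_itv_oo_cc xI).
    by rewrite /T_op => /eqP; rewrite addr_eq0 mulNr => /eqP.
  - by move=> k kn; rewrite y0//; apply: (derivableI_right ab); exact: du.
move=> t tI; have /andP[at_ tb] : a <= t <= b by move: tI; rewrite in_itv.
have [->|ta] := eqVneq t a; first by rewrite y0.
have [->|tb'] := eqVneq t b; last first.
  by apply: oo => //; rewrite in_itv/= !lt_neqAle at_ tb tb' eq_sym ta.
have l1 := derivableI_left ab (du i b ilt bI).
have l2 : nderivI a b i u t @[t --> b^'-] --> y i b.
  have : y i t @[t --> b^'-] --> y i b.
    by apply: cvg_at_left_filter; exact: (solution_continuous ys).
  apply: cvg_trans; apply: near_eq_cvg; near=> x; rewrite oo// in_itv/=.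
  by apply/andP; split=> //; near: x; exact: nbhs_left_gt.
exact: (cvg_unique _ l1 l2).
Unshelve. all: by end_near. Qed.

Lemma zero_on_interval kappa y : solution n kappa y ->
  {in `]a, b[, forall t, y 0%N t = 0} -> forall i t, y i t = 0.
Proof.
move=> ys y0; have z i : {in `]a, b[, forall t, y i t = 0}.
  elim: i => [|i ih] t tI; first exact: y0.
  have [_ <-] := ys.1 i t.
  have [_ <-] : is_derive t (1 : R) (y i) 0; last by [].
  apply: (derive1_at_min (ltW ab)) (tI) _ => [x _|x xI]; first by case: (ys.1 i x).
  by rewrite (ih t tI) (ih x xI).
have mI : (a + b) / 2 \in `]a, b[ by exact: mid_in_itvoo.
by apply: (solution_eq0 (s := (a + b) / 2) n0 ys) => i _; exact: z.
Qed.

Lemma eigenvalueP A B lambda : all (fun i => (i < n)%N) A -> all (fun i => (i < n)%N) B ->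
  Defs.eigenvalue a b n A B lambda <->
  exists y, [/\ solution n (- lambda) y, exists i s, y i s != 0,
    vanishes_at A a y & vanishes_at B b y].
Proof.
move=> An Bn; have aI : a \in `[a, b] by rewrite in_itv/= lexx ltW.
have bI : b \in `[a, b] by rewrite in_itv/= lexx ltW.
split=> [[u [[uC [uA uB]] [t tI ut] Tu]]|[y [ys [i [s yn0]] yA yB]]].
  have [y ys uy] := classC_solution uC Tu; exists y; split=> //.
  - by exists 0%N, t; rewrite -uy.
  - by move=> i iA; rewrite -uy ?uA// (allP An).
  - by move=> i iB; rewrite -uy ?uB// (allP Bn).
exists (y 0%N); split.
- split; first exact: solution_classC ys.
  by split=> j jI; rewrite (nderivI_solution _ ys)//; [exact: yA|exact: yB].
- apply: contrapT => no; move/eqP: yn0; apply; apply: (zero_on_interval ys) => t tI.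
  apply: contrapT => /eqP yt; apply: no; exists t => //.
  exact: subset_itv_oo_cc.
- move=> t tI; rewrite /T_op (nderivI_solution _ ys)//.
  by have := ys.2 0%N t; rewrite add0n => ->; rewrite mulNr addNr.
Qed.

End Eigenvalues.

(** * Sign of the leading derivative at an end point *)

Section LeadingSigns.
Context {R : realType}.
Implicit Types (f df : R -> R) (z : nat -> R -> R) (a b c t s l e : R).

(** Version of [near_right_sign] for functions controlled on one side only, such as [g] near an end
    point. *)
Lemma near_right_sign_lim f df t s : (\forall u \near t^'+, is_derive u (1 : R) f (df u)) ->
  f x @[x --> t^'+] --> 0 -> (\forall u \near t^'+, 0 < s * df u) ->
  \forall u \near t^'+, 0 < s * f u.
Proof.
move=> /near_rightP[d1 d10 dfE] ft0 /near_rightP[d2 d20 dfp].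
apply/near_rightP; exists (Num.min d1 d2); first by rewrite lt_min d10.
move=> u /andP[tu ud].
have [ud1 ud2] : u < t + d1 /\ u < t + d2.
  by split; apply: (lt_le_trans ud); rewrite lerD2l ge_min lexx ?orbT.
have mono v w : t < v -> v < w -> w <= u -> s * f v < s * f w.
  move=> tv vw wu; apply: (@derive_gt0_lt _ (s \*: (f : R -> R)) (fun x => s * df x)) => // x.
    rewrite in_itv/= => /andP[vx xw]; apply: is_deriveZ; apply: dfE.
    by rewrite (lt_le_trans tv)//= (le_lt_trans xw)// (le_lt_trans wu).
  rewrite in_itv/= => /andP[vx xw]; apply: dfp.
  by rewrite (lt_trans tv)//= (lt_trans xw)// (le_lt_trans wu).
(* The limit only gives [0 <= s * f m]; the intermediate point [m] makes the inequality at [u]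
   strict. *)
have [tm mu] := midf_lt tu; set m := (t + u) / 2 in tm mu.
apply: le_lt_trans (mono m u tm mu (lexx u)).
have sf : s * f x @[x --> t^'+] --> s * 0 by apply: cvgM => //; exact: cvg_cst.
rewrite -(mulr0 s) -(cvg_lim _ sf)//; apply: limr_le; first by apply/cvg_ex; eexists; exact: sf.
near=> v; apply/ltW/mono => //; last exact: ltW.
Unshelve. all: by end_near. Qed.

Lemma near_left_sign_lim f df t s : (\forall u \near t^'-, is_derive u (1 : R) f (df u)) ->
  f x @[x --> t^'-] --> 0 -> (\forall u \near t^'-, 0 < s * df u) ->
  \forall u \near t^'-, 0 < - s * f u.
Proof.
move=> /near_leftP[d1 d10 dfE] ft0 /near_leftP[d2 d20 dfp].
apply/near_leftP; exists (Num.min d1 d2); first by rewrite lt_min d10.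
move=> u /andP[ud ut].
have [ud1 ud2] : t - d1 < u /\ t - d2 < u.
  by split; apply: (le_lt_trans _ ud); rewrite lerD2l lerN2 ge_min lexx ?orbT.
have mono v w : u <= v -> v < w -> w < t -> s * f v < s * f w.
  move=> uv vw wt; apply: (@derive_gt0_lt _ (s \*: (f : R -> R)) (fun x => s * df x)) => // x.
    rewrite in_itv/= => /andP[vx xw]; apply: is_deriveZ; apply: dfE.
    by rewrite (le_lt_trans xw)// (lt_le_trans ud1)// (le_trans uv).
  rewrite in_itv/= => /andP[vx xw]; apply: dfp.
  by rewrite (lt_trans xw)// (lt_le_trans ud2)// (le_trans uv)// ltW.
have [um mt] := midf_lt ut; set m := (u + t) / 2 in um mt.
rewrite mulNr oppr_gt0; apply: lt_le_trans (mono u m (lexx u) um mt) _.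
have sf : s * f x @[x --> t^'-] --> s * 0 by apply: cvgM => //; exact: cvg_cst.
rewrite -(mulr0 s) -(cvg_lim _ sf)//; apply: limr_ge; first by apply/cvg_ex; eexists; exact: sf.
near=> v; apply/ltW/mono => //; first exact: ltW.
Unshelve. all: by end_near. Qed.

Lemma near_right_in_itv a b : a < b -> \forall u \near a^'+, u \in `]a, b[.
Proof.
by move=> ab; near=> u; rewrite in_itv/=; apply/andP; split=> //; near: u; exact: nbhs_right_lt.
Unshelve. all: by end_near. Qed.

Lemma near_left_in_itv a b : a < b -> \forall u \near b^'-, u \in `]a, b[.
Proof.
by move=> ab; near=> u; rewrite in_itv/=; apply/andP; split=> //; near: u; exact: nbhs_left_gt.
Unshelve. all: by end_near. Qed.

(** If [e * l] were positive, integrating down from order [p] would make [e * z q] positive near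
    [c]. In [leading_left] each of the [p - q] integrations reverses the sign. *)
Lemma leading_right z q p c l e : (q <= p)%N ->
  (forall i, (q <= i < p)%N -> \forall u \near c^'+, is_derive u (1 : R) (z i) (z i.+1 u)) ->
  (forall i, (q <= i < p)%N -> z i t @[t --> c^'+] --> 0) ->
  z p t @[t --> c^'+] --> l -> (\forall u \near c^'+, e * z q u <= 0) -> e * l <= 0.
Proof.
move=> qp dz z0 zl ez; rewrite leNgt; apply/negP => el.
have H j : (j <= p - q)%N -> \forall u \near c^'+, 0 < e * z (p - j)%N u.
  elim: j => [|j ih] jle.
    rewrite subn0; have : e * z p t @[t --> c^'+] --> e * l.
      by apply: cvgM => //; exact: cvg_cst.
    by move/cvgr_gt; apply.
  have iE : (p - j)%N = (p - j.+1).+1 by lia.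
  have rg : (q <= p - j.+1 < p)%N by lia.
  apply: (near_right_sign_lim (dz _ rg) (z0 _ rg)).
  by rewrite -iE; apply: ih; exact: ltnW.
have := H (p - q)%N (leqnn _); rewrite subKn// => H'.
near c^'+ => u; have : 0 < e * z q u by near: u.
by rewrite ltNge => /negP; apply; near: u.
Unshelve. all: by end_near. Qed.

Lemma leading_left z q p c l e : (q <= p)%N ->
  (forall i, (q <= i < p)%N -> \forall u \near c^'-, is_derive u (1 : R) (z i) (z i.+1 u)) ->
  (forall i, (q <= i < p)%N -> z i t @[t --> c^'-] --> 0) ->
  z p t @[t --> c^'-] --> l -> (\forall u \near c^'-, e * z q u <= 0) ->
  (-1) ^+ (p - q) * e * l <= 0.
Proof.
move=> qp dz z0 zl ez; rewrite leNgt; apply/negP => el.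
have H j : (j <= p - q)%N -> \forall u \near c^'-, 0 < (-1) ^+ (p - q - j) * e * z (p - j)%N u.
  elim: j => [|j ih] jle.
    rewrite !subn0; have : (-1) ^+ (p - q) * e * z p t @[t --> c^'-] --> (-1) ^+ (p - q) * e * l.
      by apply: cvgM => //; exact: cvg_cst.
    by move/cvgr_gt; apply.
  have iE : (p - j)%N = (p - j.+1).+1 by lia.
  have rg : (q <= p - j.+1 < p)%N by lia.
  have -> : (-1) ^+ (p - q - j.+1) * e = - ((-1) ^+ (p - q - j) * e).
    rewrite (_ : (p - q - j = (p - q - j.+1).+1)%N); last by lia.
    by rewrite exprS; ring.
  apply: (near_left_sign_lim (dz _ rg) (z0 _ rg)).
  by rewrite -iE; apply: ih; exact: ltnW.
have := H (p - q)%N (leqnn _); rewrite subnn expr0 mul1r subKn// => H'.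
near c^'- => u; have : 0 < e * z q u by near: u.
by rewrite ltNge => /negP; apply; near: u.
Unshelve. all: by end_near. Qed.

End LeadingSigns.

(** * Solvability of two-point problems *)

Section MixedBoundaryProblem.
Context {R : realType}.
Variables (n : nat) (kappa : R).
Hypothesis n0 : (0 < n)%N.

(* A condition is a pair of a point and an order of derivation. *)
Lemma mixed_problem_solvable (rows : seq (R * nat)) (w : R * nat -> R) :
  size rows = n ->
  (forall y, solution n kappa y -> {in rows, forall x, y x.2 x.1 = 0} -> forall i t, y i t = 0) ->
  exists2 y, solution n kappa y & {in rows, forall x, y x.2 x.1 = w x}.
Proof.
move=> rn triv; have [E EP] := solution_basis kappa n0.
pose x0 : R * nat := (0, 0%N).
pose Q : 'M[R]_n := \matrix_(i, r) E r (nth x0 rows i).2 (nth x0 rows i).1.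
pose sol (v : 'I_n -> R) i t := \sum_(r < n) v r * E r i t.
have solP v : solution n kappa (sol v).
  by apply: solution_sum => r; exact: (EP r (ltn_ord r)).1.
have sol0 v (i : 'I_n) : sol v i 0 = v i.
  rewrite /sol (bigD1 i)//= (EP i (ltn_ord i)).2// eqxx mulr1 big1 ?addr0//.
  by move=> r ri; rewrite (EP r (ltn_ord r)).2// eq_sym val_eqE (negPf ri) mulr0.
have rowsP (P : R * nat -> Prop) : (forall i : 'I_n, P (nth x0 rows i)) -> {in rows, forall x, P x}.
  move=> H x xr; have ix : (index x rows < n)%N by rewrite -rn index_mem.
  by have := H (Ordinal ix); rewrite /= nth_index.
(* A kernel vector of the matrix of conditions is a solution of the homogeneous problem. *)
have Qu : Q \in unitmx.
  rewrite unitmxE unitfE -det_tr; apply/det0P => -[v v0 vQ].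
  have z := triv (sol (fun r => v 0 r)) (solP _).
  move/eqP: v0; apply; apply/rowP => r; rewrite mxE -(sol0 (fun r => v 0 r)) z//.
  apply: rowsP => i; have := congr1 (fun N : 'rV[R]_n => N 0 i) vQ.
  by rewrite !mxE => e; rewrite -[RHS]e; apply: eq_bigr => j _; rewrite !mxE.
pose c : 'cV[R]_n := invmx Q *m \col_i w (nth x0 rows i).
exists (sol (fun r => c r 0)); first exact: solP.
apply: rowsP => i.
have := congr1 (fun N : 'cV[R]_n => N i 0) (mulKVmx Qu (\col_i w (nth x0 rows i))).
rewrite -/c [RHS]mxE => <-; rewrite [RHS]mxE; apply: eq_bigr => r _.
by rewrite !mxE mulrC.
Qed.

End MixedBoundaryProblem.

Lemma predn_subK n p : (p < n)%N -> (n.-1 - (n.-1 - p))%N = p.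
Proof. lia. Qed.

Lemma predn_sub_lt n p : (p < n)%N -> (n.-1 - p < n)%N.
Proof. lia. Qed.

Lemma predn_sub_eq n m : (m < n)%N -> (n.-1 - m == n.-1)%N = (m == 0%N).
Proof. by move=> mn; apply/eqP/eqP; lia. Qed.

(** * Boundary values of the Green's function as adjoint solutions *)

Section GreenFunction.
Context {R : realType}.
Variables (a b : R) (n : nat) (M : R) (sigma eps : seq nat) (g : R -> R -> R).
Hypotheses (ab : a < b) (n1 : (1 < n)%N) (Hg : is_green a b n M sigma eps g).
Hypotheses (sigma_eps : boundary_orders n sigma eps).

Let n0 : (0 < n)%N := ltnW n1.
(** Constant of the adjoint equation. *)
Let kappa := (-1) ^+ n * - M.
Let z s i t := partial_t a b i g t s.

Let aI : a \in `[a, b]. Proof. by rewrite in_itv/= lexx ltW. Qed.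
Let bI : b \in `[a, b]. Proof. by rewrite in_itv/= lexx ltW. Qed.
Let sI s : s \in `]a, b[ -> [/\ s \in `[a, b], a < s & s < b].
Proof. by move=> h; split; [exact: subset_itv_oo_cc|rewrite (itvP h)|rewrite (itvP h)]. Qed.

Lemma green_derivableI s i t : s \in `]a, b[ -> (i < n)%N -> t \in `[a, b] -> t != s ->
  derivableI a b (z s i) t.
Proof.
move=> /sI[s_ _ _] ilt tI ts; have [H1 _ _ _ _] := Hg.
by apply: H1 => //; right.
Qed.

Lemma green_is_derive s i t : s \in `]a, b[ -> (i < n)%N -> t \in `]a, b[ -> t != s ->
  is_derive t (1 : R) (z s i) (z s i.+1 t).
Proof.
move=> sab ilt tI ts; apply: (derivableI_interior tI).
by apply: green_derivableI => //; exact: subset_itv_oo_cc.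
Qed.

Lemma green_cvg_left s i : s \in `]a, b[ -> (i < n)%N -> z s i t @[t --> a^'+] --> z s i a.
Proof.
move=> sab ilt; apply: (derivableI_right ab); apply: green_derivableI => //.
by have [_ /lt_eqF->] := sI sab.
Qed.

Lemma green_cvg_right s i : s \in `]a, b[ -> (i < n)%N -> z s i t @[t --> b^'-] --> z s i b.
Proof.
move=> sab ilt; apply: (derivableI_left ab); apply: green_derivableI => //.
by have [_ _ /gt_eqF->] := sI sab.
Qed.

Let green_diagonal s i (F : set_system R) {FF : ProperFilter F} : s \in `]a, b[ -> (i <= n - 2)%N ->
  F --> s -> z s i t @[t --> F] --> z s i s.
Proof.
move=> sab ile Fs; have [s_ as_ sb] := sI sab; have [_ H2 _ _ _] := Hg.
have sq : square a b (s, s) by split.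
have := H2 i ile; rewrite subspace_continuousP => /(_ (s, s) sq) H.
have : (t, s) @[t --> F] --> within (square a b) (nbhs (s, s)).
  move=> P; rewrite /within/= => PW.
  have FP : \forall t \near F, square a b (t, s) -> P (t, s).
    have c1 : t @[t --> F] --> s by exact: Fs.
    have c2 : s @[_ --> F] --> s by exact: cvg_cst.
    have c : (t, s) @[t --> F] --> (s, s) by exact: (cvg_pair c1 c2).
    exact: (c _ PW).
  have FA : \forall t \near F, square a b (t, s).
    have h : \forall t \near s, a < t < b.
      by near=> t; apply/andP; split; near: t; [exact: lt_nbhsr|exact: lt_nbhsl].
    have := Fs _ h; apply: filterS => t /andP[at_ tb].
    by split=> //=; rewrite in_itv/= !ltW.
  by move: FP FA; apply: filterS2 => t; apply.
move/cvg_comp => /(_ _ _ _ H); exact.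
Unshelve. all: by end_near. Qed.

Lemma green_equation s t : s \in `]a, b[ -> t \in `[a, b] -> t != s ->
  z s n t = - M * z s 0%N t.
Proof.
move=> sab tI ts; have [_ _ _ _ /(_ s sab)[/(_ t tI ts) + _]] := Hg.
by rewrite /T_op => /eqP; rewrite addr_eq0 mulNr => /eqP.
Qed.

(* Integrating the Lagrange identity on both sides of the diagonal leaves the
   unit jump of the derivative of order [n - 1]. *)
Lemma green_jump G s : solution n kappa G -> s \in `]a, b[ ->
  concomitant n G (z s) b - concomitant n G (z s) a = G 0%N s.
Proof.
move=> Gs sab; have [s_ as_ sb] := sI sab.
have [_ _ _ /(_ s sab)[lp [lm [cp _ cm _ jump]]] _] := Hg.
(* One-sided limits at [s]: only the derivative of order [n - 1] depends on the side. *)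
pose l (v : R) i := if i == n.-1 then v else z s i s.
have dW c d : {in `]c, d[, forall t, (t \in `]a, b[) /\ (t != s)} ->
    forall t, t \in `]c, d[ -> is_derive t (1 : R) (concomitant n G (z s)) 0.
  move=> sub t tI; have [tab ts] := sub t tI; apply: is_derive_eq.
    by apply: is_derive_concomitant => i ilt; [exact: Gs.1|exact: green_is_derive].
  rewrite green_equation//; last exact: subset_itv_oo_cc.
  have := Gs.2 0%N t; rewrite add0n => ->.
  by rewrite /kappa !mulrA -exprMn mulN1r opprK expr1n mul1r; ring.
have GF (F : set_system R) c (FF : Filter F) : F --> c ->
    forall m, (m < n)%N -> G m t @[t --> F] --> G m c.
  by move=> Fc m _; apply: cvg_trans (solution_continuous Gs (x := c)); exact: cvg_app.
have zF (F : set_system R) (FF : ProperFilter F) v : F --> s -> z s n.-1 t @[t --> F] --> v ->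
    forall i, (i < n)%N -> z s i t @[t --> F] --> l v i.
  move=> Fs Fv i ilt; rewrite /l; case: eqP => [->//|ine].
  by apply: green_diagonal => //; lia.
have cvR : s^'+ --> s by apply: cvg_within.
have cvL : s^'- --> s by apply: cvg_within.
have cvA : a^'+ --> a by apply: cvg_within.
have cvB : b^'- --> b by apply: cvg_within.
have R1 := concomitant_cvg (GF _ _ _ cvR) (zF _ _ _ cvR cp).
have L1 := concomitant_cvg (GF _ _ _ cvL) (zF _ _ _ cvL cm).
have A1 := concomitant_cvg (GF _ _ _ cvA) (fun i ilt => green_cvg_left sab ilt).
have B1 := concomitant_cvg (GF _ _ _ cvB) (fun i ilt => green_cvg_right sab ilt).
have subR : {in `]s, b[, forall t, (t \in `]a, b[) /\ (t != s)}.
  move=> t; rewrite !in_itv/= => /andP[st tb].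
  by rewrite (lt_trans as_ st) tb gt_eqF.
have subL : {in `]a, s[, forall t, (t \in `]a, b[) /\ (t != s)}.
  move=> t; rewrite !in_itv/= => /andP[at_ ts].
  by rewrite (lt_trans ts sb) at_ lt_eqF.
have mR : (s + b) / 2 \in `]s, b[ by exact: mid_in_itvoo.
have mL : (a + s) / 2 \in `]a, s[ by exact: mid_in_itvoo.
have eB := derive_constant_left (dW _ _ subR) (B1 _ _) mR.
rewrite (derive_constant_right (dW _ _ subR) (R1 _ _ _) mR) in eB.
have eA := derive_constant_right (dW _ _ subL) (A1 _ _) mL.
rewrite (derive_constant_left (dW _ _ subL) (L1 _ _ _) mL) in eA.
rewrite /concomitant -eA -eB -sumrB (bigD1 (Ordinal n0))//= subn0 /l eqxx.
rewrite expr0 mul1r -mulrBr jump mulr1 big1 ?addr0// => m m0.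
by rewrite predn_sub_eq// (negPf (m0 : nat_of_ord m != 0%N)) subrr.
Qed.

Lemma green_boundary s : s \in `]a, b[ ->
  {in sigma, forall i, z s i a = 0} /\ {in eps, forall i, z s i b = 0}.
Proof. by move=> sab; have [_ _ _ _ /(_ s sab)[_ []]] := Hg. Qed.

(** One condition of order [m] for every free order [n - 1 - m]: these match the summands of the
    concomitant that the conditions on [g] do not kill. *)
Definition adjoint_conditions : seq (R * nat) :=
  [seq (a, m) | m <- iota 0 n & (n.-1 - m)%N \notin sigma] ++
  [seq (b, m) | m <- iota 0 n & (n.-1 - m)%N \notin eps].

Lemma adjoint_conditions_left m : (m < n)%N -> (n.-1 - m)%N \notin sigma ->
  (a, m) \in adjoint_conditions.
Proof.
move=> mn h; rewrite mem_cat; apply/orP; left; apply/mapP; exists m => //.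
by rewrite mem_filter h mem_iota.
Qed.

Lemma adjoint_conditions_right m : (m < n)%N -> (n.-1 - m)%N \notin eps ->
  (b, m) \in adjoint_conditions.
Proof.
move=> mn h; rewrite mem_cat; apply/orP; right; apply/mapP; exists m => //.
by rewrite mem_filter h mem_iota.
Qed.

Lemma size_adjoint_conditions : size adjoint_conditions = n.
Proof.
have [us ue sn en [_ _ se]] := sigma_eps.
have cnt (s : seq nat) : uniq s -> all (fun i => (i < n)%N) s ->
    (size [seq m <- iota 0 n | (n.-1 - m)%N \notin s] + size s)%N = n.
  move=> us' /allP sn'; pose r m := (n.-1 - m)%N.
  have -> : size s = size [seq r m | m <- iota 0 n & r m \in s].
    apply/perm_size/uniq_perm => //.
      rewrite map_inj_in_uniq ?filter_uniq ?iota_uniq// => m1 m2.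
      by rewrite !mem_filter !mem_iota /r => /andP[_ h1] /andP[_ h2]; lia.
    move=> i; apply/idP/mapP => [iS|[m]]; last by rewrite mem_filter => /andP[ms _] ->.
    have ilt := sn' i iS; exists (r i); last by rewrite /r predn_subK.
    by rewrite mem_filter mem_iota /r predn_subK// iS predn_sub_lt.
  rewrite size_map !size_filter addnC -[RHS](size_iota 0 n).
  by rewrite -(count_predC (fun m => r m \in s)).
rewrite size_cat !size_map; have := cnt _ us sn; have := cnt _ ue en; lia.
Qed.

(** All boundary terms vanish, so the jump formula gives [G 0 s = 0]: the mere existence of [g]
    makes the adjoint problem uniquely solvable. *)
Lemma adjoint_trivial G : solution n kappa G ->
  {in adjoint_conditions, forall x, G x.2 x.1 = 0} -> forall i t, G i t = 0.
Proof.
move=> Gs G0; apply: (zero_on_interval ab n0 Gs) => s sab.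
have [zs ze] := green_boundary sab.
rewrite -(green_jump Gs sab) /concomitant !big1 ?subrr// => m _.
  have [ms|ms] := boolP ((n.-1 - m)%N \in sigma); first by rewrite zs// mulr0.
  by rewrite (G0 (a, nat_of_ord m)) ?mulr0 ?mul0r// adjoint_conditions_left.
have [ms|ms] := boolP ((n.-1 - m)%N \in eps); first by rewrite ze// mulr0.
by rewrite (G0 (b, nat_of_ord m)) ?mulr0 ?mul0r// adjoint_conditions_right.
Qed.

(** Nonzero data at the single order [n - 1 - p] leave one boundary term in the jump formula, the
    one containing the derivative of order [p] of [g] at [a]. *)
Lemma green_value_left p : (p < n)%N -> p \notin sigma ->
  exists G, [/\ solution n kappa G,
    forall m, (m < n)%N -> (n.-1 - m)%N \notin sigma -> m != (n.-1 - p)%N -> G m a = 0,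
    (-1) ^+ (n.-1 - p) * G (n.-1 - p)%N a = -1,
    forall m, (m < n)%N -> (n.-1 - m)%N \notin eps -> G m b = 0 &
    forall s, s \in `]a, b[ -> G 0%N s = partial_t a b p g a s].
Proof.
move=> pn ps; pose w (x : R * nat) : R :=
  if x == (a, (n.-1 - p)%N) then - (-1) ^+ (n.-1 - p) else 0.
have [G Gs GP] := mixed_problem_solvable n0 w size_adjoint_conditions adjoint_trivial.
have pE := predn_subK pn.
have Ga m : (m < n)%N -> (n.-1 - m)%N \notin sigma -> m != (n.-1 - p)%N -> G m a = 0.
  move=> mn ms mp; rewrite (GP (a, m) (adjoint_conditions_left mn ms)) /w.
  by rewrite xpair_eqE eqxx (negPf mp).
have Gp : (-1) ^+ (n.-1 - p) * G (n.-1 - p)%N a = -1.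
  rewrite (GP (a, (n.-1 - p)%N)) ?/w ?eqxx; last first.
    by apply: adjoint_conditions_left; [exact: predn_sub_lt|rewrite pE].
  by rewrite mulrN -exprMn mulN1r opprK expr1n.
have Gb m : (m < n)%N -> (n.-1 - m)%N \notin eps -> G m b = 0.
  move=> mn ms; rewrite (GP (b, m) (adjoint_conditions_right mn ms)) /w.
  by rewrite xpair_eqE (gt_eqF ab).
exists G; split=> // s sab; have [zs ze] := green_boundary sab.
rewrite -(green_jump Gs sab) {1}/concomitant big1 ?sub0r; last first.
  move=> m _; have [ms|ms] := boolP ((n.-1 - m)%N \in eps); first by rewrite ze// mulr0.
  by rewrite Gb// mulr0 mul0r.
have pn' := predn_sub_lt pn.
rewrite /concomitant (bigD1 (Ordinal pn'))//= Gp pE big1 ?addr0 ?mulN1r ?opprK//.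
move=> m mp; have [ms|ms] := boolP ((n.-1 - m)%N \in sigma); first by rewrite zs// mulr0.
by rewrite Ga// mulr0 mul0r.
Qed.

Lemma green_value_right p : (p < n)%N -> p \notin eps ->
  exists G, [/\ solution n kappa G,
    forall m, (m < n)%N -> (n.-1 - m)%N \notin eps -> m != (n.-1 - p)%N -> G m b = 0,
    (-1) ^+ (n.-1 - p) * G (n.-1 - p)%N b = 1,
    forall m, (m < n)%N -> (n.-1 - m)%N \notin sigma -> G m a = 0 &
    forall s, s \in `]a, b[ -> G 0%N s = partial_t a b p g b s].
Proof.
move=> pn ps; pose w (x : R * nat) : R :=
  if x == (b, (n.-1 - p)%N) then (-1) ^+ (n.-1 - p) else 0.
have [G Gs GP] := mixed_problem_solvable n0 w size_adjoint_conditions adjoint_trivial.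
have pE := predn_subK pn.
have Gb m : (m < n)%N -> (n.-1 - m)%N \notin eps -> m != (n.-1 - p)%N -> G m b = 0.
  move=> mn ms mp; rewrite (GP (b, m) (adjoint_conditions_right mn ms)) /w.
  by rewrite xpair_eqE eqxx (negPf mp).
have Gp : (-1) ^+ (n.-1 - p) * G (n.-1 - p)%N b = 1.
  rewrite (GP (b, (n.-1 - p)%N)) ?/w ?eqxx; last first.
    by apply: adjoint_conditions_right; [exact: predn_sub_lt|rewrite pE].
  by rewrite -exprMn mulN1r opprK expr1n.
have Ga m : (m < n)%N -> (n.-1 - m)%N \notin sigma -> G m a = 0.
  move=> mn ms; rewrite (GP (a, m) (adjoint_conditions_left mn ms)) /w.
  by rewrite xpair_eqE (lt_eqF ab).
exists G; split=> // s sab; have [zs ze] := green_boundary sab.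
rewrite -(green_jump Gs sab) {2}/concomitant [X in _ - X]big1 ?subr0; last first.
  move=> m _; have [ms|ms] := boolP ((n.-1 - m)%N \in sigma); first by rewrite zs// mulr0.
  by rewrite Ga// mulr0 mul0r.
have pn' := predn_sub_lt pn.
rewrite /concomitant (bigD1 (Ordinal pn'))//= Gp pE big1 ?addr0 ?mul1r//.
move=> m mp; have [ms|ms] := boolP ((n.-1 - m)%N \in eps); first by rewrite ze// mulr0.
by rewrite Gb// mulr0 mul0r.
Qed.

End GreenFunction.

(** * Monotonicity of the concomitant of [G] and an eigenfunction *)

Section ConcomitantMonotonicity.
Context {R : realType}.
Variables (a b : R) (n : nat) (kappa kappa' e c : R) (G U : nat -> R -> R).
Hypotheses (ab : a < b) (Gs : solution n ((-1) ^+ n * kappa) G) (Us : solution n kappa' U).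
Hypotheses (G0 : forall t, t \in `]a, b[ -> e * G 0%N t <= 0).
Hypotheses (U0 : forall t, a < t < b -> 0 < U 0%N t).

Let W := concomitant n G U.

Let dW t : is_derive t (1 : R) W ((kappa' - kappa) * (G 0%N t * U 0%N t)).
Proof.
apply: is_derive_eq.
  by apply: is_derive_concomitant => i ilt; [exact: Gs.1|exact: Us.1].
have := Us.2 0%N t; have := Gs.2 0%N t; rewrite !add0n => -> ->.
by rewrite !mulrA -exprMn mulN1r opprK expr1n mul1r; ring.
Qed.

(** The derivative of [W] is [(kappa' - kappa) * G * U]. The factor [c] orients the gap between the
    constants; it will be [tau] or [- tau]. *)
Lemma concomitant_monotone x y : 0 <= c * (kappa' - kappa) -> a <= x -> x <= y -> y <= b ->
  e * c * W y <= e * c * W x.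
Proof.
move=> c0 ax xy yb.
suff : (- (e * c) \*: (W : R -> R)) x <= (- (e * c) \*: (W : R -> R)) y.
  by rewrite /= /GRing.scale/= !mulNr lerN2.
pose dF t := - (e * c) *: ((kappa' - kappa) * (G 0%N t * U 0%N t)).
have dFE t : t \in `[x, y] -> is_derive t (1 : R) (- (e * c) \*: (W : R -> R)) (dF t).
  by move=> _; exact: is_deriveZ.
apply: (derive_ge0_le dFE _ xy) => t; rewrite /dF /GRing.scale/=.
rewrite in_itv/= => /andP[xt ty].
have tab : a < t < b by rewrite (le_lt_trans ax xt) (lt_le_trans ty yb).
have -> : - (e * c) * ((kappa' - kappa) * (G 0%N t * U 0%N t)) =
  c * (kappa' - kappa) * (- (e * G 0%N t) * U 0%N t) by ring.
by rewrite mulr_ge0// mulr_ge0 ?oppr_ge0 ?G0 ?ltW ?U0// in_itv.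
Qed.

(** End values ordered against the monotonicity make [W] constant, and a strict gap then leaves only
    [G = 0]. *)
Lemma concomitant_rigid : e != 0 -> 0 < c * (kappa' - kappa) ->
  e * c * W a <= e * c * W b -> {in `]a, b[, forall t, G 0%N t = 0}.
Proof.
move=> e0 c0 Wab t tI; have /andP[at_ tb] : a < t < b by move: tI; rewrite in_itv.
have mono := concomitant_monotone (ltW c0).
have const x : x \in `]a, b[ -> (e * c) * W x = (e * c) * W t.
  have cst z : z \in `]a, b[ -> (e * c) * W z = (e * c) * W a.
    rewrite in_itv/= => /andP[/ltW az /ltW zb]; apply/le_anti/andP; split.
      exact: mono.
    by apply: (le_trans Wab); exact: mono.
  by move=> xI; rewrite !cst.
have [_ d0] : is_derive t (1 : R) ((e * c) \*: (W : R -> R)) 0.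
  apply: (derive1_at_min (ltW ab)) (tI) _ => [x _|x xI].
    by have h := is_deriveZ (e * c) (dW x); case: h.
  by rewrite /= /GRing.scale/= (const x xI).
have [_] := is_deriveZ (e * c) (dW t); rewrite d0 /GRing.scale/= => /esym/eqP.
have -> : e * c * ((kappa' - kappa) * (G 0%N t * U 0%N t)) =
  (e * (c * (kappa' - kappa))) * (G 0%N t * U 0%N t) by ring.
rewrite !mulf_eq0 (negPf e0) (gt_eqF (U0 _)) ?at_// orbF/=.
by case/orP => [/orP[]|/eqP//] /eqP h; move: c0; rewrite -[c * _]mulrC ?h ?mulr0 ?mul0r ltxx.
Qed.

End ConcomitantMonotonicity.

(** * Bounds on [M] from a Green's function of constant sign *)

Section SpectralBounds.
Context {R : realType}.
Variables (a b : R) (n q : nat) (M e : R) (sigma eps : seq nat) (g : R -> R -> R).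
Hypotheses (ab : a < b) (n1 : (1 < n)%N) (Hg : is_green a b n M sigma eps g).
Hypotheses (sigma_eps : boundary_orders n sigma eps) (e0 : e != 0).
Hypothesis g_sign : forall t s, t \in `[a, b] -> s \in `[a, b] -> e * partial_t a b q g t s <= 0.

Let n0 : (0 < n)%N := ltnW n1.
Let tau : R := (-1) ^+ size eps.
Let tau2 : tau * tau = 1. Proof. by rewrite -exprMn mulN1r opprK expr1n. Qed.

Let tau_sign m : 0 < m -> odd (size eps) = (tau * m < 0).
Proof.
by move=> m0; rewrite pmulr_llt0// /tau -signr_odd; case: odd; rewrite ?expr1 ?expr0 ?ltrN10 ?ltr10.
Qed.

Lemma green_sign_left p s : (q <= p < n)%N -> (forall i, (q <= i < p)%N -> i \in sigma) ->
  s \in `]a, b[ -> e * partial_t a b p g a s <= 0.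
Proof.
move=> /andP[qp pn] sq sab; have /andP[as_ sb] : a < s < b by move: sab; rewrite in_itv.
apply: (@leading_right _ (fun i t => partial_t a b i g t s) q p a) => //.
- move=> i /andP[_ ip]; near=> u.
  have ua : a < u by [].
  have us : u < s by near: u; exact: nbhs_right_lt.
  apply: (green_is_derive Hg) => //; rewrite ?lt_eqF//; first exact: ltn_trans pn.
  by rewrite in_itv/= ua (lt_trans us).
- move=> i /andP[qi ip]; have [zs _] := green_boundary Hg sab.
  have ilt : (i < n)%N := ltn_trans ip pn.
  have := green_cvg_left ab Hg sab ilt; rewrite zs//; apply: sq.
  by rewrite qi.
- exact: (green_cvg_left ab Hg).
- apply: filterS (near_right_in_itv ab) => u uI.
  by apply: g_sign; exact: subset_itv_oo_cc.
Unshelve. all: by end_near. Qed.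

Lemma green_sign_right p s : (q <= p < n)%N -> (forall i, (q <= i < p)%N -> i \in eps) ->
  s \in `]a, b[ -> (-1) ^+ (p - q) * e * partial_t a b p g b s <= 0.
Proof.
move=> /andP[qp pn] sq sab; have /andP[as_ sb] : a < s < b by move: sab; rewrite in_itv.
apply: (@leading_left _ (fun i t => partial_t a b i g t s) q p b) => //.
- move=> i /andP[_ ip]; near=> u.
  have ub : u < b by [].
  have su : s < u by near: u; exact: nbhs_left_gt.
  apply: (green_is_derive Hg) => //; rewrite ?gt_eqF//; first exact: ltn_trans pn.
  by rewrite in_itv/= ub andbT (lt_trans as_).
- move=> i /andP[qi ip]; have [_ ze] := green_boundary Hg sab.
  have ilt : (i < n)%N := ltn_trans ip pn.
  have := green_cvg_right ab Hg sab ilt; rewrite ze//; apply: sq.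
  by rewrite qi.
- exact: (green_cvg_right ab Hg).
- apply: filterS (near_left_in_itv ab) => u uI.
  by apply: g_sign; exact: subset_itv_oo_cc.
Unshelve. all: by end_near. Qed.

(** Otherwise [e * tau * W] would not increase from [- e * tau * y p a] to 0, against the strict
    sign of [y p a]: [e] is the parity that [left_endpoint_sign] produces at [p]. *)
Lemma first_eigenvalue_bound p m1 y : (q <= p < n)%N -> p \notin sigma ->
  (forall i, (q <= i < p)%N -> i \in sigma) ->
  e = (-1) ^+ (\sum_(p <= i < n) (i \notin sigma)) ->
  first_modulus n a b sigma eps m1 y -> tau * M < - m1.
Proof.
move=> qpn ps sq eE [m10 [ys yA yB] yp _]; have /andP[_ pn] := qpn.
have [G [Gs Ga Gp Gb GE]] := green_value_left ab n1 Hg sigma_eps pn ps.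
have Gneg s : s \in `]a, b[ -> e * G 0%N s <= 0 by move=> sab; rewrite GE// green_sign_left.
rewrite ltNge; apply/negP => tM.
have c0 : 0 <= tau * (tau * m1 - - M) by rewrite mulrBr mulrA tau2; lra.
have := concomitant_monotone Gs ys Gneg yp c0 (lexx a) (ltW ab) (lexx b).
have -> : concomitant n G y b = 0.
  rewrite /concomitant big1// => m _; have [ms|ms] := boolP ((n.-1 - m)%N \in eps).
    by rewrite yB// mulr0.
  by rewrite Gb// mulr0 mul0r.
have -> : concomitant n G y a = - y p a.
  have pn' := predn_sub_lt pn.
  rewrite /concomitant (bigD1 (Ordinal pn'))//= Gp big1 ?addr0 ?mulN1r.
    by rewrite predn_subK.
  move=> m mp; have [ms|ms] := boolP ((n.-1 - m)%N \in sigma); first by rewrite yA// mulr0.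
  by rewrite Ga// mulr0 mul0r.
rewrite mulr0 mulrN oppr_ge0 leNgt => /negP; apply.
have km0 : tau * m1 != 0 by rewrite mulf_neq0 ?signr_eq0 ?gt_eqF.
have := left_endpoint_sign n1 ab sigma_eps km0 (tau_sign m10) ys yA yB yp pn ps.
rewrite -eE => h; have : 0 < m1 * (e * tau * y p a).
  by have -> : m1 * (e * tau * y p a) = e * (tau * m1) * y p a by ring.
by rewrite pmulr_rgt0.
Qed.

(** Only the freed order [j] leaves a boundary term, with both factors of known sign. If the bound
    failed, [concomitant_rigid] would give [G = 0], contradicting the normalisation of [G] at order
    [n - 1 - p]. *)
Lemma left_exchange_bound p j m3 U : (q <= p < n)%N -> p \notin sigma ->
  (forall i, (q <= i < p)%N -> i \in sigma) -> (p < j)%N -> j \in sigma ->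
  (forall i, i \in sigma -> (i <= j)%N) -> boundary_orders n (p :: rem j sigma) eps ->
  first_modulus n a b (p :: rem j sigma) eps m3 U -> - m3 <= tau * M.
Proof.
move=> qpn ps sq pj js jmax ord3 [m30 [Us UA UB] Up _]; have /andP[_ pn] := qpn.
have [us ue /allP sn _ _] := sigma_eps; have jn : (j < n)%N := sn j js.
have [G [Gs Ga Gp Gb GE]] := green_value_left ab n1 Hg sigma_eps pn ps.
have Gneg s : s \in `]a, b[ -> e * G 0%N s <= 0 by move=> sab; rewrite GE// green_sign_left.
rewrite leNgt; apply/negP => tM.
have c0 : 0 < - tau * (tau * m3 - - M) by rewrite mulNr mulrBr mulrA tau2; lra.
have rem_mem i : i \in sigma -> i != j -> i \in p :: rem j sigma.
  by move=> iS ij; rewrite inE mem_rem_uniq// inE ij iS orbT.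
have Wb : concomitant n G U b = 0.
  rewrite /concomitant big1// => m _; have [ms|ms] := boolP ((n.-1 - m)%N \in eps).
    by rewrite UB// mulr0.
  by rewrite Gb// mulr0 mul0r.
have jn' := predn_sub_lt jn; have jE := predn_subK jn.
have Wa : concomitant n G U a = (-1) ^+ (n.-1 - j) * G (n.-1 - j)%N a * U j a.
  rewrite /concomitant (bigD1 (Ordinal jn'))//= jE big1 ?addr0// => m mj.
  have [ms|ms] := boolP ((n.-1 - m)%N \in sigma).
    rewrite UA ?mulr0// rem_mem//; apply: contraNneq mj => h.
    by apply/eqP/val_inj => /=; rewrite -h predn_subK.
  have [mp|mp] := eqVneq (nat_of_ord m) (n.-1 - p)%N.
    by rewrite UA ?mulr0// mp predn_subK// mem_head.
  by rewrite Ga// mulr0 mul0r.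
(* For [m < n - 1 - j] the order [n - 1 - m] exceeds [j], so it is free and differs from [p]; hence
   [G m] vanishes at [a], and the sign of [G] passes to order [n - 1 - j]. *)
have Gj : e * G (n.-1 - j)%N a <= 0.
  apply: (@leading_right _ G 0%N (n.-1 - j)%N a) => //.
  - by move=> i _; apply: nearW => u; exact: Gs.1.
  - move=> i /andP[_ ij].
    have <- : G i a = 0.
      apply: Ga; first by clear -ij; lia.
        by apply/negP => /jmax; clear -ij; lia.
      by clear -ij pj; lia.
    by apply: cvg_at_right_filter; exact: (solution_continuous Gs).
  - by apply: cvg_at_right_filter; exact: (solution_continuous Gs).
  - by apply: filterS (near_right_in_itv ab) => u; exact: Gneg.
have jA : j \notin p :: rem j sigma.
  by rewrite inE mem_rem_uniqF// orbF gtn_eqF.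
have Uj : 0 < (-1) ^+ (n - j) * tau * U j a.
  have km0 : tau * m3 != 0 by rewrite mulf_neq0 ?signr_eq0 ?gt_eqF.
  have := left_endpoint_sign n1 ab ord3 km0 (tau_sign m30) Us UA UB Up jn jA.
  (* After the exchange no order from [j] on is prescribed, so all [n - j] of them count. *)
  have -> : (\sum_(j <= i < n) (i \notin p :: rem j sigma) = n - j)%N.
    rewrite -[RHS]muln1 -sum_nat_const_nat; apply: eq_big_nat => i /andP[ji ilt].
    rewrite inE negb_or gtn_eqF ?(leq_trans pj)//=.
    have [->|ij] := eqVneq i j; first by rewrite mem_rem_uniqF.
    apply/eqP; rewrite eqb1; apply/negP => /mem_rem/jmax ij'.
    by move/eqP: ij; apply; apply/anti_leq; rewrite ij' ji.
  move=> h; have : 0 < m3 * ((-1) ^+ (n - j) * tau * U j a).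
    by have -> : m3 * ((-1) ^+ (n - j) * tau * U j a) =
      (-1) ^+ (n - j) * (tau * m3) * U j a by ring.
  by rewrite pmulr_rgt0.
have Wle : e * - tau * concomitant n G U a <= e * - tau * concomitant n G U b.
  rewrite Wb mulr0 Wa.
  have -> : e * - tau * ((-1) ^+ (n.-1 - j) * G (n.-1 - j)%N a * U j a) =
      (e * G (n.-1 - j)%N a) * ((-1) ^+ (n - j) * tau * U j a).
    have -> : (n - j = (n.-1 - j).+1)%N by clear -jn; lia.
    by rewrite exprS; ring.
  by rewrite mulr_le0_ge0// ltW.
have G0 := concomitant_rigid ab Gs Us Gneg Up e0 c0 Wle.
have := zero_on_interval ab n0 Gs G0 (n.-1 - p)%N a => h.
by move: Gp; rewrite h mulr0 => /eqP; rewrite eq_sym oppr_eq0 oner_eq0.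
Qed.

(** Counterpart at [b]: [e'] absorbs the sign reversals of [leading_left], and the end point sign
    has exponent 0 since no order from [j] on remains prescribed. *)
Lemma right_exchange_bound p j m5 U : (q <= p < n)%N -> p \notin eps ->
  (forall i, (q <= i < p)%N -> i \in eps) -> (p < j)%N -> j \in eps ->
  (forall i, i \in eps -> (i <= j)%N) -> boundary_orders n sigma (p :: rem j eps) ->
  first_modulus n a b sigma (p :: rem j eps) m5 U -> - m5 <= tau * M.
Proof.
move=> qpn ps sq pj js jmax ord5 [m50 [Us UA UB] Up _]; have /andP[_ pn] := qpn.
have [us ue _ /allP en _] := sigma_eps; have jn : (j < n)%N := en j js.
have sz : size (p :: rem j eps) = size eps.
  by rewrite /= size_rem// prednK// -has_predT; apply/hasP; exists j.
rewrite sz -/tau in Us.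
have [G [Gs Gb Gp Ga GE]] := green_value_right ab n1 Hg sigma_eps pn ps.
pose e' := (-1) ^+ (p - q) * e.
have e'0 : e' != 0 by rewrite mulf_neq0 ?signr_eq0.
have Gneg s : s \in `]a, b[ -> e' * G 0%N s <= 0 by move=> sab; rewrite GE// green_sign_right.
rewrite leNgt; apply/negP => tM.
have c0 : 0 < - tau * (tau * m5 - - M) by rewrite mulNr mulrBr mulrA tau2; lra.
have rem_mem i : i \in eps -> i != j -> i \in p :: rem j eps.
  by move=> iS ij; rewrite inE mem_rem_uniq// inE ij iS orbT.
have Wa : concomitant n G U a = 0.
  rewrite /concomitant big1// => m _; have [ms|ms] := boolP ((n.-1 - m)%N \in sigma).
    by rewrite UA// mulr0.
  by rewrite Ga// mulr0 mul0r.
have jn' := predn_sub_lt jn; have jE := predn_subK jn.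
have Wb : concomitant n G U b = (-1) ^+ (n.-1 - j) * G (n.-1 - j)%N b * U j b.
  rewrite /concomitant (bigD1 (Ordinal jn'))//= jE big1 ?addr0// => m mj.
  have [ms|ms] := boolP ((n.-1 - m)%N \in eps).
    rewrite UB ?mulr0// rem_mem//; apply: contraNneq mj => h.
    by apply/eqP/val_inj => /=; rewrite -h predn_subK.
  have [mp|mp] := eqVneq (nat_of_ord m) (n.-1 - p)%N.
    by rewrite UB ?mulr0// mp predn_subK// mem_head.
  by rewrite Gb// mulr0 mul0r.
have Gj : (-1) ^+ (n.-1 - j) * e' * G (n.-1 - j)%N b <= 0.
  rewrite -[X in _ ^+ X]subn0; apply: (@leading_left _ G 0%N (n.-1 - j)%N b) => //.
  - by move=> i _; apply: nearW => u; exact: Gs.1.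
  - move=> i /andP[_ ij].
    have <- : G i b = 0.
      apply: Gb; first by clear -ij; lia.
        by apply/negP => /jmax; clear -ij; lia.
      by clear -ij pj; lia.
    by apply: cvg_at_left_filter; exact: (solution_continuous Gs).
  - by apply: cvg_at_left_filter; exact: (solution_continuous Gs).
  - by apply: filterS (near_left_in_itv ab) => u; exact: Gneg.
have jB : j \notin p :: rem j eps.
  by rewrite inE mem_rem_uniqF// orbF gtn_eqF.
have Uj : 0 < tau * U j b.
  have km0 : tau * m5 != 0 by rewrite mulf_neq0 ?signr_eq0 ?gt_eqF.
  have := right_endpoint_sign n1 ab ord5 km0 _ Us UA UB Up jn jB.
  rewrite sz => /(_ (tau_sign m50)).
  have -> : (\sum_(j <= i < n) (i \in p :: rem j eps) = 0)%N.
    apply: big1_seq => i; rewrite mem_index_iota => /andP[_ /andP[ji ilt]].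
    rewrite inE gtn_eqF ?(leq_trans pj)//=.
    have [->|ij] := eqVneq i j; first by rewrite mem_rem_uniqF.
    apply/eqP; rewrite eqb0; apply/negP => /mem_rem/jmax ij'.
    by move/eqP: ij; apply; apply/anti_leq; rewrite ij' ji.
  rewrite expr0 mul1r => h; have : 0 < m5 * (tau * U j b).
    by have -> : m5 * (tau * U j b) = tau * m5 * U j b by ring.
  by rewrite pmulr_rgt0.
have Wle : e' * - tau * concomitant n G U a <= e' * - tau * concomitant n G U b.
  rewrite Wa mulr0 Wb.
  have -> : e' * - tau * ((-1) ^+ (n.-1 - j) * G (n.-1 - j)%N b * U j b) =
      - (((-1) ^+ (n.-1 - j) * e' * G (n.-1 - j)%N b) * (tau * U j b)) by ring.
  by rewrite oppr_ge0 mulr_le0_ge0// ltW.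
have G0 := concomitant_rigid ab Gs Us Gneg Up e'0 c0 Wle.
have := zero_on_interval ab n0 Gs G0 (n.-1 - p)%N b => h.
by move: Gp; rewrite h mulr0 => /eqP; rewrite eq_sym oner_eq0.
Qed.

End SpectralBounds.

(** * Extremal eigenvalues and shifts of orders *)

Section ExtremalEigenvalues.
Context {R : realType}.
Variables (a b : R) (n : nat).
Hypotheses (ab : a < b) (n1 : (1 < n)%N).
Implicit Types (A B : seq nat).

Let n0 : (0 < n)%N := ltnW n1.

Lemma first_modulus_eigenvalue A B m y : boundary_orders n A B ->
  first_modulus n a b A B m y ->
  Defs.eigenvalue a b n A B (- ((-1) ^+ size B * m)) /\
  forall m', 0 < m' -> Defs.eigenvalue a b n A B (- ((-1) ^+ size B * m')) -> m <= m'.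
Proof.
move=> [_ _ An Bn _] [m0 [ys yA yB] yp nz]; split.
  apply/(eigenvalueP ab n0) => //; exists y; split=> //; first by rewrite opprK.
  exists 0%N, ((a + b) / 2); rewrite gt_eqF// yp//.
  by have [-> ->] := midf_lt ab.
move=> m' m'0 /(eigenvalueP ab n0 _ An Bn)[z [zs [i [s zn0]] zA zB]].
rewrite leNgt; apply/negP => m'm; rewrite opprK in zs.
by have := nz m' z; rewrite m'0 m'm => /(_ isT zs zA zB i s)/eqP; rewrite (negPf zn0).
Qed.

Lemma first_modulus_negative A B m y : boundary_orders n A B ->
  first_modulus n a b A B m y -> ~~ odd (size B) ->
  biggest_negative_eigenvalue a b n A B (- m).
Proof.
move=> AB fm oB; have [] := first_modulus_eigenvalue AB fm.
rewrite -signr_odd (negPf oB) expr0 mul1r => ev mmin; have [m0 _ _ _] := fm.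
split=> //; first by rewrite oppr_lt0.
move=> l l0 evl; rewrite lerNr; apply: mmin; first by rewrite oppr_gt0.
by rewrite mul1r opprK.
Qed.

Lemma first_modulus_positive A B m y : boundary_orders n A B ->
  first_modulus n a b A B m y -> odd (size B) ->
  least_positive_eigenvalue a b n A B m.
Proof.
move=> AB fm oB; have [] := first_modulus_eigenvalue AB fm.
rewrite -signr_odd oB expr1 mulN1r opprK => ev mmin; have [m0 _ _ _] := fm.
by split=> // l l0 evl; apply: mmin => //; rewrite mulN1r opprK.
Qed.

(* If [u^(n) = - lambda u] with [lambda != 0], the orders of derivation count
   only modulo [n]. *)
Lemma eigenvalue_shift A B A' B' q lambda : lambda != 0 -> (q <= n)%N ->
  all (fun i => (i < n)%N) A -> all (fun i => (i < n)%N) B ->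
  all (fun i => (i < n)%N) A' -> all (fun i => (i < n)%N) B' ->
  {in A', forall i, ((i + q) %% n)%N \in A} -> {in B', forall i, ((i + q) %% n)%N \in B} ->
  Defs.eigenvalue a b n A B lambda -> Defs.eigenvalue a b n A' B' lambda.
Proof.
move=> l0 qn An Bn An' Bn' AA BB /(eigenvalueP ab n0 _ An Bn)[y [ys [i [s yn0]] yA yB]].
apply/(eigenvalueP ab n0) => //; exists (fun i => y (i + q)%N).
have per j t : y ((j %% n)%N) t = 0 -> y j t = 0.
  rewrite {2}(divn_eq j n) addnC; elim: (j %/ n)%N => [|m ih] yj; first by rewrite mul0n addn0.
  by rewrite mulSnr addnA ys.2 ih// mulr0.
split; first exact: solution_deriv.
- exists (i + n - q)%N, s; rewrite subnK; last by rewrite (leq_trans qn)// leq_addl.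
  by rewrite ys.2 mulf_neq0// oppr_eq0.
- by move=> j jA; apply: per; exact/yA/AA.
- by move=> j jB; apply: per; exact/yB/BB.
Qed.

End ExtremalEigenvalues.

(** * Index sets modulo the shift by [q] *)

Section IndexCombinatorics.
Implicit Types (n m q : nat) (tau s : seq nat).
Local Open Scope nat_scope.

(** The two pieces of [shifted] are the residues of [i - q] modulo [n]. *)
Lemma mem_shifted n q tau i : q < n -> all (fun i => i < n) tau -> i < n ->
  (i \in shifted n q tau) = ((i + q) %% n \in tau).
Proof.
move=> qn /allP tn ilt; rewrite /shifted mem_sort mem_cat; apply/orP/idP.
  case=> /mapP[j]; rewrite mem_filter => /andP[h jt] ->; have jn := tn j jt.
    by rewrite subnK// modn_small.
  have -> : j + n - q + q = j + n by lia.
  by rewrite modnDr modn_small.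
move=> it; case: (ltnP (i + q) n) => iq.
  left; apply/mapP; exists (i + q); last by rewrite addnK.
  by rewrite mem_filter leq_addl; rewrite modn_small in it.
right; apply/mapP; have e : (i + q) %% n = i + q - n.
  by rewrite -{1}(subnK iq) modnDr modn_small//; lia.
rewrite e in it; exists (i + q - n); last by lia.
by rewrite mem_filter it andbT; lia.
Qed.

Lemma shifted_lt n q tau : q < n -> all (fun i => i < n) tau ->
  all (fun i => i < n) (shifted n q tau).
Proof.
move=> qn /allP tn; apply/allP => i; rewrite /shifted mem_sort mem_cat.
by case/orP => /mapP[j]; rewrite mem_filter => /andP[h /tn jn] ->; lia.
Qed.

Lemma least_missingP n s : (exists2 i, i < n & i \notin s) ->
  [/\ least_missing n s < n, least_missing n s \notin s &
      forall i, i < least_missing n s -> i \in s].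
Proof.
rewrite /least_missing => -[i ilt iS].
have : i \in [seq i <- iota 0 n | i \notin s] by rewrite mem_filter iS mem_iota.
have srt : sorted leq [seq i <- iota 0 n | i \notin s].
  by rewrite sorted_filter ?iota_sorted//; exact: leq_trans.
case E : [seq _ <- _ | _] srt => [//|x l] /= srt _.
have : x \in x :: l := mem_head x l; rewrite -E mem_filter mem_iota => /andP[xs /= xn].
split=> // j jx; apply: contraT => js.
have : j \in x :: l by rewrite -E mem_filter js mem_iota /= (ltn_trans jx xn).
rewrite inE ltn_eqF//= => /(allP (order_path_min leq_trans srt)).
by rewrite leqNgt jx.
Qed.

Lemma card_geE n q tau : uniq tau -> all (fun i => i < n) tau ->
  card_ge q tau = \sum_(q <= i < n) (i \in tau).
Proof.
move=> ut /allP tn; rewrite /card_ge -size_filter -sum1_size.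
rewrite (perm_big [seq i <- index_iota q n | i \in tau]) /=.
  by rewrite big_filter big_mkcond; apply: eq_bigr => i _; case: (i \in tau).
apply: uniq_perm; rewrite ?filter_uniq ?iota_uniq// => i.
rewrite !mem_filter mem_index_iota; case: (boolP (i \in tau)) => it; last by rewrite andbF.
by rewrite andbT tn// andbT.
Qed.

Lemma addn_modn_eq n q i x : q < n -> i < n -> q <= x -> x < n ->
  ((i + q) %% n == x) = (i == x - q).
Proof.
move=> qn ilt qx xn; case: (ltnP (i + q) n) => iq.
  by rewrite modn_small//; apply/eqP/eqP; lia.
have -> : (i + q) %% n = i + q - n by rewrite -{1}(subnK iq) modnDr modn_small//; lia.
by apply/eqP/eqP; lia.
Qed.

Lemma sorted_find_count q tau : sorted ltn tau ->
  find (fun i => q <= i) tau = count (fun i => i < q) tau.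
Proof.
elim: tau => [//|x s ih] /= srt; case: leqP => qx /=; last by rewrite ih ?(path_sorted srt).
apply/esym/eqP; rewrite addn_eq0 /= -leqn0 leqNgt -has_count; apply/hasPn => y ys.
by rewrite -leqNgt (leq_trans qx)// ltnW// (allP (order_path_min ltn_trans srt)).
Qed.

Lemma shiftedE n q tau : q < n -> all (fun i => i < n) tau -> sorted ltn tau ->
  shifted n q tau = [seq i - q | i <- tau & q <= i] ++ [seq i + n - q | i <- tau & i < q].
Proof.
move=> qn /allP tn; rewrite sorted_pairwise; last exact: ltn_trans.
move=> pw; apply: sorted_sort; first exact: leq_trans.
rewrite sorted_pairwise; last exact: leq_trans.
rewrite pairwise_cat; apply/and3P; split.
- apply/allrelP => x y /mapP[i]; rewrite mem_filter => /andP[_ /tn hi] ->.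
  by move=> /mapP[i' _ ->]; lia.
- rewrite pairwise_map; apply: (sub_pairwise (r := ltn)); last exact: pairwise_filter.
  by move=> x y /= xy; lia.
- rewrite pairwise_map; apply: (sub_pairwise (r := ltn)); last exact: pairwise_filter.
  by move=> x y /= xy; lia.
Qed.

(** The entry of index [z] is [j - q], with [j] the largest order. It differs from [z - 1] exactly
    when the orders from [q] to [j] have a gap; [p] is the first gap, and [p - q] the least missing
    element of the shifted set. *)
Lemma exchange_facts n m q tau : q < n -> index_seq n m tau -> 1 <= card_ge q tau ->
  let mu := shifted n q tau in let z := last_kept q tau in
  entry mu z <> z.-1 ->
  exists p j, [/\ q <= p < n /\ p \notin tau, forall i, q <= i < p -> i \in tau,
    p < j /\ j \in tau, forall i, i \in tau -> i <= j &
    all (fun i => i < n) (exchange n mu z) /\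
    forall i, i < n -> (i \in exchange n mu z) = ((i + q) %% n \in p :: rem j tau)].
Proof.
move=> qn [srt szt tn] c1 mu z; have tn' := allP tn.
have ut : uniq tau := sorted_uniq ltn_trans ltnn srt.
have zE : z = card_ge q tau.
  rewrite /z /last_kept sorted_find_count// /card_ge -(count_predC (fun i => i < q) tau) addKn.
  by apply: eq_count => i; rewrite /= -leqNgt.
rewrite zE /entry /mu shiftedE//; set L := [seq i <- tau | q <= i].
have cL : card_ge q tau = size L by rewrite size_filter.
have mL i : (i \in L) = (q <= i) && (i \in tau) by rewrite mem_filter.
have uL : uniq L by rewrite filter_uniq.
have sL : pairwise ltn L.
  by apply: pairwise_filter; rewrite -sorted_pairwise//; exact: ltn_trans.
rewrite cL nth_cat size_map prednK -?cL// leqnn.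
rewrite (nth_map 0) ?prednK -?cL//; rewrite cL nth_last.
rewrite cL in c1; set j := last 0 L => jz.
have jL : j \in L by rewrite /j; case: (L) c1 => // x l _; exact: mem_last.
have /andP[qj jt] : (q <= j) && (j \in tau) by rewrite -mL.
have jmaxL i : i \in L -> i <= j.
  move: sL; rewrite /j; case/lastP: (L) => [//|l x]; rewrite last_rcons pairwise_rcons.
  by move=> /andP[/allP lx _]; rewrite mem_rcons inE => /predU1P[->//|/lx/ltnW].
have jmax i : i \in tau -> i <= j.
  by move=> it; case: (leqP q i) => qi; [apply: jmaxL; rewrite mL qi|rewrite (leq_trans (ltnW qi))].
have jn := tn' _ jt.
have [i0 /andP[qi0 i0j] i0t] : exists2 i, q <= i < j & i \notin tau.
  have [/allP all_in|/allPn[i]] := boolP (all (mem tau) (iota q (j - q))); last first.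
    by rewrite mem_iota subnKC// => h ht; exists i.
  case: jz; apply/eqP; rewrite eqn_leq; apply/andP; split.
    rewrite -ltnS prednK// -(size_iota q (j - q).+1); apply: uniq_leq_size; first exact: iota_uniq.
    move=> i; rewrite mem_iota addnS subnKC// ltnS [i <= j]leq_eqVlt => /andP[qi /predU1P[->//|ij]].
    by rewrite mL qi; apply: all_in; rewrite mem_iota qi subnKC.
  rewrite -ltnS prednK// -(size_iota q (j - q).+1); apply: uniq_leq_size => // i iL.
  have := jmaxL i iL; move: iL; rewrite mL => /andP[qi _] ij.
  by rewrite mem_iota qi addnS subnKC.
have i0n : i0 - q < n := leq_ltn_trans (leq_subr q i0) (ltn_trans i0j jn).
have i0mu : i0 - q \notin mu.
  by rewrite mem_shifted// subnK// modn_small//; exact: ltn_trans jn.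
have [an amu amin] := least_missingP (ex_intro2 _ _ (i0 - q) i0n i0mu).
pose al := least_missing n mu.
have ali0 : al <= i0 - q by rewrite leqNgt; apply/negP => /amin; rewrite (negPf i0mu).
(* The gap at [i0] keeps [al + q] below [j], so shifting back does not wrap around. *)
have pj : al + q < j by rewrite (leq_ltn_trans _ i0j)// -(subnK qi0) leq_add2r.
have pn : al + q < n := ltn_trans pj jn.
exists (al + q), j; split=> //.
- rewrite leq_addl pn; split=> //; move: amu.
  by rewrite -/al mem_shifted// modn_small.
- move=> i /andP[qi ip]; have := amin (i - q); rewrite -/al => H.
  have iq : i - q < al by rewrite ltn_subLR// addnC.
  move: (H iq); rewrite mem_shifted// ?subnK// ?modn_small//.
    exact: ltn_trans pn.
  exact: leq_ltn_trans (leq_subr q i) (ltn_trans ip pn).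
have sE : [seq i - q | i <- L] ++ [seq i + n - q | i <- tau & i < q] = mu.
  by rewrite /mu shiftedE.
have eE : entry mu z = j - q.
  rewrite /entry zE cL -sE nth_cat size_map prednK// leqnn.
  by rewrite (nth_map 0) ?prednK// nth_last.
rewrite sE -cL -zE /exchange eE -/al; split.
  rewrite /= an; apply/allP => i; rewrite mem_filter => /andP[_].
  exact: (allP (shifted_lt qn tn)).
move=> i ilt; rewrite !inE mem_filter mem_rem_uniq// !inE mem_shifted// !addn_modn_eq//.
  by rewrite addnK.
by rewrite leq_addl.
Qed.

End IndexCombinatorics.

(** * Transfer along the cyclic shift, and assembly of the bounds *)

Section CyclicShift.
Context {R : realType}.
Variables (a b : R) (n : nat).
Hypotheses (ab : a < b) (n1 : (1 < n)%N).
Implicit Types (A B : seq nat).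

Lemma eigenvalue_cyclic A B A' B' q lambda : lambda != 0 -> (q < n)%N ->
  all (fun i => (i < n)%N) A -> all (fun i => (i < n)%N) B ->
  all (fun i => (i < n)%N) A' -> all (fun i => (i < n)%N) B' ->
  (forall i, (i < n)%N -> (i \in A') = (((i + q) %% n)%N \in A)) ->
  (forall i, (i < n)%N -> (i \in B') = (((i + q) %% n)%N \in B)) ->
  Defs.eigenvalue a b n A B lambda <-> Defs.eigenvalue a b n A' B' lambda.
Proof.
move=> l0 qn An Bn An' Bn' AA BB.
have inv i : (i < n)%N -> (((i + (n - q)) %% n + q) %% n)%N = i.
  by move=> ilt; rewrite modnDml -addnA subnK ?(ltnW qn)// modnDr modn_small.
have modlt i : (i %% n < n)%N by rewrite ltn_mod ltnW.
split; [apply: (eigenvalue_shift ab n1 (q := q)) |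
  apply: (eigenvalue_shift ab n1 (q := (n - q)%N))] => //.
- exact: ltnW.
- by move=> i iA; rewrite -AA// (allP An').
- by move=> i iB; rewrite -BB// (allP Bn').
- exact: leq_subr.
- by move=> i iA; rewrite AA// inv// (allP An).
- by move=> i iB; rewrite BB// inv// (allP Bn).
Qed.

Lemma biggest_negative_eq A B A' B' l :
  (forall lambda : R, lambda != 0 ->
     Defs.eigenvalue a b n A B lambda <-> Defs.eigenvalue a b n A' B' lambda) ->
  biggest_negative_eigenvalue a b n A B l -> biggest_negative_eigenvalue a b n A' B' l.
Proof.
move=> E [l0 ev lmax]; split=> //; first by apply/E; rewrite ?lt_eqF.
by move=> l' l'0 /E ev'; apply: lmax => //; apply: ev'; rewrite lt_eqF.
Qed.

Lemma least_positive_eq A B A' B' l :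
  (forall lambda : R, lambda != 0 ->
     Defs.eigenvalue a b n A B lambda <-> Defs.eigenvalue a b n A' B' lambda) ->
  least_positive_eigenvalue a b n A B l -> least_positive_eigenvalue a b n A' B' l.
Proof.
move=> E [l0 ev lmin]; split=> //; first by apply/E; rewrite ?gt_eqF.
by move=> l' l'0 /E ev'; apply: lmin => //; apply: ev'; rewrite gt_eqF.
Qed.

(** Lowering one prescribed order can only raise the counts below each [h], so Polya's condition
    survives. *)
Lemma exchange_boundary A B p j : boundary_orders n A B -> polya n A B ->
  (p < j)%N -> p \notin A -> j \in A ->
  boundary_orders n (p :: rem j A) B /\ polya n (p :: rem j A) B.
Proof.
move=> [uA uB An Bn [A0 B0 AB]] pAB pj pA jA; have jn := allP An j jA.
have sz : size (p :: rem j A) = size A by rewrite /= size_rem// prednK.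
split.
  split=> //; last by rewrite sz.
  - by rewrite /= rem_uniq// andbT; apply: contra pA; exact: mem_rem.
  - rewrite /= (ltn_trans pj jn); apply/allP => i /mem_rem; exact: (allP An).
move=> h hn; apply: leq_trans (pAB h hn) _; rewrite leq_add2r.
rewrite (permP (perm_to_rem jA) (fun i => (i < h)%N)) /= leq_add2r.
by case: (ltnP j h) => // jh; rewrite (ltn_trans pj jh).
Qed.

End CyclicShift.

Theorem theorem3p15 (R : realType) (a b : R) (n k q : nat) (sigma eps : seq nat) :
  a < b -> (2 <= n)%N -> (1 <= k <= n.-1)%N -> (1 <= q <= n.-1)%N ->
  index_seq n k sigma -> index_seq n (n - k) eps ->
  condition_Na n sigma eps ->
  (card_ge q sigma + card_ge q eps = n - q)%N ->
  (1 <= card_ge q sigma)%N -> (1 <= card_ge q eps)%N ->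
  let mu := shifted n q sigma in
  let rho := shifted n q eps in
  let z := last_kept q sigma in
  let h := last_kept q eps in
  entry mu z <> z.-1 -> entry rho h <> h.-1 ->
  (~~ odd (n - k) ->
   exists lambda1 lambda3 lambda5 : R,
     [/\ biggest_negative_eigenvalue a b n sigma eps lambda1,
         biggest_negative_eigenvalue a b n (exchange n mu z) rho lambda3,
         biggest_negative_eigenvalue a b n mu (exchange n rho h) lambda5 &
         forall (M : R) (g : R -> R -> R), is_green a b n M sigma eps g ->
           (~~ odd (n - q - card_ge q sigma) ->
            nonpositive_on_square a b (partial_t a b q g) ->
            M \in `[Num.max lambda3 lambda5, lambda1[) /\
           (odd (n - q - card_ge q sigma) ->
            nonnegative_on_square a b (partial_t a b q g) ->
            M \in `[Num.max lambda3 lambda5, lambda1[)])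
  /\
  (odd (n - k) ->
   exists lambda1 lambda3 lambda5 : R,
     [/\ least_positive_eigenvalue a b n sigma eps lambda1,
         least_positive_eigenvalue a b n (exchange n mu z) rho lambda3,
         least_positive_eigenvalue a b n mu (exchange n rho h) lambda5 &
         forall (M : R) (g : R -> R -> R), is_green a b n M sigma eps g ->
           (~~ odd (n - q - card_ge q sigma) ->
            nonpositive_on_square a b (partial_t a b q g) ->
            M \in `]lambda1, Num.min lambda3 lambda5]) /\
           (odd (n - q - card_ge q sigma) ->
            nonnegative_on_square a b (partial_t a b q g) ->
            M \in `]lambda1, Num.min lambda3 lambda5])]).
Proof.
move=> ab n2 kn qn1 sS eS Na cc cs ce mu rho z h zz hh.
have n1 : (1 < n)%N := n2.
have qn : (q < n)%N by lia.
have [s_srt s_sz s_n] := sS; have [e_srt e_sz e_n] := eS.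
have us : uniq sigma := sorted_uniq ltn_trans ltnn s_srt.
have ue : uniq eps := sorted_uniq ltn_trans ltnn e_srt.
have ord1 : boundary_orders n sigma eps by split=> //; rewrite s_sz e_sz; split; lia.
have pol1 : polya n sigma eps.
  move=> l /andP[l0 ln]; have [ll|nl] := ltnP l n; first by apply: Na; lia.
  have -> : l = n by lia.
  have cnt s : all (fun i => (i < n)%N) s -> count (fun i => (i < n)%N) s = size s.
    by rewrite all_count => /eqP.
  by rewrite !cnt// s_sz e_sz; lia.
have [ps [js [[qpn psn] sq [pjs jst] jsmax [xs_n xsE]]]] := exchange_facts qn sS cs zz.
have [pe [je [[qpen pen] eq_ [pje jet] jemax [xe_n xeE]]]] := exchange_facts qn eS ce hh.
have [ord3 pol3] := exchange_boundary ord1 pol1 pjs psn jst.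
(* The exchange at [b] is the exchange at [a] with the two index sets swapped. *)
have [ord5 pol5] : boundary_orders n sigma (pe :: rem je eps) /\ polya n sigma (pe :: rem je eps).
  have [od5 pd5] := exchange_boundary (boundary_ordersC ord1) (polyaC pol1) pje pen jet.
  by split; [exact: boundary_ordersC|exact: polyaC].
have [m1 [y1 fm1]] := first_modulus_exists n1 ab ord1 pol1.
have [m3 [y3 fm3]] := first_modulus_exists n1 ab ord3 pol3.
have [m5 [y5 fm5]] := first_modulus_exists n1 ab ord5 pol5.
have sz5 : size (pe :: rem je eps) = size eps.
  by have [_ _ _ _ [_ e_gt0 _]] := ord1; rewrite /= size_rem// prednK.
have [_ _ s3n _ _] := ord3; have [_ _ _ e5n _] := ord5.
have muE i : (i < n)%N -> (i \in mu) = (((i + q) %% n)%N \in sigma) by exact: mem_shifted.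
have rhoE i : (i < n)%N -> (i \in rho) = (((i + q) %% n)%N \in eps) by exact: mem_shifted.
have mu_n := shifted_lt qn s_n; have rho_n := shifted_lt qn e_n.
have ev3 (l : R) : l != 0 -> Defs.eigenvalue a b n (ps :: rem js sigma) eps l <->
    Defs.eigenvalue a b n (exchange n mu z) rho l.
  by move=> l0; apply: (eigenvalue_cyclic ab n1 (q := q)).
have ev5 (l : R) : l != 0 -> Defs.eigenvalue a b n sigma (pe :: rem je eps) l <->
    Defs.eigenvalue a b n mu (exchange n rho h) l.
  by move=> l0; apply: (eigenvalue_cyclic ab n1 (q := q)).
(* The sign [(-1) ^ d] merges the nonpositive and nonnegative cases. *)
pose d := card_ge q eps; have dE : (n - q - card_ge q sigma = d)%N by rewrite -cc addKn.
pose tau : R := (-1) ^+ size eps.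
have bounds M g : is_green a b n M sigma eps g ->
    (forall t s, t \in `[a, b] -> s \in `[a, b] -> (-1) ^+ d * partial_t a b q g t s <= 0) ->
    [/\ tau * M < - m1, - m3 <= tau * M & - m5 <= tau * M].
  move=> Hg gs; have e0 : (-1) ^+ d != 0 :> R by rewrite signr_eq0.
  split.
  - apply: (first_eigenvalue_bound ab n1 Hg ord1 gs qpn psn sq _ fm1); congr (_ ^+ _).
    have /andP[qp pn] := qpn.
    (* Orders from [q] to [ps - 1] are all prescribed, so the free orders from [ps] on are those
       from [q] on, [d] in number. *)
    have : (\sum_(q <= i < n) (i \notin sigma) + \sum_(q <= i < n) (i \in sigma) = n - q)%N.
      rewrite -big_split /= -[RHS]muln1 -sum_nat_const_nat; apply: eq_bigr => i _.
      by case: (i \in sigma).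
    rewrite -(card_geE _ us s_n) (big_cat_nat _ (n := ps)) ?(ltnW pn)//=.
    rewrite big_nat big1 ?add0n => [H|i /sq->//].
    by rewrite -dE -H addnK.
  - exact: (left_exchange_bound ab n1 Hg ord1 e0 gs qpn psn sq pjs jst jsmax ord3 fm3).
  - exact: (right_exchange_bound ab n1 Hg ord1 e0 gs qpen pen eq_ pje jet jemax ord5 fm5).
have signs (g : R -> R -> R) :
    (~~ odd (n - q - card_ge q sigma) /\ nonpositive_on_square a b (partial_t a b q g)) \/
    (odd (n - q - card_ge q sigma) /\ nonnegative_on_square a b (partial_t a b q g)) ->
    forall t s, t \in `[a, b] -> s \in `[a, b] -> (-1) ^+ d * partial_t a b q g t s <= 0.
  rewrite dE -signr_odd => -[[od gs] t s tI sI|[od gs] t s tI sI].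
    by rewrite (negPf od) expr0 mul1r gs.
  by rewrite od expr1 mulN1r oppr_le0 gs.
split=> [ev|od].
- have size_odd : ~~ odd (size eps) by rewrite e_sz.
  have t1 : tau = 1 by rewrite /tau -signr_odd (negPf size_odd) expr0.
  exists (- m1), (- m3), (- m5); split.
  + exact: (first_modulus_negative ab n1 ord1 fm1).
  + exact/(biggest_negative_eq ev3)/(first_modulus_negative ab n1 ord3 fm3).
  + by apply/(biggest_negative_eq ev5)/(first_modulus_negative ab n1 ord5 fm5); rewrite sz5.
  + move=> M g Hg; split=> od_d gs; rewrite in_itv/= ge_max.
      have [|] := bounds M g Hg; first by apply: signs; left.
      by rewrite t1 mul1r => -> -> ->.
    have [|] := bounds M g Hg; first by apply: signs; right.
    by rewrite t1 mul1r => -> -> ->.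
- have size_odd : odd (size eps) by rewrite e_sz.
  have t1 : tau = -1 by rewrite /tau -signr_odd size_odd expr1.
  exists m1, m3, m5; split.
  + exact: (first_modulus_positive ab n1 ord1 fm1).
  + exact/(least_positive_eq ev3)/(first_modulus_positive ab n1 ord3 fm3).
  + by apply/(least_positive_eq ev5)/(first_modulus_positive ab n1 ord5 fm5); rewrite sz5.
  + move=> M g Hg; split=> od_d gs; rewrite in_itv/= le_min.
      have [|] := bounds M g Hg; first by apply: signs; left.
      by rewrite t1 mulN1r !lerN2 ltrN2 => -> -> ->.
    have [|] := bounds M g Hg; first by apply: signs; right.
    by rewrite t1 mulN1r !lerN2 ltrN2 => -> -> ->.
Qed.
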